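(* For $n\ge1$, the number $s(n)$ of smooth positroids on ground set $[n]$ is $$s(n)=\frac1{(n+1)!}\sum_{k=1}^n (n+1)_k\, b_{n,k}=\sum_{k=1}^n\frac{b_{n,k}}{(n-k+1)!}.$$
   Context: $[n]=\{1,\dots,n\}$ and $(m)_k=m(m-1)\cdots(m-k+1)$ is the falling factorial. The partial Bell polynomial is $B_{n,k}(x_1,\dots,x_{n-k+1})=\sum_{B_1\sqcup\dots\sqcup B_k}\prod_{i=1}^k x_{|B_i|}$, summed over all set partitions of $[n]$ into $k$ (nonempty) blocks. Put $s_c(1)=2$ and $s_c(i)=i-1$ for $i>1$, and define, for $1\le k\le n$, $b_{n,k}=B_{n,k}(x_1,\dots,x_{n-k+1})$ evaluated at $x_i=s_c(i)\cdot i!$, that is $b_{n,k}=B_{n,k}(2\cdot1!,\,1\cdot2!,\,2\cdot3!,\dots,(n-k)\cdot(n-k+1)!)$. A positroid of rank $r$ on $[n]$ ($0\le r\le n$) is a matroid whose set of bases is $\mathcal M=\{J\in\binom{[n]}{r}:\Delta_J(A)\neq0\}$ for some real full rank $r\times n$ matrix $A$ all of whose maximal minors $\Delta_J(A)$ are $\ge0$. The positroid variety $\Pi_{\mathcal M}$ is the subvariety of the complex Grassmannian $Gr(r,n)$ (points = row spans of full rank complex $r\times n$ matrices) defined by $\Delta_I=0$ for all $I\in\binom{[n]}{r}\setminus\mathcal M$; these $\Delta_I$ are known to generate its vanishing ideal. A point represented by $A$ is singular if the Jacobian matrix $(\partial\Delta_I/\partial x_{ij})$, with rows $I\in\binom{[n]}{r}\setminus\mathcal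 M$ and columns indexed by the matrix entries $x_{ij}$, evaluated at $A$, has rank strictly smaller than the codimension of $\Pi_{\mathcal M}$ in $Gr(r,n)$; $\Pi_{\mathcal M}$ is smooth if it has no singular points. A positroid is smooth if its positroid variety is smooth. $s(n)$ is the number of smooth positroids on $[n]$, of all ranks. *)

(* Defs.v *)
From mathcomp Require Import all_boot all_order all_algebra.
From mathcomp Require Import mathcomp_extra boolp classical_sets reals complex.
From mathcomp Require Import mpoly.
Set Implicit Arguments.
Unset Strict Implicit.
Unset Printing Implicit Defensive.

Import Order.TTheory GRing.Theory Num.Theory.

(* The ground set is 'I_n = {0, ..., n - 1} with its usual order. *)

Definition bell (n k : nat) (x : nat -> nat) : nat :=
  \sum_(P : {set {set 'I_n}} | finset.partition P finset.setT && (#|P| == k))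
    \prod_(B in P) x #|B|.

(* The index 0 is never used: blocks are nonempty. *)
Definition s_c (i : nat) : nat := if i == 1 then 2 else i.-1.

Definition bell_sc (n k : nat) : nat := bell n k (fun i => s_c i * i`!).

Notation rsubset r n := {J : {set 'I_n} | #|J| == r}.

Local Open Scope classical_set_scope.
Local Open Scope ring_scope.

(* [enum_val] lists the elements of J in increasing order. *)
Definition minor (K : comNzRingType) (r n : nat) (A : 'M[K]_(r, n))
    (J : rsubset r n) : K :=
  \det (colsub (fun k : 'I_r => enum_val (cast_ord (esym (eqP (valP J))) k)) A).

Definition is_positroid (R : realType) (r n : nat) (M : {set rsubset r n}) : Prop :=
  exists A : 'M[R]_(r, n),
    [/\ \rank A = r, forall J, 0 <= minor A J & forall J, (J \in M) = (minor A J != 0)].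

Section Variety.
Variables (R : realType) (r n : nat).
Local Notation C := (R[i]).

(* The matrix <<A>>%MS is a canonical generator of the row space of A, so that
   <<A>>%MS = <<B>>%MS if and only if A and B have the same row span: the points
   of Gr(r, n) are the matrices <<A>>%MS for A of full rank. *)
Definition Gr : set 'M[C]_n :=
  [set U | exists2 A : 'M[C]_(r, n), \rank A = r & U = <<A>>%MS].

Definition pvar (M : {set rsubset r n}) : set 'M[C]_n :=
  [set U | exists A : 'M[C]_(r, n),
     [/\ \rank A = r, U = <<A>>%MS & forall I, I \notin M -> minor A I = 0]].

Definition plucker (A : 'M[C]_(r, n)) (k : 'I_#|{: rsubset r n}|) : C :=
  minor A (enum_val k).

(* Zariski topology of Gr(r, n), as a subspace of projective space under the
   Pluecker embedding. *)
Definition zclosed (Z : set 'M[C]_n) : Prop :=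
  exists F : set {mpoly C[#|{: rsubset r n}|]},
    (forall f, F f -> exists d : nat, f \is d.-homog) /\
    Z = [set U | exists A : 'M[C]_(r, n),
           [/\ \rank A = r, U = <<A>>%MS & forall f, F f -> f.@[plucker A] = 0]].

Definition irreducible_closed (Z : set 'M[C]_n) : Prop :=
  [/\ zclosed Z, Z !=set0 &
      forall Z1 Z2, zclosed Z1 -> zclosed Z2 -> Z `<=` Z1 `|` Z2 ->
        Z `<=` Z1 \/ Z `<=` Z2].

Definition chain_length (Y : set 'M[C]_n) (k : nat) : Prop :=
  exists Z : nat -> set 'M[C]_n,
    (forall i, (i <= k)%N -> irreducible_closed (Z i) /\ Z i `<=` Y) /\
    (forall i, (i < k)%N -> Z i `<` Z i.+1).

(* The lengths of chains in Gr(r, n) are bounded (by r (n - r)), so this supremum is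
   the Krull dimension and the default 0 only matters for the empty set. *)
Definition krull_dim (Y : set 'M[C]_n) : nat := supremum 0%N [set k | chain_length Y k].

Definition codim (Y : set 'M[C]_n) : nat := (krull_dim Gr - krull_dim Y)%N.

Definition generic_mx : 'M[{mpoly C[r * n]}]_(r, n) :=
  \matrix_(i, j) 'X_(mxvec_index i j).

Definition jacobian (M : {set rsubset r n}) (A : 'M[C]_(r, n))
    : 'M[C]_(#|~: M|, r * n) :=
  \matrix_(k, l) ((minor generic_mx (enum_val k))^`M(l)).@[mxvec A 0].

Definition singular_at (M : {set rsubset r n}) (A : 'M[C]_(r, n)) : Prop :=
  (\rank (jacobian M A) < codim (pvar M))%N.

Definition smooth (M : {set rsubset r n}) : Prop :=
  forall A : 'M[C]_(r, n), \rank A = r -> pvar M <<A>>%MS -> ~ singular_at M A.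

End Variety.

Definition num_smooth_positroids (R : realType) (n : nat) : nat :=
  (\sum_(r < n.+1)
     #|[set M : {set rsubset r n} | `[< is_positroid R M /\ smooth R M >]]%SET|)%N.

(* Main.v *)
(* A smooth positroid is a direct sum of uniform matroids along a noncrossing
   set partition; the formula counts such partitions, with one summand U(k, m),
   0 < k < m, for every block of size m > 1 and a loop or a coloop for every
   singleton.

   At the coordinate point of a basis J the Jacobian has rank r (n - r) - d(J),
   where d(J) is the number of bases that differ from J by one exchange.  So
   smoothness forces d(J) <= dim for every basis J.  On an irreducible
   subvariety of maximal dimension, let N be the set of the Pluecker coordinates
   that do not vanish identically.  For J in N, the chart of J has at most d(J)
   nonzero coordinates, hence dim <= d(J), with strict inequality if these
   coordinates satisfy a polynomial relation or if N misses a neighbor of J.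
   Therefore N consists of all bases and the chart coordinates of every basis are
   free.  Freeness at neighboring bases makes the exchange graph of each basis a
   disjoint union of complete bipartite graphs, whose components are the blocks of
   the direct sum.

   Positivity of the minors, compared with those of a Vandermonde matrix, excludes
   crossing blocks; conversely, a block Vandermonde matrix whose columns are
   suitably signed realizes every noncrossing direct sum.

   Removing the block with the largest minimum shows that noncrossing partitions
   are weighted like ballot sequences, which the cycle lemma counts by the
   coefficients of the powers of 1 + sum_i x_i t^i. *)

(* The variety of a positroid is not assumed irreducible, and its dimension is a supremum of lengths
   of chains of closed sets, so every bound has to come from chains. Consecutive members of a chain
   are separated by a form that vanishes on the smaller one only; dividing these forms by powers of
   one coordinate gives as many algebraically independent ratios as the chain has steps. In the
   chart of a basis the ratios become quotients of polynomials in the free entries, and a count of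
   monomials shows that there are at most as many of them as entries. Primality is available for
   homogeneous forms only, so all relations are kept homogeneous. The top of a longest chain serves
   as the irreducible subvariety of maximal dimension. The other obstacle is signs: exchanging a
   column in place leaves the column list unsorted. Multiplying a minor by the ordinary Vandermonde
   minor on the same list cancels the sorting sign, because the latter is positive on sorted
   lists. *)
Require Import Defs.
From mathcomp Require Import boolp classical_sets complex mpoly.
From mathcomp Require Import all_boot all_order all_fingroup all_algebra reals.
From mathcomp Require Import zify ring.
Set Implicit Arguments.
Unset Strict Implicit.
Unset Printing Implicit Defensive.
Import Order.TTheory GRing.Theory Num.Theory.
Local Open Scope ring_scope.

(** * Ballot sequences and partition sums *)

Section LukasiewiczCount.
Variables (x : nat -> nat) (L : nat).

Definition step_weight (i : nat) : rat := if i == 0%N then 1 else (x i)%:R.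
Definition part_poly : {poly rat} :=
  \poly_(i < L.+1) (if i == 0%N then 0 else (x i)%:R).
Definition step_poly : {poly rat} := 1 + part_poly.

Lemma coef_step_poly d : (d <= L)%N -> step_poly`_d = step_weight d.
Proof.
move=> dL; rewrite coefD coef1 coef_poly ltnS dL /step_weight.
by case: d {dL} => [|d]; rewrite ?addr0 ?add0r.
Qed.

Lemma coef_step_polyXS m s : (s <= L)%N ->
  (step_poly ^+ m.+1)`_s = \sum_(d < s.+1) step_weight d * (step_poly ^+ m)`_(s - d).
Proof.
move=> sL; rewrite exprS coefM; apply: eq_bigr => d _.
by rewrite coef_step_poly // (leq_trans _ sL) // -ltnS.
Qed.

(** Compare the coefficients of t^(s-1) in (S^(m+1))' = (m+1) S' S^m, with S = [step_poly]. *)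
Lemma deriv_step_polyX m s : (s <= L)%N ->
  (\sum_(d < s.+1) d%:R * step_weight d * (step_poly ^+ m)`_(s - d)) * m.+1%:R =
  s%:R * (step_poly ^+ m.+1)`_s.
Proof.
case: s => [|s] sL; first by rewrite big_ord1 /= !mul0r.
have /(congr1 (fun p : {poly rat} => p`_s)) := deriv_exp step_poly m.+1.
rewrite coef_deriv coefMn coefM /= => H.
rewrite big_ord_recl /= !mul0r add0r mulr_natr [RHS]mulr_natl H; congr (_ *+ _).
apply: eq_bigr => d _; rewrite coef_deriv coef_step_poly //; last first.
  by rewrite (leq_trans _ sL) // ltn_ord.
by rewrite /bump /= ?add1n; rewrite subSS mulr_natl mulrnAl.
Qed.

(* Total weight of the sequences (d_1, ..., d_m) for which h + sum (d_i - 1)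
   vanishes for the first time after m steps; the value is the cycle lemma. *)
Definition first_passage (m h : nat) : rat :=
  if (h <= m)%N then h%:R / m%:R * (step_poly ^+ m)`_(m - h) else 0.

(** The first step d = w - h moves the height from h + 1 to w. The range of w depends on n only, the
    terms with w > m being zero, so that sums can be exchanged in [ballot_splice]. *)
Lemma first_passage_rec n m h : (0 < m)%N -> (m <= n)%N -> (m <= L)%N ->
  first_passage m.+1 h.+1 =
  \sum_(w < n.+1 | (h <= w)%N) step_weight (w - h) * first_passage m w.
Proof.
move=> m0 mn mL; have m0R : m%:R != 0 :> rat by rewrite pnatr_eq0 -lt0n.
rewrite {1}/first_passage ltnS; case: (leqP h m) => hm; last first.
  rewrite big1 // => w hw; rewrite /first_passage leqNgt (leq_trans hm hw) /=.
  by rewrite mulr0.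
rewrite subSS.
have mhL : (m - h <= L)%N by rewrite (leq_trans _ mL) ?leq_subr.
set s := (m - h)%N in mhL *.
have -> : \sum_(w < n.+1 | (h <= w)%N) step_weight (w - h) * first_passage m w =
   \sum_(d < s.+1) step_weight d * ((h + d)%:R / m%:R * (step_poly ^+ m)`_(s - d)).
  rewrite -(big_mkord (fun w => (h <= w)%N)
    (fun w => step_weight (w - h) * first_passage m w)).
  rewrite (big_cat_nat (n := m.+1)) //= [X in _ + X]big_nat_cond.
  rewrite [X in _ + X]big1 ?addr0; last first.
    move=> i /andP[/andP[mi _] _]; rewrite /first_passage leqNgt mi /=.
    by rewrite mulr0.
  rewrite (big_cat_nat (n := h)) //=; last exact: leq_trans hm _.
  rewrite [X in X + _]big_nat_cond [X in X + _]big1 ?add0r; last first.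
    by move=> i /andP[/andP[_ ih]]; rewrite leqNgt ih.
  rewrite -{1}[h]add0n big_addn subSn // -/s big_mkcond big_mkord /=.
  apply: eq_bigr => d _; rewrite leq_addl addnK /first_passage.
  have dS : (d <= s)%N by rewrite -ltnS.
  have -> : (d + h <= m)%N by move: dS; rewrite /s; lia.
  have -> : (m - (d + h) = s - d)%N by rewrite /s; lia.
  by rewrite [(d + h)%N]addnC.
(* [E1] and [E2] reduce both sums to the single coefficient of t^s in S^(m+1); what remains is h + s
   / (m+1) = m (h+1) / (m+1). *)
have E1 := coef_step_polyXS m mhL.
have E2 := deriv_step_polyX m mhL.
have -> : \sum_(d < s.+1) step_weight d * ((h + d)%:R / m%:R * (step_poly ^+ m)`_(s - d))
  = (h%:R * (step_poly ^+ m.+1)`_s +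
      \sum_(d < s.+1) d%:R * step_weight d * (step_poly ^+ m)`_(s - d)) / m%:R.
  rewrite E1 mulr_sumr -big_split /= mulr_suml; apply: eq_bigr => d _.
  by rewrite natrD; ring.
have m1R : m.+1%:R != 0 :> rat by rewrite pnatr_eq0.
have -> : \sum_(d < s.+1) d%:R * step_weight d * (step_poly ^+ m)`_(s - d) =
   s%:R * (step_poly ^+ m.+1)`_s / m.+1%:R.
  by rewrite -E2 mulfK.
have -> : s%:R = m%:R - h%:R :> rat by rewrite /s natrB.
rewrite -[m.+1]addn1 -[h.+1]addn1 !natrD.
rewrite -[m.+1]addn1 natrD in m1R.
by field; rewrite m0R m1R.
Qed.

(* Total weight of the sequences (d_0, ..., d_(p-1)) with d_0 + ... + d_j > j for
   all j < p and sum p + u. *)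
Fixpoint ballot (p u : nat) : rat :=
  if p is p'.+1 then \sum_(v < u.+2) step_weight (u.+1 - v) * ballot p' v
  else (u == 0%N)%:R.

Lemma first_passage0 m : first_passage m 0 = 0.
Proof. by rewrite /first_passage mul0r mul0r. Qed.

(** A path from height 1 that first reaches 0 after n + 1 steps is cut after p steps: its height is
    then u + 1 and its first part is a ballot sequence. Hence the sum is the same for every p, and p
    = n isolates [ballot n 0]. *)
Lemma ballot_splice n p : (n <= L)%N -> (p <= n)%N ->
  \sum_(u < n.+1) ballot p u * first_passage (n.+1 - p) u.+1 = first_passage n.+1 1.
Proof.
move=> nL; elim: p => [|p IHp] pn.
  rewrite big_ord_recl /= mul1r subn0 big1 ?addr0 // => i _.
  by rewrite mul0r.
rewrite -{}IHp; last exact: ltnW.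
have -> : (n.+1 - p = (n - p).+1)%N by rewrite subSn // ltnW.
rewrite subSS.
transitivity (\sum_(w < n.+1) \sum_(v < n.+1 | (v <= w)%N)
   step_weight (w - v) * ballot p v * first_passage (n - p) w); last first.
  rewrite (exchange_big_dep predT) //=; apply: eq_bigr => v _.
  rewrite (@first_passage_rec n) ?subn_gt0 ?leq_subr //; last first.
    by rewrite (leq_trans _ nL) ?leq_subr.
  by rewrite mulr_sumr; apply: eq_bigr => w _; ring.
(* The two sums differ by the shift w = u + 1: height n + 1 contributes nothing because n - p steps
   cannot descend that far, and neither does w = 0. *)
rewrite big_ord_recr /=.
have -> : first_passage (n - p) n.+1 = 0.
  by rewrite /first_passage leqNgt ltnS leq_subr.
rewrite mulr0 addr0 [RHS]big_ord_recl first_passage0 [X in _ = X + _]big1; last first.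
  by move=> i _; rewrite mulr0.
rewrite add0r; apply: eq_bigr => u _ /=.
rewrite mulr_suml /bump /= ?add1n.
rewrite -(big_mkord (fun v => (v <= u.+1)%N) (fun v => step_weight (u.+1 - v) *
  ballot p v * first_passage (n - p) u.+1)).
rewrite (big_cat_nat (n := u.+2)) //=; last by rewrite ltnS ltn_ord.
rewrite [X in _ + X]big_nat_cond [X in _ + X]big1 ?addr0; last first.
  by move=> i /andP[/andP[ui _]]; rewrite leqNgt ui.
rewrite -(big_mkord xpredT (fun v => step_weight (u.+1 - v) * ballot p v *
   first_passage (n - p) u.+1)).
rewrite big_nat [RHS]big_nat_cond; apply: eq_bigl => i.
by rewrite andbC; case: (ltnP i u.+2) => //= iu; rewrite -ltnS iu.
Qed.

Lemma coef_part_polyX k s : (s < k)%N -> (part_poly ^+ k)`_s = 0.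
Proof.
move=> sk.
have [q ->] : exists q, part_poly = q * 'X.
  exists (\poly_(i < L) (x i.+1)%:R); apply/polyP => i.
  by rewrite coefMX !coef_poly; case: i => [|i] //=; rewrite ltnS.
by rewrite exprMn_comm ?coefMXn ?sk //; apply: commr_polyX.
Qed.

Lemma ballot_cycle n : (n <= L)%N ->
  ballot n 0 = (n.+1%:R)^-1 * \sum_(k < n.+2) (part_poly ^+ k)`_n *+ 'C(n.+1, k).
Proof.
move=> nL; have := ballot_splice nL (leqnn n).
rewrite subSnn big_ord_recl big1 ?addr0; last first.
  by move=> i _; rewrite /first_passage /= mulr0.
rewrite {1}/first_passage /= divr1 mul1r expr1 coef_step_poly // mulr1 => ->.
rewrite /first_passage /= subSS subn0 mul1r; congr (_ * _).
rewrite /step_poly exprDn coef_sum; apply: eq_bigr => k _.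
by rewrite expr1n mul1r coefMn.
Qed.

End LukasiewiczCount.

(** * Set partitions weighted by block sizes *)

Section PartitionSums.
Variable T : finType.
Implicit Types (A B : {set T}) (P Q : {set {set T}}).

Lemma sum_pblock (F : {set {set T}} -> rat) A B a : a \in B -> B \subset A ->
  \sum_(P | finset.partition P A && (pblock P a == B)) F P =
  \sum_(Q | finset.partition Q (A :\: B)) F (B |: Q).
Proof.
move=> aB BA.
rewrite (reindex_onto (fun Q => B |: Q) (fun P => P :\ B)) /=; last first.
  move=> P /andP[PA /eqP pB]; rewrite finset.setD1K //.
  by rewrite -pB pblock_mem // (cover_partition PA) (subsetP BA).
apply: eq_bigl => Q; apply/idP/idP.
  case/andP=> /andP[PA /eqP pB] /eqP <-; apply: partitionD1 => //.
  by rewrite setU11.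
move=> QA.
have B0 : B != finset.set0 by apply/set0Pn; exists a.
have BQ : B \notin Q.
  apply/negP => BQ; have /subsetP/(_ a aB) := partitionS QA BQ.
  by rewrite inE aB.
have disj : [disjoint B & A :\: B] by rewrite -setI_eq0 setIDA finset.setIC -setIDA setDv setI0.
have PA := partitionU1 QA B0 disj.
rewrite -{2}(finset.setIidPr BA) setID in PA.
by rewrite PA (def_pblock (partition_trivIset PA) _ aB) ?setU11 // eqxx /= setU1K.
Qed.

Lemma sum_partition_pblock (F : {set {set T}} -> rat) A a : a \in A ->
  \sum_(P | finset.partition P A) F P =
  \sum_(B : {set T} | (a \in B) && (B \subset A))
    \sum_(Q | finset.partition Q (A :\: B)) F (B |: Q).
Proof.
move=> aA.
rewrite (partition_big (fun P => pblock P a)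
  (fun B : {set T} => (a \in B) && (B \subset A))) /=.
  by apply: eq_bigr => B /andP[aB BA]; apply: sum_pblock.
move=> P PA; rewrite mem_pblock (cover_partition PA) aA /=.
by apply: (partitionS PA); rewrite pblock_mem // (cover_partition PA).
Qed.

Lemma sum_subset_card A (g : nat -> rat) :
  \sum_(B : {set T} | B \subset A) g #|B| = \sum_(d < #|A|.+1) g d *+ 'C(#|A|, d).
Proof.
rewrite (partition_big (fun B => inord #|B| : 'I_(#|A|.+1)) xpredT) //=.
apply: eq_bigr => d _; rewrite -cards_draws -sumr_const.
rewrite (eq_bigl [in [set B : {set T} | B \subset A & #|B| == d]]) /=.
  by apply: eq_bigr => B; rewrite inE => /andP[_ /eqP ->].
move=> B; rewrite inE; case BA: (B \subset A) => //=.
by rewrite -val_eqE /= inordK // ltnS subset_leq_card.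
Qed.

Lemma sum_pointed_subset_card A a (g : nat -> rat) : a \in A ->
  \sum_(B : {set T} | (a \in B) && (B \subset A)) g #|B| =
  \sum_(d < #|A|) g d.+1 *+ 'C(#|A|.-1, d).
Proof.
move=> aA; have cA : #|A :\ a| = #|A|.-1 by rewrite (cardsD1 a A) aA.
have A0 : (0 < #|A|)%N by apply/card_gt0P; exists a.
rewrite (reindex_onto (fun B => a |: B) (fun B => B :\ a)) /=; last first.
  by move=> B /andP[aB _]; rewrite finset.setD1K.
have := @sum_subset_card (A :\ a) (fun d => g d.+1).
rewrite cA prednK // => <-; apply: eq_big => [B|B /andP[_ /eqP H]].
  rewrite setU11 subUset sub1set aA finset.subsetD1 /=; congr andb.
  by apply/eqP/idP => [<-|aB]; rewrite ?setD11 // setU1K.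
by rewrite cardsU1 -H setD11.
Qed.

Variables (x : nat -> nat) (L : nat).

Definition ordered_weight P : rat := \prod_(B in P) (x #|B| * (#|B|)`!)%:R.

Lemma partition_neq0_notin A B Q :
  finset.partition Q (A :\: B) -> B != finset.set0 -> B \notin Q.
Proof.
move=> QA /set0Pn[a aB]; apply/negP => BQ.
by have /subsetP/(_ a aB) := partitionS QA BQ; rewrite inE aB.
Qed.

(** The exponential formula for blocks of weight x_i i!; the factor k! orders the blocks. Removing
    the block of a fixed element lowers k, and the resulting sum over block sizes is a coefficient
    of (p^(k+1))' = (k+1) p' p^k for p = [part_poly x L]. *)
Lemma sum_ordered_weight k A : (#|A| <= L)%N ->
  \sum_(P | finset.partition P A) (if #|P| == k then ordered_weight P else 0) *+ k`! =
  (part_poly x L ^+ k)`_#|A| *+ (#|A|)`!.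
Proof.
elim: k A => [|k IHk] A AL.
  have [->|[a aA]] := set_0Vmem A.
    rewrite (eq_bigl (pred1 finset.set0)) => [|P]; last by rewrite partition_set0.
    by rewrite big_pred1_eq !finset.cards0 /= /ordered_weight big_set0 expr0 coef1.
  rewrite big1 => [|P PA].
    have /set0Pn/negbTE A0 : exists b, b \in A by exists a.
    by rewrite expr0 coef1 cards_eq0 A0 mul0rn.
  case: eqP => // /eqP; rewrite cards_eq0 => /eqP P0.
  by have := cover_partition PA; rewrite P0 /cover big_set0 => A0;
     rewrite -A0 inE in aA.
have [->|[a aA]] := set_0Vmem A.
  rewrite finset.cards0 coef_part_polyX // mul0rn big1 // => P.
  by rewrite partition_set0 => /eqP ->; rewrite finset.cards0 mul0rn.
have A0 : (0 < #|A|)%N by apply/card_gt0P; exists a.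
have -> : \sum_(P | finset.partition P A)
      (if #|P| == k.+1 then ordered_weight P else 0) *+ k.+1`! =
  \sum_(B : {set T} | (a \in B) && (B \subset A))
    ((x #|B| * (#|B|)`!)%:R * ((part_poly x L ^+ k)`_(#|A| - #|B|) *+ (#|A| - #|B|)`!)) *+ k.+1.
  rewrite (sum_partition_pblock _ aA); apply: eq_bigr => B /andP[aB BA].
  have B0 : B != finset.set0 by apply/set0Pn; exists a.
  have cAB : #|A :\: B| = (#|A| - #|B|)%N by rewrite cardsD (finset.setIidPr BA).
  rewrite -cAB -IHk; last by rewrite cAB (leq_trans _ AL) // leq_subr.
  rewrite mulr_sumr -sumrMnl; apply: eq_bigr => Q QA.
  have BQ := partition_neq0_notin QA B0.
  rewrite cardsU1 BQ eqSS; case: eqP => _; last by rewrite !mul0rn mulr0 mul0rn.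
  rewrite /ordered_weight big_setU1 //= factS [(k.+1 * _)%N]mulnC mulrnA; congr (_ *+ _).
  by rewrite mulrnAr.
rewrite (@sum_pointed_subset_card A a (fun d =>
  ((x d * d`!)%:R * ((part_poly x L ^+ k)`_(#|A| - d) *+ (#|A| - d)`!)) *+ k.+1)) //.
case: #|A| A0 AL => // n _ nL.
have /(congr1 (fun p : {poly rat} => p`_n)) := deriv_exp (part_poly x L) k.+1.
rewrite coef_deriv coefMn coefM /= => H.
rewrite factS mulrnA H.
rewrite -!sumrMnl; apply: eq_bigr => d _.
rewrite coef_deriv coef_poly ltnS (leq_trans (ltn_ord d) nL) /= subSS.
(* In 'C(n, d) (d+1)! (n-d)! = (d+1) n! the factor d + 1 is the one produced by the derivative. *)
have <- : ('C(n, d) * (d`! * (n - d)`!))%N = n`! by apply: bin_fact; rewrite -ltnS.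
rewrite factS !(mulrnAr, mulrnAl) -!mulrnA. ring.
Qed.

End PartitionSums.

Lemma bell_coef (x : nat -> nat) (L n k : nat) : (n <= L)%N ->
  (bell n k (fun i => x i * i`!)%N)%:R *+ k`! = (part_poly x L ^+ k)`_n *+ n`! :> rat.
Proof.
move=> nL; have := @sum_ordered_weight 'I_n x L k finset.setT.
rewrite cardsT card_ord => <- //; rewrite /bell natr_sum.
rewrite [in LHS]big_mkcondr -sumrMnl; apply: eq_bigr => P _.
by case: eqP => _; rewrite ?mul0rn // /ordered_weight natr_prod.
Qed.

(** * Noncrossing partitions and ballot sequences *)

Section Noncrossing.
Variable n : nat.
Implicit Types (A B U : {set 'I_n}) (P Q : {set {set 'I_n}}) (t : nat).

Definition crossing B B' : Prop :=
  exists a b c d : 'I_n, [/\ a \in B, b \in B', c \in B & d \in B'] /\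
    [/\ (a < b)%N, (b < c)%N & (c < d)%N].

Definition noncrossing P : bool :=
  `[< {in P &, forall B B', crossing B B' -> B = B'} >].

Definition opens_before t P : bool := [forall B in P, exists a in B, (a < t)%N].

Definition initial U B : Prop :=
  B \subset U /\ forall x y, x \in B -> y \in U -> (y < x)%N -> y \in B.

Lemma initial_inj U B B' : initial U B -> initial U B' -> #|B| = #|B'| -> B = B'.
Proof.
wlog [x xB xB'] : B B' / exists2 x, x \in B & x \notin B'.
  move=> IH iB iB' c; have [BB'|/subsetPn[x xB xB']] := boolP (B \subset B').
    by apply/eqP; rewrite eqEcard BB' c leqnn.
  by apply: IH => //; exists x.
move=> [BU iB] [BU' iB'] c; symmetry; apply/eqP; rewrite eqEcard c leqnn andbT.
apply/subsetP => y yB'; have [xy|yx|/val_inj xy] := ltngtP x y.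
- by rewrite (iB' y x) ?(subsetP BU) in xB'.
- by apply: (iB x y) => //; apply: (subsetP BU').
- by rewrite xy yB' in xB'.
Qed.

Lemma initial_exists U d : (d <= #|U|)%N -> exists2 B, initial U B & #|B| = d.
Proof.
move: {2}#|U| (erefl #|U|) => m; elim: m U => [|m IH] U cU dU.
  exists U; last by apply/eqP; rewrite eq_sym cU -leqn0 -cU.
  by split=> // x y _ ->.
move: dU; rewrite leq_eqVlt => /orP[/eqP ->|dU].
  by exists U => //; split=> // x y _ ->.
have /card_gt0P[x0 x0U] : (0 < #|U|)%N by rewrite cU.
case: (@arg_maxnP _ x0 [in U] (fun i : 'I_n => i : nat) x0U) => z /= zU zmax.
have cz : #|U :\ z| = m by move: (cardsD1 z U); rewrite zU cU => -[].
have [|B [BU iB] cB] := IH (U :\ z) cz; first by rewrite cz -ltnS -cU.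
exists B => //; split; first by apply: subset_trans BU _; apply: subD1set.
move=> x y xB yU yx; apply: (iB x) => //; rewrite !inE yU andbT.
apply: contraTneq yx => ->; rewrite -leqNgt; apply: zmax.
by have := subsetP BU x xB; rewrite !inE => /andP[].
Qed.

Variable x : nat -> nat.

Definition nc_weight P : rat := \prod_(B in P) (x #|B|)%:R.

(** The threshold t carries the recursion: it is lowered to the largest element of A below it, where
    at most one block opens. *)
Definition nc_sum A t : rat :=
  \sum_(P | finset.partition P A)
    (if noncrossing P && opens_before t P then nc_weight P else 0).

Section LastOpening.
Variables (A : {set 'I_n}) (t : nat) (a : 'I_n).
Hypotheses (aA : a \in A) (a_lt : (a < t)%N)
  (amax : forall b, b \in A -> (b < t)%N -> (b <= a)%N).
Let U := [set b in A | (a <= b)%N].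

Lemma ltn_threshold b : b \in A -> b != a -> (b < t)%N = (b < a)%N.
Proof.
move=> bA ba; apply/idP/idP => [bt|]; last by move=> ba'; apply: ltn_trans ba' a_lt.
by rewrite ltn_neqAle amax // andbT.
Qed.

(** The block that fails to open before a must open at a. If it skipped an element y of U below some
    z of the block, the block of y would open at some b < a, and b < a < y < z would be a
    crossing. *)
Lemma opens_before_max_initial P : finset.partition P A -> noncrossing P ->
  opens_before t P -> ~~ opens_before a P -> initial U (pblock P a).
Proof.
move=> PA /asboolP ncP /forall_inP oP /forall_inPn[B BP /exists_inPn nB].
have tP := partition_trivIset PA.
have aB : a \in B.
  have /exists_inP[b bB bt] := oP B BP.
  have bA := subsetP (partitionS PA BP) b bB.
  have [<- //|ba] := eqVneq b a.
  by move: bt (nB b bB); rewrite ltn_threshold // => ->.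
rewrite (def_pblock tP BP aB).
have BA := partitionS PA BP.
split; first by apply/subsetP => b bB; rewrite inE (subsetP BA) // leqNgt nB.
move=> z y zB; rewrite inE => /andP[yA]; rewrite leq_eqVlt => /orP[/eqP/val_inj <- //|ay] yz.
apply: contraT => yB.
have yP : y \in cover P by rewrite (cover_partition PA).
have /exists_inP[b bY bt] := oP _ (pblock_mem yP).
have yY : y \in pblock P y by rewrite mem_pblock.
have bA := subsetP (partitionS PA (pblock_mem yP)) b bY.
have bB : pblock P y != B by apply: contraNneq yB => <-.
have ba : b != a.
  apply: contra_neq bB => ba; rewrite -(def_pblock tP BP aB) -ba.
  by apply/esym/same_pblock.
rewrite ltn_threshold // in bt.
case/eqP: bB; apply: ncP => //; first exact: pblock_mem.
by exists b, a, y, z.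
Qed.

(** No element of A outside B lies between two elements of B, so adding B creates no crossing. *)
Lemma noncrossingU1_initial B Q : finset.partition Q (A :\: B) -> initial U B ->
  a \in B ->
  noncrossing (B |: Q) && (opens_before t (B |: Q) && ~~ opens_before a (B |: Q)) =
  noncrossing Q && opens_before a Q.
Proof.
move=> QA [BU iB] aB.
have QS C c : C \in Q -> c \in C -> (c \in A) && (c \notin B).
  by move=> CQ cC; have := subsetP (partitionS QA CQ) c cC; rewrite inE andbC.
have Ba b : b \in B -> (a <= b)%N by move=> /(subsetP BU); rewrite inE => /andP[].
have betw b c y : b \in B -> c \in B -> y \in A -> (b < y)%N -> (y < c)%N -> y \in B.
  move=> bB cB yA by_ yc; apply: (iB c) => //; rewrite inE yA.
  by apply: leq_trans (ltnW by_); apply: Ba.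
have -> : noncrossing (B |: Q) = noncrossing Q.
  apply/asboolP/asboolP => nc.
    by move=> C C' CQ CQ'; apply: nc; rewrite !inE ?CQ ?CQ' orbT.
  move=> C C'; rewrite !inE.
  move=> /orP[/eqP ->|CQ] /orP[/eqP ->|CQ'] //; last exact: nc.
    move=> [p [q [r [s [[pB qC rB sC] [pq qr rs]]]]]].
    have /andP[qA /negP[]] := QS _ _ CQ' qC.
    exact: (betw p r).
  move=> [p [q [r [s [[pB qC rB sC] [pq qr rs]]]]]].
  have /andP[qA /negP[]] := QS _ _ CQ rB.
  exact: (betw q s).
congr andb.
have -> : ~~ opens_before a (B |: Q).
  apply/forall_inPn; exists B; rewrite ?setU11 //.
  by apply/exists_inPn => b /Ba; rewrite leqNgt.
rewrite andbT; apply/forall_inP/forall_inP => o C CQ.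
  have /exists_inP[c cC ct] : [exists c in C, (c < t)%N] by apply: o; rewrite inE CQ orbT.
  apply/exists_inP; exists c => //; have /andP[cA cB] := QS _ _ CQ cC.
  by rewrite -ltn_threshold //; apply: contraNneq cB => ->.
apply/exists_inP; move: CQ; rewrite !inE => /orP[/eqP -> |CQ]; first by exists a.
by have /exists_inP[c cC ca] := o C CQ; exists c => //; apply: ltn_trans ca a_lt.
Qed.

(* A block whose minimum is the largest among all blocks is an interval of A. *)
Lemma nc_sum_rec : nc_sum A t = nc_sum A a +
  \sum_(B | `[< initial U B >] && (a \in B)) (x #|B|)%:R * nc_sum (A :\: B) a.
Proof.
rewrite {1}/nc_sum.
transitivity (nc_sum A a + \sum_(P | finset.partition P A)
   (if noncrossing P && (opens_before t P && ~~ opens_before a P)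
    then nc_weight P else 0)).
  rewrite -big_split /=; apply: eq_bigr => P PA.
  case: (noncrossing P) => /=; last by rewrite addr0.
  case oa: (opens_before a P); last by rewrite andbT add0r.
  have -> : opens_before t P; last by rewrite addr0.
  apply/forall_inP => B BP; have /exists_inP[b bB ba] := forall_inP oa B BP.
  by apply/exists_inP; exists b => //; apply: ltn_trans ba a_lt.
congr (_ + _); rewrite (sum_partition_pblock _ aA).
rewrite (bigID (fun B => `[< initial U B >])) /= [X in _ + X]big1 ?addr0; last first.
  move=> B /andP[/andP[aB BA] /asboolP nB]; apply: big1 => Q QA.
  have B0 : B != finset.set0 by apply/set0Pn; exists a.
  have disj : [disjoint B & A :\: B].
    by rewrite -setI_eq0 setIDA finset.setIC -setIDA setDv setI0.
  have PA := partitionU1 QA B0 disj.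
  rewrite -{2}(finset.setIidPr BA) setID in PA.
  case: ifP => // /and3P[nc ot oa]; case: nB.
  have := opens_before_max_initial PA nc ot oa.
  by rewrite (def_pblock (partition_trivIset PA) _ aB) // setU11.
apply: eq_big => [B|B].
  rewrite andbC; case iB: `[< _ >] => //=; case aB: (a \in B) => //=.
  move/asboolP: iB => [BU _]; apply/subsetP => b /(subsetP BU).
  by rewrite inE => /andP[].
move=> /andP[/andP[aB BA] /asboolP iB].
rewrite /nc_sum mulr_sumr; apply: eq_bigr => Q QA.
rewrite noncrossingU1_initial //; case: ifP => _; last by rewrite mulr0.
rewrite /nc_weight big_setU1 //; apply: (partition_neq0_notin QA).
by apply/set0Pn; exists a.
Qed.

End LastOpening.

(** Each entry of the ballot sequence is the size of the block that opens at the corresponding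
    element of A, or 0 if none opens there. The ballot condition says that the blocks opened so far
    have room for all elements passed so far. *)
Lemma nc_sum_ballot p u A t : #|[set a in A | (a < t)%N]| = p -> #|A| = (p + u)%N ->
  nc_sum A t = ballot x p u.
Proof.
elim: p u A t => [|p IHp] u A t cp cA.
  move/cards0_eq: cp => A_t; rewrite add0n in cA.
  have nobef P : finset.partition P A -> opens_before t P = (P == finset.set0).
    move=> PA; apply/forall_inP/eqP => [o|-> B]; last by rewrite inE.
    apply/setP => B; rewrite in_set0; apply/negP => BP.
    have /exists_inP[b bB bt] := o B BP.
    have : b \in [set a in A | (a < t)%N].
      by rewrite inE bt andbT (subsetP (partitionS PA BP)).
    by rewrite A_t inE.
  have [A0|[a aA]] := set_0Vmem A.
    rewrite /= -cA A0 finset.cards0 eqxx /nc_sum.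
    rewrite (eq_bigl (pred1 finset.set0)) => [|P]; last by rewrite partition_set0.
    rewrite big_pred1_eq /nc_weight big_set0.
    have -> : noncrossing finset.set0 by apply/asboolP => B B'; rewrite inE.
    by rewrite nobef ?eqxx // A0 partition_set0.
  have u0 : u != 0%N by rewrite -cA; apply/eqP => /cards0_eq A0; rewrite A0 inE in aA.
  rewrite /= (negbTE u0) /nc_sum big1 // => P PA; rewrite nobef //.
  case: eqP => [P0|]; last by rewrite andbF.
  by have := cover_partition PA; rewrite P0 /cover big_set0 => A0; rewrite -A0 inE in aA.
have /card_gt0P[x0 x0U] : (0 < #|[set a in A | (a < t)%N]|)%N by rewrite cp.
case: (@arg_maxnP _ x0 [in [set a in A | (a < t)%N]] (fun i : 'I_n => i : nat) x0U).
move=> a /= ; rewrite inE => /andP[aA a_lt] amax.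
have amax' b : b \in A -> (b < t)%N -> (b <= a)%N.
  by move=> bA bt; apply: amax; rewrite inE bA.
have cpa : #|[set b in A | (b < a)%N]| = p.
  have : #|[set b in A | (b < t)%N] :\ a| = p.
    by move: (cardsD1 a [set b in A | (b < t)%N]); rewrite cp inE aA a_lt => -[].
  move=> <-; apply: eq_card => b; rewrite !inE.
  have [->|ba] := eqVneq b a; first by rewrite ltnn andbF.
  by case bA: (b \in A) => //=; rewrite (ltn_threshold a_lt amax').
set U := [set b in A | (a <= b)%N].
have cU : #|U| = u.+1.
  have := cardsID [set b : 'I_n | (b < a)%N] A; rewrite cA.
  have -> : A :&: [set b : 'I_n | (b < a)%N] = [set b in A | (b < a)%N].
    by apply/setP => b; rewrite !inE.
  have -> : A :\: [set b : 'I_n | (b < a)%N] = U.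
    by apply/setP => b; rewrite !inE -leqNgt andbC.
  by rewrite cpa addSnnS => /eqP; rewrite eqn_add2l => /eqP.
rewrite (nc_sum_rec aA a_lt amax') -/U /= big_ord_recr /= addrC subnn /=.
have -> : step_weight x 0 = 1 by [].
rewrite mul1r; congr (_ + _); first by apply: IHp => //; rewrite cA; lia.
(* After the reversal, d stands for block size d + 1, and U has exactly one initial segment of that
   size. *)
rewrite (reindex_inj rev_ord_inj) /=.
rewrite (partition_big (fun B => inord #|B|.-1 : 'I_u.+1) xpredT) //=.
apply: eq_bigr => d _.
have dU : (d.+1 <= #|U|)%N by rewrite cU ltn_ord.
have [B0 iB0 cB0] := initial_exists dU.
have aU : a \in U by rewrite inE aA leqnn.
have aB0 : a \in B0.
  have /card_gt0P[b bB] : (0 < #|B0|)%N by rewrite cB0.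
  have := subsetP iB0.1 b bB; rewrite inE => /andP[bA].
  rewrite leq_eqVlt => /orP[/eqP/val_inj -> //|ab].
  exact: (iB0.2 b).
rewrite (big_pred1 B0) => [|B] /=.
  have -> : (u.+1 - (u.+1 - d.+1) = d.+1)%N by have := ltn_ord d; lia.
  rewrite /step_weight /= cB0; congr (_ * _); apply: IHp.
    rewrite -cpa; apply: eq_card => b; rewrite !inE.
    case bB0: (b \in B0) => //=; have := subsetP iB0.1 b bB0.
    by rewrite inE ltnNge => /andP[_ ->]; rewrite andbF.
  have B0A : B0 \subset A.
    by apply: subset_trans iB0.1 _; apply/subsetP => b; rewrite inE => /andP[].
  by rewrite cardsD (finset.setIidPr B0A) cB0 cA; have := ltn_ord d; lia.
apply/idP/eqP => [/andP[/andP[/asboolP iB aB] /eqP dB]|->].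
  apply: (initial_inj iB iB0); rewrite cB0.
  have cB : (0 < #|B|)%N by apply/card_gt0P; exists a.
  have BU : (#|B| <= u.+1)%N by rewrite -cU subset_leq_card //; case: iB.
  have Bu : (#|B|.-1 < u.+1)%N by rewrite prednK.
  move/(congr1 val): dB; rewrite [LHS]inordK // => <-.
  by rewrite prednK.
apply/andP; split; first by apply/andP; split=> //; apply/asboolP.
by rewrite cB0 /= inord_val.
Qed.

Lemma sum_noncrossing (hn : (0 < n)%N) :
  \sum_(P | finset.partition P finset.setT && noncrossing P) nc_weight P =
  \sum_(1 <= k < n.+1) (bell n k (fun i => x i * i`!)%N)%:R / (n - k + 1)`!%:R.
Proof.
transitivity (nc_sum finset.setT n).
  rewrite /nc_sum big_mkcondr /=; apply: eq_bigr => P PA.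
  rewrite (_ : opens_before n P) ?andbT //; apply/forall_inP => B BP.
  have /set0Pn[b bB] := partition_neq0 PA BP.
  by apply/exists_inP; exists b.
rewrite (@nc_sum_ballot n 0); last 2 first.
- by rewrite -[RHS](card_ord n) -cardsT; apply: eq_card => b; rewrite !inE ltn_ord.
- by rewrite cardsT card_ord addn0.
rewrite (ballot_cycle x (leqnn n)).
(* The terms k = n + 1 and k = 0 vanish: the (n+1)-st power of [part_poly] has no term of degree n,
   and n > 0. For the others the claim is 'C(n+1, k) k! / (n+1)! = 1 / (n+1-k)!. *)
rewrite big_ord_recr /= coef_part_polyX // mul0rn addr0 big_ord_recl /=.
rewrite expr0 coef1 eqn0Ngt hn mul0rn add0r mulr_sumr.
rewrite big_add1 /= big_mkord; apply: eq_bigr => k _.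
rewrite /bump /= add1n.
have := @bell_coef x n n k.+1 (leqnn n).
set b := bell _ _ _; set c := _`_n => E.
have kn : (k.+1 <= n.+1)%N by rewrite ltnS ltnW.
have F := bin_fact kn.
have -> : (n - k.+1 + 1 = n.+1 - k.+1)%N by have := ltn_ord k; lia.
have nz m : m`!%:R != 0 :> rat by rewrite pnatr_eq0 -lt0n fact_gt0.
have -> : b%:R = c * n`!%:R / k.+1`!%:R.
  apply: (canRL (mulfK (nz _))). by rewrite !mulr_natr E.
have -> : (n.+1%:R)^-1 = n`!%:R / (n.+1)`!%:R :> rat.
  by rewrite factS natrM invfM mulrA mulrAC mulrV ?mul1r // unitfE.
rewrite -[c *+ _]mulr_natr.
have -> : (n.+1)`!%:R = 'C(n.+1, k.+1)%:R * ((k.+1)`!%:R * (n.+1 - k.+1)`!%:R) :> rat.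
  by rewrite -F natrM (natrM _ (k.+1)`!).
have C0 : 'C(n.+1, k.+1)%:R != 0 :> rat by rewrite pnatr_eq0 -lt0n bin_gt0.
move: C0 (nz k.+1) (nz (n.+1 - k.+1)%N).
move: ('C(n.+1, k.+1)%:R) ((k.+1)`!%:R) ((n.+1 - k.+1)`!%:R) => C f1 f2 C0 f10 f20.
by field; rewrite C0 f10 f20.
Qed.

End Noncrossing.

(** * Minors and block Vandermonde matrices *)

Section ColumnMinors.
Variables (K : comNzRingType) (r n : nat).
Implicit Types (A : 'M[K]_(r, n)) (f g : 'I_r -> 'I_n) (J : rsubset r n).

(** Arbitrary column lists are allowed because an exchange in place need not keep the list sorted,
    as it is in [minor]. *)
Definition cminor A f : K := \det (colsub f A).

Definition subset_enum J (k : 'I_r) : 'I_n :=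
  enum_val (cast_ord (esym (eqP (valP J))) k).

Definition swap f (p : 'I_r) (l : 'I_n) (q : 'I_r) : 'I_n :=
  if q == p then l else f q.

Lemma minorE A J : minor A J = cminor A (subset_enum J).
Proof. by []. Qed.

Lemma subset_enum_inj J : injective (subset_enum J).
Proof. by move=> i j /enum_val_inj/cast_ord_inj. Qed.

Lemma subset_enum_in J k : subset_enum J k \in val J.
Proof. exact: enum_valP. Qed.

Lemma imset_subset_enum J : subset_enum J @: 'I_r = val J.
Proof.
apply/eqP; rewrite eqEcard card_imset ?card_ord ?(eqP (valP J)) ?leqnn ?andbT; last first.
  exact: subset_enum_inj.
by apply/subsetP => _ /imsetP[k _ ->]; apply: subset_enum_in.
Qed.

Lemma subset_enumP J x : x \in val J -> exists k, x = subset_enum J k.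
Proof. by rewrite -imset_subset_enum => /imsetP[k _ ->]; exists k. Qed.

Lemma swap_inj f p l : injective f -> (forall q, q != p -> f q != l) -> injective (swap f p l).
Proof.
move=> fI fl i j; rewrite /swap; case: eqP => [->|/eqP ip]; case: eqP => [->|/eqP jp] //.
- by move=> H; have := fl j jp; rewrite H eqxx.
- by move=> H; have := fl i ip; rewrite H eqxx.
- exact: fI.
Qed.

Lemma eq_cminor A f g : f =1 g -> cminor A f = cminor A g.
Proof. by move=> fg; congr (\det _); apply: eq_colsub. Qed.

Lemma cminor_perm A f (s : 'S_r) : cminor A (f \o s) = (-1) ^+ s * cminor A f.
Proof. by rewrite /cminor colsub_comp -col_permEsub col_permE det_mulmx det_perm mulrC
  odd_permV. Qed.

Lemma cminor_noninj A f p q : p != q -> f p = f q -> cminor A f = 0.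
Proof.
move=> pq fpq; rewrite /cminor -det_tr (determinant_alternate pq) // => i.
by rewrite !mxE fpq.
Qed.

Lemma cminor_mul (g : 'M[K]_r) A f : cminor (g *m A) f = \det g * cminor A f.
Proof. by rewrite /cminor -det_mulmx mulmx_colsub. Qed.

(** Cramer's rule, by expansion along column p. *)
Lemma cminor_swap A f p l : cminor A (swap f p l) = (\adj (colsub f A) *m A) p l.
Proof.
rewrite /cminor (expand_det_col _ p) mxE; apply: eq_bigr => i _.
rewrite !mxE /swap eqxx mulrC; congr (_ * _).
rewrite /cofactor; congr (_ * _); congr (\det _); apply/matrixP => a b.
by rewrite !mxE eq_sym (negbTE (neq_lift _ _)).
Qed.

Lemma cminor_neq0_perm A f : cminor A f != 0 -> exists s : 'S_r, forall i, A i (f (s i)) != 0.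
Proof.
move=> nz; apply: contrapT => nH; case/eqP: nz.
rewrite /cminor /determinant big1 // => s _.
have [i /eqP E] : exists i, A i (f (s i)) == 0.
  by apply: contrapT => H; apply: nH; exists s => i; apply/negP => E; apply: H; exists i.
by rewrite (bigD1 i) //= !mxE E mul0r mulr0.
Qed.

End ColumnMinors.

Lemma same_image_perm (r n : nat) (f g : 'I_r -> 'I_n) : injective f -> injective g ->
  f @: 'I_r = g @: 'I_r -> exists s : 'S_r, f =1 g \o s.
Proof.
move=> fI gI fg.
have H i : {j | g j == f i}.
  apply: sigW; have : f i \in g @: 'I_r by rewrite -fg imset_f.
  by case/imsetP => j _ ->; exists j.
have sI : injective (fun i => sval (H i)).
  move=> i j /= ; case: (H i) (H j) => [a /= /eqP ga] [b /= /eqP gb] ab.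
  by apply: fI; rewrite -ga -gb ab.
exists (perm sI) => i /=; rewrite permE; apply/esym/eqP.
exact: (svalP (H i)).
Qed.

Lemma cminor_cross (K L : comNzRingType) (r n : nat) (h : {rmorphism K -> L})
  (A : 'M[K]_(r, n)) (B : 'M[L]_(r, n)) (f g : 'I_r -> 'I_n) :
  injective f -> injective g -> f @: 'I_r = g @: 'I_r ->
  h (cminor A f) * cminor B g = h (cminor A g) * cminor B f.
Proof.
move=> fI gI /(same_image_perm fI gI)[s fs].
rewrite (eq_cminor A fs) (eq_cminor B fs) !cminor_perm rmorphM rmorph_sign.
by rewrite mulrAC mulrC.
Qed.

Lemma card_rsubset_image (r n : nat) (f : 'I_r -> 'I_n) : injective f -> #|f @: 'I_r| == r.
Proof. by move=> fI; rewrite card_imset // card_ord. Qed.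

Definition image_subset (r n : nat) (f : 'I_r -> 'I_n) (fI : injective f) : rsubset r n :=
  exist _ (f @: 'I_r) (card_rsubset_image fI).

Lemma minor_image_eq0 (K : comNzRingType) (r n : nat) (A : 'M[K]_(r, n))
    (f : 'I_r -> 'I_n) (fI : injective f) :
  (minor A (image_subset fI) == 0) = (cminor A f == 0).
Proof.
have /same_image_perm[|//|s fs] : subset_enum (image_subset fI) @: 'I_r = f @: 'I_r.
- by rewrite imset_subset_enum.
- exact: subset_enum_inj.
by rewrite minorE (eq_cminor A fs) cminor_perm mulr_sign; case: (s : bool);
   rewrite ?oppr_eq0.
Qed.

(** * Minors of block Vandermonde matrices *)

Section BlockVandermonde.
Variables (F : numFieldType) (T : eqType) (r n : nat).
Variables (row_label : 'I_r -> T) (label : 'I_n -> T).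
Implicit Types (f : 'I_r -> 'I_n).

(** The rows of one label receive the exponents 0, 1, 2, ... in order and so form a Vandermonde
    block. *)
Definition row_degree (i : 'I_r) : nat :=
  #|[set i' : 'I_r | (i' < i)%N && (row_label i' == row_label i)]|.

Definition block_vandermonde : 'M[F]_(r, n) :=
  \matrix_(i, x) if row_label i == label x then (x : nat)%:R ^+ row_degree i else 0.

Definition label_matched f := exists s : 'S_r, forall i, row_label i = label (f (s i)).

Lemma row_degree_lt (i i' : 'I_r) : (i < i')%N -> row_label i = row_label i' ->
  (row_degree i < row_degree i')%N.
Proof.
move=> ii' ll; apply: proper_card; apply/properP; split.
  apply/subsetP => j; rewrite !inE => /andP[ji jl].
  by rewrite (ltn_trans ji ii') -ll.
by exists i; rewrite !inE ?ltnn // ii' ll /=.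
Qed.

Lemma row_degree_inj (i i' : 'I_r) :
  row_label i = row_label i' -> row_degree i = row_degree i' -> i = i'.
Proof.
move=> ll ee; have [ii'|ii'|/val_inj //] := ltngtP i i'.
- by have := row_degree_lt ii' ll; rewrite ee ltnn.
- by have := row_degree_lt ii' (esym ll); rewrite ee ltnn.
Qed.

Lemma row_degree_bound i : (row_degree i < #|[set i' | row_label i' == row_label i]|)%N.
Proof.
apply: proper_card; apply/properP; split.
  by apply/subsetP => j; rewrite !inE => /andP[].
by exists i; rewrite !inE ?ltnn.
Qed.

Definition block_poly (t : T) (u : 'I_r -> F) : {poly F} :=
  \sum_(i | row_label i == t) u i *: 'X^(row_degree i).

Lemma size_block_poly t u : (size (block_poly t u) <= #|[set i | row_label i == t]|)%N.
Proof.
apply: (leq_trans (size_sum _ _ _)); apply/bigmax_leqP => i /eqP it.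
apply: (leq_trans (size_scale_leq _ _)); rewrite size_polyXn -it.
exact: row_degree_bound.
Qed.

Lemma coef_block_poly u i : (block_poly (row_label i) u)`_(row_degree i) = u i.
Proof.
rewrite coef_sum (bigD1 i) //= coefZ coefXn eqxx mulr1 big1 ?addr0 // => j /andP[/eqP jl ji].
rewrite coefZ coefXn; case: eqP => [ee|]; last by rewrite mulr0.
by case/eqP: ji; apply: row_degree_inj.
Qed.

Lemma horner_block_poly u x :
  (block_poly (label x) u).[(x : nat)%:R] = \sum_i u i * block_vandermonde i x.
Proof.
rewrite horner_sum big_mkcond /=; apply: eq_bigr => i _; rewrite mxE.
by case: eqP; rewrite ?mulr0 // hornerZ hornerXn.
Qed.

Lemma card_label_matched f t : label_matched f ->
  #|[set i | row_label i == t]| = #|[set p | label (f p) == t]|.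
Proof.
move=> [s H]; rewrite -[RHS](card_preimset _ (@perm_inj _ s)).
by apply: eq_card => i; rewrite !inE H.
Qed.

Lemma block_vandermonde_matched f : cminor block_vandermonde f != 0 -> label_matched f.
Proof.
case/cminor_neq0_perm => s H; exists s => i; move: (H i); rewrite mxE.
by case: (row_label i =P _) => //; rewrite eqxx.
Qed.

(** A vector of the left kernel gives for each label a polynomial of degree less than the number of
    rows of that label, with as many distinct roots as there are such rows. *)
Lemma cminor_block_vandermonde f : injective f -> label_matched f ->
  cminor block_vandermonde f != 0.
Proof.
move=> fI fm; apply/negP => /det0P[v v0 vZ].
case/negP: v0; apply/eqP/rowP => i; rewrite mxE -[LHS](coef_block_poly (v 0)).
set P := block_poly _ _; rewrite (_ : P = 0) ?coef0 //.
pose S := [set p | label (f p) == row_label i].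
apply: (@roots_geq_poly_eq0 _ _ [seq (f p : nat)%:R | p <- enum S]).
- apply/allP => _ /mapP[p pS ->]; rewrite mem_enum inE in pS.
  apply/rootP; rewrite /P -(eqP pS) horner_block_poly.
  move/matrixP/(_ 0 p): vZ; rewrite !mxE => vZ; rewrite -[RHS]vZ.
  by apply: eq_bigr => j _; rewrite !mxE.
- rewrite map_inj_uniq ?enum_uniq // => p q /eqP.
  by rewrite eqr_nat => /eqP/val_inj/fI.
- by rewrite size_map -cardE -(card_label_matched _ fm) size_block_poly.
Qed.

Lemma cminor_swap_block_vandermonde f p : injective f -> label_matched f ->
  exists c, forall l, label l = label (f p) ->
    cminor block_vandermonde (swap f p l) =
    c * \prod_(q | (q != p) && (label (f q) == label (f p))) ((l : nat)%:R - (f q : nat)%:R).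
Proof.
move=> fI fm; set t := label (f p).
set S := [set q | (q != p) && (label (f q) == t)].
set Z := colsub f block_vandermonde.
(* As a function of l, the minor is a polynomial of degree less than the size of
   the class of f p, and it vanishes at the other members of this class. *)
pose h := block_poly t ((\adj Z) p).
have hE l : label l = t -> cminor block_vandermonde (swap f p l) = h.[(l : nat)%:R].
  by move=> lt; rewrite cminor_swap mxE /h -lt horner_block_poly.
pose rs := [seq (f q : nat)%:R : F | q <- enum S].
have urs : uniq_roots rs.
  rewrite uniq_rootsE map_inj_uniq ?enum_uniq // => a b /eqP.
  by rewrite eqr_nat => /eqP/val_inj/fI.
have hrs : all (root h) rs.
  apply/allP => _ /mapP[q qS ->]; rewrite mem_enum inE in qS.
  case/andP: qS => qp /eqP ql; apply/rootP; rewrite -hE //.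
  by apply: (cminor_noninj _ qp); rewrite /swap eqxx (negbTE qp).
have /Pdiv.Field.dvdpP[w hw] := uniq_roots_dvdp hrs urs.
have cS : #|[set i | row_label i == t]| = #|S|.+1.
  rewrite (card_label_matched _ fm) (cardsD1 p) inE eqxx add1n; congr _.+1.
  by apply: eq_card => q; rewrite !inE.
have mrs : \prod_(z <- rs) ('X - z%:P) \is monic by apply: monic_prod_XsubC.
have sw : (size w <= 1)%N.
  have [->|w0] := eqVneq w 0; first by rewrite size_poly0.
  have := size_block_poly t ((\adj Z) p); rewrite -/h hw size_Mmonic //.
  by rewrite size_prod_XsubC size_map -cardE cS addnS /= -[#|S|.+1]add1n leq_add2r.
exists w`_0 => l lt; rewrite hE // hw (size1_polyC sw) hornerM hornerC coefC eqxx.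
congr (_ * _); rewrite horner_prod big_map big_enum /=.
by apply: eq_big => [q|q _]; rewrite ?inE // !hornerE.
Qed.

End BlockVandermonde.

(** A factor (a - g)(b - g) is negative exactly when g lies strictly between a and b. *)
Lemma prod_sub_sign (R : realFieldType) (I : finType) (P : pred I) (g : I -> nat) (a b : nat) :
  (forall q, P q -> g q != a) -> (forall q, P q -> g q != b) ->
  0 < (-1) ^+ #|[set q | P q && (minn a b < g q < maxn a b)%N]| *
     ((\prod_(q | P q) (a%:R - (g q)%:R)) * \prod_(q | P q) (b%:R - (g q)%:R)) :> R.
Proof.
pose btw q := (minn a b < g q < maxn a b)%N.
move=> ga gb.
have -> : (-1) ^+ #|[set q | P q && btw q]| =
    \prod_(q | P q) (if btw q then -1 else 1) :> R.
  by rewrite -big_mkcondr /= -prodr_const; apply: eq_bigl => q; rewrite inE.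
rewrite -!big_split /=; apply: prodr_gt0 => q Pq.
have := gb q Pq; have := ga q Pq; rewrite /btw !neq_ltn.
case: (ltngtP (g q) a) => //= qa _; case: (ltngtP (g q) b) => //= qb _.
- rewrite ifF; last by apply/negP; lia.
  by rewrite mul1r mulr_gt0 // subr_gt0 ltr_nat.
- rewrite ifT; last by lia.
  by rewrite mulN1r -mulrN mulr_gt0 ?oppr_gt0 ?subr_gt0 ?subr_lt0 ?ltr_nat.
- rewrite ifT; last by lia.
  by rewrite mulN1r -mulNr mulr_gt0 ?oppr_gt0 ?subr_gt0 ?subr_lt0 ?ltr_nat.
- rewrite ifF; last by apply/negP; lia.
  by rewrite mul1r nmulr_lgt0 ?subr_lt0 ?ltr_nat.
Qed.

Section SwapSign.
Variables (R : realFieldType) (T : eqType) (r n : nat).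
Variables (row_label : 'I_r -> T) (label : 'I_n -> T).

Definition between_count (f : 'I_r -> 'I_n) (p : 'I_r) (l : 'I_n) : nat :=
  #|[set q | [&& q != p, label (f q) == label (f p) &
      (minn (f p) l < f q < maxn (f p) l)%N]]|.

(** Both minors are values, at f p and at l, of one product of linear factors times a constant c,
    and c enters the product as a square. *)
Lemma block_vandermonde_swap_sign (f : 'I_r -> 'I_n) p l :
  injective f -> label_matched row_label label f -> label l = label (f p) ->
  (forall q, q != p -> f q != l) ->
  0 < (-1) ^+ between_count f p l *
     (cminor (block_vandermonde R row_label label) f *
      cminor (block_vandermonde R row_label label) (swap f p l)).
Proof.
move=> fI fm ll fl; have [c H] := cminor_swap_block_vandermonde R p fI fm.
have ff : swap f p (f p) =1 f by move=> q; rewrite /swap; case: eqP => [->|].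
have nz := cminor_block_vandermonde R fI fm.
have Hf := H (f p) erefl; rewrite (eq_cminor _ ff) in Hf.
have c0 : c != 0 by apply: contra_neq nz => c0; rewrite Hf c0 mul0r.
rewrite Hf H //.
have := @prod_sub_sign R _ (fun q => (q != p) && (label (f q) == label (f p)))
  (fun q => f q) (f p) l.
set S1 := [set q | _]; set S2 := between_count _ _ _.
have -> : #|S1| = S2.
  by apply: eq_card => q; rewrite !inE !andbA.
set P1 := \prod_(q | _) _; set P2 := \prod_(q | _) _ => Hp.
have -> : (-1) ^+ S2 * (c * P1 * (c * P2)) = c ^+ 2 * ((-1) ^+ S2 * (P1 * P2)) by ring.
rewrite mulr_gt0 ?exprn_even_gt0 //. apply: Hp => q /andP[qp _].
  by apply: contra_neq qp => /val_inj/fI.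
exact: fl.
Qed.

End SwapSign.

(** * Dimension of closed subsets of the Grassmannian *)

Section DigitMonomials.

(* The digits of a in base N are the exponents of the u_i; the powers of the v_i
   make all these monomials homogeneous of the same degree. *)
Fixpoint digit_monomial (S : comNzRingType) (u v : nat -> S) (N k a : nat) : S :=
  if k is k'.+1 then
    u k' ^+ (a %/ N ^ k') * v k' ^+ (N.-1 - a %/ N ^ k') *
    digit_monomial u v N k' (a %% N ^ k')
  else 1.

Lemma rmorph_digit_monomial (S S' : comNzRingType) (h : {rmorphism S -> S'}) u v N k a :
  h (digit_monomial u v N k a) = digit_monomial (h \o u) (h \o v) N k a.
Proof. by elim: k a => [|k IH] a /=; rewrite ?rmorph1 // !rmorphM !rmorphXn IH. Qed.

Lemma eq_digit_monomial (S : comNzRingType) (u u' v v' : nat -> S) N k a :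
  (forall i, (i < k)%N -> u i = u' i) -> (forall i, (i < k)%N -> v i = v' i) ->
  digit_monomial u v N k a = digit_monomial u' v' N k a.
Proof.
elim: k a => [|k IH] a //= uu vv; rewrite uu // vv //; congr (_ * _).
by apply: IH => i ik; [apply: uu|apply: vv]; apply: ltnW.
Qed.

Variables (K : comNzRingType) (S : comAlgType K).
Implicit Types (van : S -> Prop) (u v : nat -> S).

(* Algebraic independence, modulo the ideal [van], of the ratios u_i / v_i. *)
Definition independent van u v k := forall (N : nat) (c : nat -> K),
  van (\sum_(a < N ^ k) c a *: digit_monomial u v N k a) ->
  forall a, (a < N ^ k)%N -> c a = 0.

Section Homogeneous.
Variables (hom : nat -> S -> Prop).
Hypotheses (hom0 : forall d, hom d 0) (hom1 : hom 0%N 1).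
Hypothesis homD : forall d x y, hom d x -> hom d y -> hom d (x + y).
Hypothesis homZ : forall d c x, hom d x -> hom d (c *: x).
Hypothesis homM : forall d e x y, hom d x -> hom e y -> hom (d + e)%N (x * y).

Lemma homX d x m : hom d x -> hom (d * m)%N (x ^+ m).
Proof.
move=> hx; elim: m => [|m IH]; first by rewrite muln0.
by rewrite mulnS exprS; apply: homM.
Qed.

Lemma hom_digit_monomial du u v N k a :
  (forall i, (i < k)%N -> hom (du i) (u i) /\ hom (du i) (v i)) -> (a < N ^ k)%N ->
  hom (\sum_(i < k) du i * N.-1)%N (digit_monomial u v N k a).
Proof.
elim: k a => [|k IH] a huv aN /=; first by rewrite big_ord0.
have N0 : (0 < N)%N by case: N aN {IH} => //; rewrite expnS mul0n.
have Nk : (0 < N ^ k)%N by rewrite expn_gt0 N0.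
rewrite big_ord_recr /= addnC; apply: homM; last first.
  by apply: IH; rewrite ?ltn_mod // => i ik; apply: huv; apply: ltnW.
have q : (a %/ N ^ k <= N.-1)%N by rewrite -ltnS prednK // ltn_divLR // -expnS.
have [hu hv] := huv k (leqnn _).
by rewrite -{1}(subnKC q) mulnDr; apply: homM; apply: homX.
Qed.

Lemma hom_sum d I (s : seq I) (P : pred I) (F : I -> S) :
  (forall i, P i -> hom d (F i)) -> hom d (\sum_(i <- s | P i) F i).
Proof. by move=> H; elim/big_ind: _ => //; apply: homD. Qed.

Lemma hom_digit_sum du u v N k (c : nat -> K) :
  (forall i, (i < k)%N -> hom (du i) (u i) /\ hom (du i) (v i)) ->
  hom (\sum_(i < k) du i * N.-1)%N (\sum_(a < N ^ k) c a *: digit_monomial u v N k a).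
Proof. by move=> huv; apply: hom_sum => a _; apply: homZ; apply: hom_digit_monomial. Qed.

Section Extend.
Variables (du : nat -> nat) (van van' : S -> Prop) (u v : nat -> S) (k : nat).
Hypothesis homuv : forall i, (i <= k)%N -> hom (du i) (u i) /\ hom (du i) (v i).
(** Along a chain of closed sets, [van'] and [van] are vanishing on the larger and on the smaller
    set; u_k is zero on the smaller one only, and v_k is not identically zero on it. *)
Hypothesis cancel_u : forall d x, hom d x -> van' (u k * x) -> van' x.
Hypothesis restrict : forall x y, van' (x + u k * y) -> van x.
Hypothesis cancel_v : forall d x, hom d x -> van (v k * x) -> van x.

(** Sort a relation by powers of u_k. Restriction kills all but the lowest power, whose coefficients
    are zero by the independence of the first k ratios; the rest is divisible by u_k, which is
    cancelled before the argument repeats. *)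
Lemma independent_extend : independent van u v k -> independent van' u v k.+1.
Proof.
move=> ind N c; have [hu hv] := homuv (leqnn k).
pose G q := \sum_(b < N ^ k) c (q * N ^ k + b)%N *: digit_monomial u v N k b.
(* The relation without its powers of u_k below q, divided by u_k^q. *)
pose T q := \sum_(q <= q' < N) u k ^+ (q' - q) * v k ^+ (N.-1 - q') * G q'.
have [->|N0] := posnP N; first by rewrite exp0n.
have Nk : (0 < N ^ k)%N by rewrite expn_gt0 N0.
have -> : \sum_(a < N ^ k.+1) c a *: digit_monomial u v N k.+1 a = T 0%N.
  rewrite /T -(big_mkord xpredT (fun a => c a *: digit_monomial u v N k.+1 a)) expnS.
  rewrite big_nat_mul; apply: eq_bigr => q _.
  rewrite mulr_sumr subn0 mulSn -{1}[(q * _)%N]add0n big_addn addnK big_mkord.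
  apply: eq_bigr => b _ /=.
  rewrite addnC divnMDl // modnMDl divn_small // modn_small // addn0.
  by rewrite -scalerAr.
have homG q : hom (\sum_(i < k) du i * N.-1)%N (G q).
  by apply: (hom_digit_sum N (fun b => c (q * N ^ k + b)%N)) => i ik; apply/homuv/ltnW.
have homT q : hom (du k * (N.-1 - q) + \sum_(i < k) du i * N.-1)%N (T q).
  rewrite /T big_nat; apply: hom_sum => q' /andP[qq' q'N]; apply: homM => //.
  have -> : (N.-1 - q = (q' - q) + (N.-1 - q'))%N by lia.
  by rewrite mulnDr; apply: homM; apply: homX.
have cancel_vX m d x : hom d x -> van (v k ^+ m * x) -> van x.
  move=> hx; elim: m => [|m IH]; first by rewrite mul1r.
  rewrite exprS -mulrA => /cancel_v H; apply: IH; apply: (H (du k * m + d)%N).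
  by apply: homM => //; apply: homX.
have TS q : (q < N)%N -> T q = v k ^+ (N.-1 - q) * G q + u k * T q.+1.
  move=> qN; rewrite /T big_ltn // subnn mul1r; congr (_ + _).
  rewrite mulr_sumr !big_nat; apply: eq_bigr => q' /andP[qq' _].
  by rewrite !mulrA -exprS subnSK.
move=> T0.
have main q : (q < N)%N -> van' (T q) /\ forall b, (b < N ^ k)%N -> c (q * N ^ k + b)%N = 0.
  elim: q => [|q IH] qN.
    split=> //; apply: ind; apply: (cancel_vX (N.-1 - 0)%N _ _ (homG 0%N)).
    by move: T0; rewrite TS // => /restrict.
  have [vT cq] := IH (ltnW qN).
  suff vT' : van' (T q.+1).
    split=> //; apply: ind; apply: (cancel_vX (N.-1 - q.+1)%N _ _ (homG q.+1)).
    by move: vT'; rewrite TS // => /restrict.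
  apply: (cancel_u (homT q.+1)); move: vT; rewrite TS; last exact: ltnW.
  by rewrite /G big1 ?mulr0 ?add0r // => b _; rewrite cq ?scale0r.
move=> a aN; rewrite (divn_eq a (N ^ k)); apply: (main _ _).2; last by rewrite ltn_mod.
by rewrite ltn_divLR // -expnS.
Qed.

End Extend.
End Homogeneous.
End DigitMonomials.

(** * Nonvanishing and algebraic dependence of polynomials *)

Section PolynomialFacts.
Variables (F : numFieldType).

Lemma msupp_inhabited m (p : {mpoly F[m]}) : p != 0 -> exists mm, mm \in msupp p.
Proof.
rewrite -msupp_eq0; case: (msupp p) => // mm s _.
by exists mm; rewrite inE eqxx.
Qed.

(** [muni] makes p a polynomial in its last variable. A point at which one of the coefficients is
    nonzero leaves a nonzero polynomial in one variable, and F is infinite. *)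
Lemma mpoly_nonroot m (p : {mpoly F[m]}) : p != 0 -> exists x : 'I_m -> F, p.@[x] != 0.
Proof.
elim: m p => [|m IH] p p0.
  exists (fun _ => 0); have [mm Hm] : exists mm, mm \in msupp p.
    exact: msupp_inhabited.
  rewrite mevalE (bigD1_seq mm) ?msupp_uniq //= big_ord0 mulr1 big1_seq ?addr0.
    by rewrite -mcoeff_msupp.
  by move=> m' /andP[/eqP []]; apply/mnmP => -[].
have [mm] : exists mm, mm \in msupp p.
  exact: msupp_inhabited.
move=> Hm.
pose m1 := [multinom (mm (widen_ord (leqnSn m) i)) | i < m].
have c1 : (muni p)`_(mm ord_max) @_ m1 != 0.
  rewrite muniE coef_sum raddf_sum /= (bigD1_seq mm) ?msupp_uniq //=.
  rewrite coefZ coefXn eqxx mulr1 mcoeffZ mcoeffX eqxx mulr1 big1_seq ?addr0 -?mcoeff_msupp //.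
  move=> m' /andP[m'm _]; rewrite coefZ coefXn.
  case: eqP => [e1|]; last by rewrite mulr0 mcoeff0.
  rewrite mulr1 mcoeffZ mcoeffX; case: eqP => [e2|]; last by rewrite mulr0.
  case/eqP: m'm; apply/mnmP => i; case: (unliftP ord_max i) => [j ->|->] //.
  have := congr1 (fun mn : 'X_{1..m} => mn j) e2; rewrite !mnmE.
  have -> : widen_ord (leqnSn m) j = lift ord_max j by apply/val_inj/esym; exact: lift_max.
  by move=> ->.
have /IH[x Hx] : (muni p)`_(mm ord_max) != 0 by apply: contraNneq c1 => ->; rewrite mcoeff0.
pose q := map_poly (meval x) (muni p).
have q0 : q != 0.
  by apply: contraNneq Hx => q0; rewrite -(coef_map (meval x)) -/q q0 coef0.
have [y Hy] : exists y, q.[y] != 0.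
  apply: contrapT => H.
  pose rs := [seq (i%:R : F) | i <- iota 0 (size q)].
  have := @max_poly_roots F q rs q0.
  rewrite size_map size_iota ltnn => /(_ _ _)/negP; apply => //.
    apply/allP => y _; apply/rootP; apply: contrapT => Hy; apply: H.
    by exists y; apply/eqP.
  by rewrite map_inj_uniq ?iota_uniq // => a b /eqP; rewrite eqr_nat => /eqP.
exists (fun i => if unlift ord_max i is Some j then x j else y).
rewrite (_ : p.@[_] = q.[y]) // /q muniE raddf_sum /= horner_sum mevalE.
apply: eq_bigr => m' _.
rewrite map_polyZ /= map_polyXn hornerZ hornerXn mevalZ mevalX -mulrA; congr (_ * _).
rewrite big_ord_recr /= unlift_none; congr (_ * _); apply: eq_bigr => i _.
rewrite mnmE; have -> : widen_ord (leqnSn m) i = lift ord_max i.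
  by apply/val_inj/esym; exact: lift_max.
by rewrite liftK.
Qed.

Definition degree_le m (p : {mpoly F[m]}) d := (msize p <= d.+1)%N.

Lemma degree_leM m (p q : {mpoly F[m]}) d e :
  degree_le p d -> degree_le q e -> degree_le (p * q) (d + e).
Proof.
rewrite /degree_le => pd qe.
have [->|p0] := eqVneq p 0; first by rewrite mul0r msize0.
have [->|q0] := eqVneq q 0; first by rewrite mulr0 msize0.
by rewrite msizeM //; move: pd qe; move: (msize p) (msize q) => a b; lia.
Qed.

Lemma degree_leX m (p : {mpoly F[m]}) d e : degree_le p d -> degree_le (p ^+ e) (e * d).
Proof.
move=> pd; elim: e => [|e IH]; first by rewrite expr0 /degree_le msize1.
by rewrite exprS mulSn; apply: degree_leM.
Qed.

Lemma degree_le_digit_monomial m (u v : nat -> {mpoly F[m]}) d N k a :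
  (forall i, (i < k)%N -> degree_le (u i) d) -> (forall i, (i < k)%N -> degree_le (v i) d) ->
  (a < N ^ k)%N -> degree_le (digit_monomial u v N k a) (k * (N * d)).
Proof.
elim: k a => [|k IH] a ud vd aN /=; first by rewrite /degree_le msize1.
have N0 : (0 < N)%N by case: N aN {IH} => //; rewrite expnS mul0n.
have Nk : (0 < N ^ k)%N by rewrite expn_gt0 N0.
rewrite mulSn; apply: degree_leM; last first.
  by apply: IH; rewrite ?ltn_mod // => i ik; [apply: ud|apply: vd]; apply: ltnW.
have q : (a %/ N ^ k < N)%N by rewrite ltn_divLR // -expnS.
have H := degree_leM (degree_leX (a %/ N ^ k) (ud k (leqnn _)))
  (degree_leX (N.-1 - a %/ N ^ k) (vd k (leqnn _))).
apply: leq_trans H _; rewrite ltnS -mulnDl leq_mul2r; apply/orP; right; lia.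
Qed.

Lemma more_rows_dependent (p q : nat) (E : 'M[F]_(p, q)) : (q < p)%N ->
  exists2 c : 'rV_p, c != 0 & c *m E = 0.
Proof.
move=> qp; have : kermx E != 0.
  rewrite -mxrank_eq0 mxrank_ker subn_eq0 -ltnNge.
  exact: leq_ltn_trans (rank_leq_col E) qp.
case/matrix0Pn => i [j Hij]; exists (row i (kermx E)).
  by apply/rV0Pn; exists j; rewrite mxE.
by apply/sub_kermxP; apply: row_sub.
Qed.

Lemma leq_exp2r_weak a b m : (a <= b)%N -> (a ^ m <= b ^ m)%N.
Proof. by move=> ab; case: m => // m; rewrite leq_exp2r. Qed.

(** The N^k digit monomials have degree at most k N d, so they lie in a space of dimension at most
    (k N d + 1)^m, which is less than N^k for large N. *)
Lemma too_many_dependent m (u v : nat -> {mpoly F[m]}) k : (m < k)%N ->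
  exists (N : nat) (c : nat -> F), (exists2 a, (a < N ^ k)%N & c a != 0) /\
    \sum_(a < N ^ k) c a *: digit_monomial u v N k a = 0.
Proof.
move=> mk.
pose d := (\max_(i < k) maxn (msize (u i)) (msize (v i)))%N.
have ud i : (i < k)%N -> degree_le (u i) d.
  move=> ik; apply: leqW; apply: leq_trans (leq_bigmax (Ordinal ik)).
  exact: leq_maxl.
have vd i : (i < k)%N -> degree_le (v i) d.
  move=> ik; apply: leqW; apply: leq_trans (leq_bigmax (Ordinal ik)).
  exact: leq_maxr.
(* Chosen so that B^m <= (N (k d + 1))^m < N^(m+1) <= N^k, for B = k N d + 1. *)
pose N := ((k * d).+1 ^ m).+1.
pose B := (k * (N * d)).+1.
pose E : 'M[F]_(N ^ k, #|{ffun 'I_m -> 'I_B}|) := \matrix_(a, j)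
  (digit_monomial u v N k a)@_[multinom ((enum_val j : {ffun 'I_m -> 'I_B}) i : nat) | i < m].
have dims : (#|{ffun 'I_m -> 'I_B}| < N ^ k)%N.
  rewrite card_ffun !card_ord.
  have h1 : (B <= N * (k * d).+1)%N by rewrite /B /N; nia.
  have h2 : (N ^ m.+1 <= N ^ k)%N by apply: leq_pexp2l.
  apply: leq_trans h2; apply: (@leq_ltn_trans ((N * (k * d).+1) ^ m)).
    exact: leq_exp2r_weak.
  by rewrite expnMn expnSr ltn_mul2l expn_gt0 /=.
have [c c0 cE] := more_rows_dependent E dims.
exists N, (fun a => if insub a is Some i then c 0 i else 0); split.
  case/rV0Pn: c0 => a ca; exists a => //.
  by rewrite valK.
apply/mpolyP => mm; rewrite mcoeff0 raddf_sum /=.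
have [mB|mB] := boolP [forall i, (mm i < B)%N].
  pose f : {ffun 'I_m -> 'I_B} := [ffun i => inord (mm i)].
  move/matrixP/(_ 0 (enum_rank f)): cE; rewrite !mxE => cE; rewrite -[RHS]cE.
  apply: eq_bigr => a _; rewrite mcoeffZ valK mxE; congr (_ * _@__).
  apply/mnmP => i; rewrite mnmE enum_rankK ffunE inordK //.
  exact: (forallP mB).
apply: big1 => a _; rewrite mcoeffZ.
suff -> : (digit_monomial u v N k a)@_mm = 0 by rewrite mulr0.
apply: memN_msupp_eq0; apply: contra mB => /msize_mdeg_lt h.
have := degree_le_digit_monomial ud vd (ltn_ord a); rewrite /degree_le => h'.
apply/forallP => i; apply: leq_ltn_trans (leq_trans h h').
by rewrite mdegE (bigD1 i) //= leq_addr.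
Qed.

End PolynomialFacts.

(** * Forms and charts on the Grassmannian *)

Section GrassmannianCharts.
Variables (R : realType) (r n : nat).
Local Notation C := (R[i]).
Local Notation P := #|{: rsubset r n}|.
Implicit Types (A B : 'M[C]_(r, n)) (J I : rsubset r n) (f g : {mpoly C[P]}).

Lemma same_span A B : \rank A = r -> \rank B = r -> (<<A>> = <<B>>)%MS ->
  exists2 g : 'M[C]_r, \det g != 0 & A = g *m B.
Proof.
move=> rA rB AB; have /submxP[g Ag] : (A <= B)%MS by rewrite -(genmxE B) -AB genmxE.
exists g => //; rewrite -unitfE -[_ \is a _]/(g \in unitmx) -row_free_unit -row_leq_rank.
by rewrite -{1}rA Ag mxrankM_maxl.
Qed.

Lemma span_mul (g : 'M[C]_r) A : \det g != 0 -> (<<g *m A>> = <<A>>)%MS.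
Proof.
rewrite -unitfE -[_ \is a _]/(g \in unitmx) => gu; apply/genmxP/andP; split.
  exact: submxMl.
by rewrite -{1}(mulKmx gu A) submxMl.
Qed.

Lemma rank_mul (g : 'M[C]_r) A : \det g != 0 -> \rank (g *m A) = \rank A.
Proof.
by move=> g0; rewrite -[LHS]genmxE span_mul // genmxE.
Qed.

Lemma cminor_rank (F : fieldType) (A : 'M[F]_(r, n)) (h : 'I_r -> 'I_n) :
  cminor A h != 0 -> \rank A = r.
Proof.
move=> H; apply/eqP; rewrite eqn_leq rank_leq_row /=.
have : colsub h A \in unitmx by rewrite unitmxE unitfE.
rewrite -row_free_unit -row_leq_rank => /leq_trans; apply.
by rewrite -[A in colsub h A]mulmx1 -mulmx_colsub mxrankM_maxl.
Qed.

Lemma rank_minor (F : fieldType) (A : 'M[F]_(r, n)) : \rank A = r -> exists J, minor A J != 0.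
Proof.
move=> rA; have fA : row_full A^T by rewrite /row_full mxrank_tr rA.
pose h := fullrankfun fA; have hI : injective h by apply: fullrankfun_inj.
exists (image_subset hI); rewrite minor_image_eq0.
have := fullrowsub_unit fA; rewrite -/h unitmxE unitfE -det_tr.
by rewrite trmx_mxsub trmxK.
Qed.

Lemma minor_mul (g : 'M[C]_r) A J : minor (g *m A) J = \det g * minor A J.
Proof. exact: cminor_mul. Qed.

Lemma dhomog_scale m (f : {mpoly C[m]}) d (x : 'I_m -> C) a : f \is d.-homog ->
  f.@[fun i => a * x i] = a ^+ d * f.@[x].
Proof.
move=> /dhomogP hf; rewrite !mevalE mulr_sumr [LHS]big_seq [RHS]big_seq.
apply: eq_bigr => mm mf; rewrite mulrCA; congr (_ * _).
have -> : d = (\sum_i mm i)%N by rewrite -(hf mm mf); apply: mdegE.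
rewrite -prodrXr -big_split /=.
by apply: eq_bigr => i _; rewrite exprMn.
Qed.

Lemma plucker_mul (g : 'M[C]_r) A f d : f \is d.-homog ->
  f.@[plucker (g *m A)] = \det g ^+ d * f.@[plucker A].
Proof.
by move=> hf; rewrite -dhomog_scale //; apply: meval_eq => i; rewrite /plucker minor_mul.
Qed.

Definition vanishes (Z : classical_sets.set 'M[C]_n) f : Prop :=
  forall A, \rank A = r -> Z <<A>>%MS -> f.@[plucker A] = 0.

Definition coord J : {mpoly C[P]} := 'X_(enum_rank J).

Lemma coordE A J : (coord J).@[plucker A] = minor A J.
Proof. by rewrite mevalXU /plucker enum_rankK. Qed.

Lemma coord_homog J : coord J \is 1.-homog.
Proof. by rewrite dhomogX; apply/eqP; apply: mdeg1. Qed.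

Lemma vanish_span A B f d : f \is d.-homog -> \rank A = r -> \rank B = r ->
  (<<A>> = <<B>>)%MS -> f.@[plucker B] = 0 -> f.@[plucker A] = 0.
Proof.
move=> hf rA rB AB fB; have [g _ ->] := same_span rA rB AB.
by rewrite (plucker_mul _ _ hf) fB mulr0.
Qed.

Definition zero_locus (S : classical_sets.set {mpoly C[P]}) : classical_sets.set 'M[C]_n :=
  fun U => exists A, [/\ \rank A = r, U = <<A>>%MS & forall f, S f -> f.@[plucker A] = 0].

Lemma zero_locusP (S : classical_sets.set {mpoly C[P]}) A :
  (forall f, S f -> exists d : nat, f \is d.-homog) -> \rank A = r ->
  zero_locus S <<A>>%MS <-> (forall f, S f -> f.@[plucker A] = 0).
Proof.
move=> hS rA; split=> [[B [rB AB HB]] f Sf|H]; last by exists A.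
by have [d hf] := hS f Sf; apply: (vanish_span hf rA rB AB); apply: HB.
Qed.

Lemma zclosed_rep (Z : classical_sets.set 'M[C]_n) U : zclosed r Z -> Z U ->
  exists2 A : 'M[C]_(r, n), \rank A = r & U = <<A>>%MS.
Proof. by move=> [S [_ ->]] [A [rA UA _]]; exists A. Qed.

(** The zero loci of f and g cover Z; homogeneity makes them independent of the matrix that
    represents a point. *)
Lemma vanishesM_prime (Z : classical_sets.set 'M[C]_n) f g d e :
  irreducible_closed r Z ->
  f \is d.-homog -> g \is e.-homog -> vanishes Z (f * g) -> vanishes Z f \/ vanishes Z g.
Proof.
move=> [cZ _ irr] hf hg fg.
have hom1 (h : {mpoly C[P]}) k : h \is k.-homog ->
    forall h', [set h]%classic h' -> exists d : nat, h' \is d.-homog.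
  by move=> hh h' ->; exists k.
have cl h k : h \is k.-homog -> zclosed r (zero_locus [set h]%classic).
  by move=> hh; exists [set h]%classic; split=> //; apply: hom1 hh.
have loc h k : h \is k.-homog ->
    classical_sets.subset Z (zero_locus [set h]%classic) -> vanishes Z h.
  move=> hh sub A rA ZA; have := sub _ ZA.
  by move/(zero_locusP (hom1 _ _ hh) rA); apply.
have [|/(loc _ _ hf)|/(loc _ _ hg)] := irr _ _ (cl _ _ hf) (cl _ _ hg); [|by left|by right].
move=> U ZU; have [A rA UA] := zclosed_rep cZ ZU; rewrite UA in ZU *.
have /eqP := fg A rA ZU; rewrite mevalM mulf_eq0 => /orP[]/eqP H; [left|right].
  by apply/(zero_locusP (hom1 _ _ hf) rA) => _ ->.
by apply/(zero_locusP (hom1 _ _ hg) rA) => _ ->.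
Qed.

Lemma separating_form (Z Z' : classical_sets.set 'M[C]_n) :
  zclosed r Z -> zclosed r Z' -> ~ classical_sets.subset Z' Z ->
  exists f d, [/\ f \is d.-homog, vanishes Z f & ~ vanishes Z' f].
Proof.
move=> [S [hS ZS]] cZ' nsub; apply: contrapT => H; apply: nsub => U Z'U.
have [A rA UA] := zclosed_rep cZ' Z'U; rewrite UA in Z'U *.
rewrite ZS; apply/(zero_locusP hS rA) => f Sf.
have [d hf] := hS f Sf; apply: contrapT => fA; apply: H; exists f, d; split=> //.
  by move=> B rB; rewrite ZS => /(zero_locusP hS rB); apply.
by move/(_ A rA Z'U).
Qed.

Lemma irreducible_coord (Z : classical_sets.set 'M[C]_n) : irreducible_closed r Z ->
  exists J, ~ vanishes Z (coord J).
Proof.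
move=> [cZ [U ZU] _]; have [A rA UA] := zclosed_rep cZ ZU; rewrite UA in ZU.
have [J HJ] := rank_minor rA; exists J => /(_ A rA ZU); rewrite coordE.
by move/eqP: HJ.
Qed.

Lemma vanishesX_prime (Z : classical_sets.set 'M[C]_n) f d m :
  irreducible_closed r Z -> f \is d.-homog -> vanishes Z (f ^+ m) -> vanishes Z f.
Proof.
move=> iZ hf; elim: m => [|m IH].
  case: iZ => cZ [U ZU] _; have [A rA UA] := zclosed_rep cZ ZU; rewrite UA in ZU.
  by move/(_ A rA ZU); rewrite expr0 meval1 => /eqP; rewrite oner_eq0.
rewrite exprS => /(vanishesM_prime iZ hf (dhomogMn m hf))[//|].
exact: IH.
Qed.

(** u_i separates Z i from Z (i+1), and v_i is the power of the same degree of a coordinate that is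
    not identically zero on Z 0, hence on no member of the chain. *)
Lemma chain_independent (Z : nat -> classical_sets.set 'M[C]_n) (k : nat) :
  (forall i, (i <= k)%N -> irreducible_closed r (Z i)) ->
  (forall i, (i < k)%N -> classical_sets.proper (Z i) (Z i.+1)) ->
  exists (u v : nat -> {mpoly C[P]}) (du : nat -> nat),
    (forall i, (i < k)%N -> u i \is (du i).-homog /\ v i \is (du i).-homog) /\
    independent (vanishes (Z k)) u v k.
Proof.
move=> irrZ strZ; have [J0 HJ0] := irreducible_coord (irrZ 0%N (leq0n _)).
have cZ i : (i <= k)%N -> zclosed r (Z i) by move=> /irrZ[].
have H i : exists ud : {mpoly C[P]} * nat, (i < k)%N ->
    [/\ ud.1 \is ud.2.-homog, vanishes (Z i) ud.1 & ~ vanishes (Z i.+1) ud.1].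
  have [ik|ik] := boolP (i < k)%N; last by exists (0, 0%N).
  have [f [d [hf fZ fZ']]] := separating_form (cZ i (ltnW ik)) (cZ i.+1 ik) (strZ i ik).2.
  by exists (f, d).
have [ud Hud] := choice H.
pose u i := (ud i).1; pose du i := (ud i).2; pose v i := coord J0 ^+ du i.
have hv i : v i \is (du i).-homog by have := dhomogMn (du i) (coord_homog J0); rewrite mul1n.
exists u, v, du; split=> [i ik|]; first by have [h1 _ _] := Hud i ik; split; last exact: hv.
have nJ0 i : (i <= k)%N -> ~ vanishes (Z i) (coord J0).
  elim: i => [//|i IH] ik; move=> H1; apply: (IH (ltnW ik)) => A rA ZA.
  by apply: H1 => //; apply: (strZ i ik).1.
suff: forall j, (j <= k)%N -> independent (vanishes (Z j)) u v j by move/(_ k (leqnn k)).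
elim=> [|j IH] jk.
  move=> N c; rewrite expn0 big_ord1 /= => van0 [|//] _.
  have [cZ0 [U ZU] _] := irrZ 0%N (leq0n _).
  have [A rA UA] := zclosed_rep cZ0 ZU; rewrite UA in ZU.
  by have := van0 A rA ZU; rewrite mevalZ meval1 mulr1.
have [huj uj uj'] := Hud j jk.
apply: (@independent_extend _ _ (fun d (x : {mpoly C[P]}) => is_true (x \is d.-homog))
  _ _ _ _ _ du (vanishes (Z j))) => //.
- by move=> d; apply: dhomog0.
- exact: dhomog1.
- by move=> d x y; apply: dhomogD.
- by move=> d c x; apply: dhomogZ.
- by move=> d e x y; apply: dhomogM.
- by move=> i ij; have [h1 _ _] := Hud i (leq_ltn_trans ij jk); split; last exact: hv.
- by move=> d x hx /(vanishesM_prime (irrZ _ jk) huj hx)[].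
- move=> x y H1 A rA ZA; have := H1 A rA ((strZ j jk).1 _ ZA).
  by rewrite mevalD mevalM uj // mul0r addr0.
- move=> d x hx /(vanishesM_prime (irrZ _ (ltnW jk)) (hv j) hx)[|//].
  by move/(vanishesX_prime (irrZ _ (ltnW jk)) (coord_homog J0))/(nJ0 _ (ltnW jk)).
- exact: (IH (ltnW jk)).
Qed.

(** The default J of [insubd] can occur only for l in J. *)
Definition neighbor J (i : 'I_r) (l : 'I_n) : rsubset r n :=
  insubd J (swap (subset_enum J) i l @: 'I_r).

Lemma swap_subset_inj J i l : l \notin val J -> injective (swap (subset_enum J) i l).
Proof.
move=> lJ; apply: swap_inj; first exact: subset_enum_inj.
by move=> q _; apply: contraNneq lJ => <-; apply: subset_enum_in.
Qed.

Lemma neighborE J i l (lJ : l \notin val J) :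
  neighbor J i l = image_subset (swap_subset_inj (i := i) lJ).
Proof.
apply: val_inj; rewrite /neighbor val_insubd card_rsubset_image //.
exact: swap_subset_inj.
Qed.

Lemma val_neighbor J i l : l \notin val J ->
  val (neighbor J i l) = l |: (val J :\ subset_enum J i).
Proof.
move=> lJ; rewrite (neighborE _ lJ) /=; apply/setP => x; rewrite !inE.
apply/imsetP/idP => [[q _ ->]|].
  rewrite /swap; case: (q =P i) => [_|/eqP qi]; first by rewrite eqxx.
  by rewrite subset_enum_in andbT (inj_eq (@subset_enum_inj _ _ J)) qi orbT.
case/orP => [/eqP ->|/andP[xi /subset_enumP[q xq]]].
  by exists i => //; rewrite /swap eqxx.
exists q => //; rewrite /swap; case: (q =P i) => // qi.
by move: xi; rewrite xq qi eqxx.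
Qed.

Lemma minor_neighbor_eq0 (K : comNzRingType) (A : 'M[K]_(r, n)) J i l : l \notin val J ->
  (minor A (neighbor J i l) == 0) = (cminor A (swap (subset_enum J) i l) == 0).
Proof. by move=> lJ; rewrite (neighborE _ lJ) minor_image_eq0. Qed.

Lemma normalize_minor (F : fieldType) (A : 'M[F]_(r, n)) J : minor A J != 0 ->
  exists2 g : 'M[F]_r, \det g != 0 & colsub (subset_enum J) (g *m A) = 1%:M.
Proof.
move=> AJ; exists (invmx (colsub (subset_enum J) A)); first by rewrite det_inv invr_eq0.
by rewrite -mulmx_colsub mulVmx // unitmxE unitfE.
Qed.

Lemma minor_neighbor_entry (F : fieldType) (A : 'M[F]_(r, n)) J i l :
  colsub (subset_enum J) A = 1%:M -> l \notin val J ->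
  (minor A (neighbor J i l) == 0) = (A i l == 0).
Proof. by move=> A1 lJ; rewrite minor_neighbor_eq0 // cminor_swap A1 adj1 mul1mx. Qed.

(** The ring varies so that the same matrix serves with numbers and with indeterminates as
    entries. *)
Definition chart_mx J (E : {set 'I_r * 'I_n}) (K : comNzRingType) (x : 'I_#|E| -> K)
    : 'M[K]_(r, n) :=
  \matrix_(i, l) if l \in val J then (subset_enum J i == l)%:R
    else \sum_(k < #|E|) x k *+ (enum_val k == (i, l)).

Arguments chart_mx J E {K} x.

Lemma chart_mx_norm J (E : {set 'I_r * 'I_n}) (K : comNzRingType) (x : 'I_#|E| -> K) :
  colsub (subset_enum J) (chart_mx J E x) = 1%:M.
Proof.
by apply/matrixP => i j; rewrite !mxE subset_enum_in (inj_eq (@subset_enum_inj _ _ J)).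
Qed.

Lemma chart_mx_out J (E : {set 'I_r * 'I_n}) (K : comNzRingType) (x : 'I_#|E| -> K) i l :
  l \notin val J -> (i, l) \notin E -> chart_mx J E x i l = 0.
Proof.
move=> lJ ilE; rewrite mxE (negbTE lJ) big1 // => k _; case: eqP => // ek.
by rewrite -ek enum_valP in ilE.
Qed.

Lemma chart_mx_in J (E : {set 'I_r * 'I_n}) (K : comNzRingType) (x : 'I_#|E| -> K) k :
  (enum_val k).2 \notin val J ->
  chart_mx J E x (enum_val k).1 (enum_val k).2 = x k.
Proof.
move=> lJ; rewrite mxE (negbTE lJ) (bigD1 k) //= -surjective_pairing eqxx mulr1n.
by rewrite big1 ?addr0 // => j jk; rewrite (inj_eq enum_val_inj) (negbTE jk).
Qed.

Definition chart_params (E : {set 'I_r * 'I_n}) A (k : 'I_#|E|) : C :=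
  A (enum_val k).1 (enum_val k).2.

Lemma chart_mxK J (E : {set 'I_r * 'I_n}) A : colsub (subset_enum J) A = 1%:M ->
  (forall i l, l \notin val J -> (i, l) \notin E -> A i l = 0) ->
  chart_mx J E (chart_params A) = A.
Proof.
move=> A1 A0; apply/matrixP => i l; rewrite mxE; case: ifP => lJ.
  have [q ->] := subset_enumP lJ.
  have := congr1 (fun B : 'M_r => B i q) A1; rewrite !mxE => ->.
  by rewrite (inj_eq (@subset_enum_inj _ _ J)).
have [ilE|ilE] := boolP ((i, l) \in E); last first.
  rewrite A0 ?lJ // big1 // => k _; case: eqP => // ek.
  by rewrite -ek enum_valP in ilE.
rewrite (bigD1 (enum_rank_in ilE (i, l))) //= enum_rankK_in // eqxx mulr1n.
rewrite /chart_params enum_rankK_in //= big1 ?addr0 // => k kE.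
case: eqP => // ek; case/eqP: kE; apply: enum_val_inj.
by rewrite enum_rankK_in.
Qed.

Definition chart_pullback J (E : {set 'I_r * 'I_n}) f : {mpoly C[#|E|]} :=
  f \mPo [tuple minor (chart_mx J E (fun k : 'I_#|E| => 'X_k)) (enum_val i) | i < P].

Lemma map_chart_mx J (E : {set 'I_r * 'I_n}) D (y : 'I_#|E| -> {mpoly C[D]}) x :
  map_mx (meval x) (chart_mx J E y) = chart_mx J E (fun k => (y k).@[x]).
Proof.
apply/matrixP => i l; rewrite !mxE; case: ifP => _; first by rewrite rmorph_nat.
by rewrite raddf_sum; apply: eq_bigr => k _; rewrite /= mevalMn.
Qed.

Lemma eq_chart_mx J (E : {set 'I_r * 'I_n}) (x y : 'I_#|E| -> C) :
  x =1 y -> chart_mx J E x = chart_mx J E y.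
Proof.
move=> xy; apply/matrixP => i l; rewrite !mxE; case: ifP => // _.
by apply: eq_bigr => k _; rewrite xy.
Qed.

Lemma minor_chart_eval J (E : {set 'I_r * 'I_n}) (x : 'I_#|E| -> C) I :
  (minor (chart_mx J E (fun k : 'I_#|E| => 'X_k)) I).@[x] = minor (chart_mx J E x) I.
Proof.
rewrite /minor -det_map_mx map_mxsub map_chart_mx (@eq_chart_mx J E _ x) // => k.
by rewrite mevalXU.
Qed.

Lemma chart_pullbackE J (E : {set 'I_r * 'I_n}) f (x : 'I_#|E| -> C) :
  (chart_pullback J E f).@[x] = f.@[plucker (chart_mx J E x)].
Proof.
rewrite /chart_pullback comp_mpoly_meval; apply: meval_eq => i.
by rewrite tnth_mktuple minor_chart_eval.
Qed.

End GrassmannianCharts.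

Arguments chart_mx {r n} J E {K} x.

(** * Upper bounds for chain lengths *)

Section ChartBounds.
Variables (R : realType) (r n : nat).
Local Notation C := (R[i]).
Local Notation P := #|{: rsubset r n}|.
Implicit Types (A B : 'M[C]_(r, n)) (J I : rsubset r n) (f g : {mpoly C[P]}).
Variables (Z : classical_sets.set 'M[C]_n) (u v : nat -> {mpoly C[P]}) (du : nat -> nat).
Variables (k : nat) (J : rsubset r n) (E : {set 'I_r * 'I_n}).
Hypothesis irrZ : irreducible_closed r Z.
Hypothesis huv : forall i, (i < k)%N -> u i \is (du i).-homog /\ v i \is (du i).-homog.
Hypothesis ind : independent (vanishes Z) u v k.
Hypothesis ZJ : ~ vanishes Z (coord R J).
Hypothesis pattern : forall A, \rank A = r -> Z <<A>>%MS ->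
  colsub (subset_enum J) A = 1%:M ->
  forall i l, l \notin val J -> (i, l) \notin E -> A i l = 0.

Definition chart_vanishes (h : {mpoly C[#|E|]}) : Prop :=
  forall A, \rank A = r -> Z <<A>>%MS -> colsub (subset_enum J) A = 1%:M ->
    h.@[chart_params A] = 0.

(** Outside the chart the coordinate of J is zero, so its product with f vanishes on all of Z, and
    primality removes this factor. *)
Lemma chart_vanishes_pullback f d : f \is d.-homog ->
  chart_vanishes (chart_pullback J E f) -> vanishes Z f.
Proof.
move=> hf fv; suff : vanishes Z (coord R J * f).
  by move/(vanishesM_prime irrZ (coord_homog R J) hf) => [].
move=> A rA ZA; rewrite mevalM coordE.
have [->|AJ] := eqVneq (minor A J) 0; first by rewrite mul0r.
have [g g0 gA1] := normalize_minor AJ.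
have rgA : \rank (g *m A) = r by rewrite rank_mul.
have ZgA : Z <<g *m A>>%MS by rewrite span_mul.
have := fv _ rgA ZgA gA1; rewrite chart_pullbackE chart_mxK //; last exact: pattern.
rewrite (plucker_mul _ _ hf) => /eqP; rewrite mulf_eq0 expf_eq0 (negbTE g0) andbF /=.
by move/eqP ->; rewrite mulr0.
Qed.

Lemma chart_independent : independent chart_vanishes
  (fun i => chart_pullback J E (u i)) (fun i => chart_pullback J E (v i)) k.
Proof.
move=> N c cv; apply: (ind (N := N)).
have hW : \sum_(a < N ^ k) c a *: digit_monomial u v N k a \is
    (\sum_(i < k) du i * N.-1)%N.-homog.
  apply: (@hom_digit_sum _ _ (fun d (x : {mpoly C[P]}) => is_true (x \is d.-homog))) => //.
  - by move=> d; apply: dhomog0.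
  - exact: dhomog1.
  - by move=> d x y; apply: dhomogD.
  - by move=> d a x; apply: dhomogZ.
  - by move=> d e x y; apply: dhomogM.
apply: (chart_vanishes_pullback hW) => A rA ZA A1; rewrite -[RHS](cv A rA ZA A1).
congr (_ .@[_]); rewrite /chart_pullback raddf_sum /=; apply: eq_bigr => a _.
by rewrite comp_mpolyZ rmorph_digit_monomial.
Qed.

Lemma chart_bound : (k <= #|E|)%N.
Proof.
rewrite leqNgt; apply/negP => /(too_many_dependent (fun i => chart_pullback J E (u i))
  (fun i => chart_pullback J E (v i)))[N [c [[a aN /eqP ca] c0]]].
by apply: ca; apply: (chart_independent (N := N)) => // A _ _ _; rewrite c0 meval0.
Qed.

(** Since h vanishes on the chart points of Z without being zero, h / 1 can be adjoined as one more
    ratio, independent in the polynomial ring itself; hence k + 1 <= #|E|. *)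
Lemma chart_bound_strict h : h != 0 -> chart_vanishes h -> (k < #|E|)%N.
Proof.
move=> h0 hv; rewrite leqNgt; apply/negP => kE.
pose u' i := if (i < k)%N then chart_pullback J E (u i) else h.
pose v' i := if (i < k)%N then chart_pullback J E (v i) else 1.
have ind' : independent chart_vanishes u' v' k.
  move=> N c H; apply: (chart_independent (N := N)); move: H; congr chart_vanishes.
  apply: eq_bigr => a _; congr (_ *: _).
  by apply: eq_digit_monomial => i ik; rewrite /u' /v' ik.
have {}ind' : independent (fun x : {mpoly C[#|E|]} => x = 0) u' v' k.+1.
  apply: (@independent_extend _ _ (fun _ _ => True) _ _ _ _ _ (fun _ => 0%N)
    chart_vanishes) => //.
  - by move=> _ x _; rewrite /u' ltnn => /eqP; rewrite mulf_eq0 (negbTE h0) => /eqP.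
  - move=> x y H A rA ZA A1; have := congr1 (meval (chart_params A)) H.
    by rewrite mevalD mevalM /u' ltnn hv // mul0r addr0 meval0.
  - by move=> _ x _; rewrite /v' ltnn mul1r.
have [N [c [[a aN /eqP ca] c0]]] := too_many_dependent u' v' kE.
by apply: ca; apply: (ind' N).
Qed.

End ChartBounds.

Section ChainBounds.
Variables (R : realType) (r n : nat).
Local Notation C := (R[i]).
Implicit Types (A B : 'M[C]_(r, n)) (J I : rsubset r n).
Variables (Z : nat -> classical_sets.set 'M[C]_n) (k : nat).
Hypothesis irrZ : forall i, (i <= k)%N -> irreducible_closed r (Z i).
Hypothesis strZ : forall i, (i < k)%N -> classical_sets.proper (Z i) (Z i.+1).
Variables (J : rsubset r n) (E : {set 'I_r * 'I_n}).
Hypothesis ZJ : ~ vanishes (Z k) (coord R J).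
Hypothesis EJ : forall i l, l \notin val J ->
  ~ vanishes (Z k) (coord R (neighbor J i l)) -> (i, l) \in E.

Let pattern A : \rank A = r -> Z k <<A>>%MS -> colsub (subset_enum J) A = 1%:M ->
  forall i l, l \notin val J -> (i, l) \notin E -> A i l = 0.
Proof.
move=> rA ZA A1 i l lJ iE; apply/eqP; rewrite -(minor_neighbor_entry _ A1 lJ) -coordE.
apply/eqP; move: A rA ZA {A1}; apply: contrapT => H.
by move/negP: iE; apply; apply: EJ => //.
Qed.

Lemma chain_bound : (k <= #|E|)%N.
Proof.
have [u [v [du [huv ind]]]] := chain_independent irrZ strZ.
exact: (chart_bound (irrZ (leqnn k)) huv ind ZJ pattern).
Qed.

(** The relation is the minor of I in the generic chart matrix: it vanishes on Z k, and A shows that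
    it is not the zero polynomial. *)
Lemma chain_bound_strict A I : minor A J != 0 -> minor A I != 0 ->
  (forall i l, l \notin val J -> minor A (neighbor J i l) != 0 -> (i, l) \in E) ->
  vanishes (Z k) (coord R I) -> (k < #|E|)%N.
Proof.
move=> AJ AI AE ZI.
have [u [v [du [huv ind]]]] := chain_independent irrZ strZ.
pose h := minor (chart_mx J E (fun j : 'I_#|E| => 'X_j : {mpoly C[#|E|]})) I.
apply: (chart_bound_strict (irrZ (leqnn k)) huv ind ZJ pattern (h := h)).
  have [g g0 gA1] := normalize_minor AJ.
  apply: contraNneq AI => h0.
  have := minor_chart_eval J (chart_params (E := E) (g *m A)) I.
  rewrite -/h h0 meval0 chart_mxK //.
    by move/esym/eqP; rewrite minor_mul mulf_eq0 (negbTE g0).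
  move=> i l lJ; apply: contraNeq => H; apply: (AE i l lJ).
  have := minor_neighbor_entry i gA1 lJ; rewrite (negbTE H).
  by rewrite minor_mul mulf_eq0 (negbTE g0) => /negbT.
move=> B rB ZB B1; rewrite /h minor_chart_eval chart_mxK //; last exact: pattern.
by rewrite -coordE; apply: ZI.
Qed.

End ChainBounds.

Lemma krull_dim_sup (R : realType) (r n b : nat) (Y : classical_sets.set 'M[R[i]]_n) :
  (forall k, chain_length r Y k -> (k <= b)%N) ->
  (forall k, chain_length r Y k -> (k <= krull_dim r Y)%N) /\
  ((exists k, chain_length r Y k) -> chain_length r Y (krull_dim r Y)).
Proof.
move=> ub; have [[k0 Hk0]|none] := pselect (exists k, chain_length r Y k); last first.
  by split=> [k H|//]; case: none; exists k.
have ex : exists k, `[< chain_length r Y k >] by exists k0; apply/asboolP.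
have ub' k : `[< chain_length r Y k >] -> (k <= b)%N by move=> /asboolP/ub.
case: (ex_maxnP ex ub') => m /asboolP Hm maxm.
suff -> : krull_dim r Y = m by split=> // k /asboolP/maxm.
rewrite /krull_dim /supremum; case: ifPn => [/eqP E|_].
  have : [set k | chain_length r Y k]%classic m by [].
  by rewrite E.
have mS : supremums [set k | chain_length r Y k]%classic m.
  by split=> [k /= /asboolP/maxm //|k]; apply.
case: xgetP => [y _ yS|/(_ m) //].
exact: (is_subset1_supremums yS mS).
Qed.

(** * Lower bounds: closures of parametrized families *)

Section LowerBounds.
Variables (R : realType) (r n : nat).
Local Notation C := (R[i]).
Local Notation P := #|{: rsubset r n}|.
Implicit Types (A B : 'M[C]_(r, n)) (J I : rsubset r n) (f g : {mpoly C[P]}).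
Implicit Types (Y : classical_sets.set 'M[C]_n) (M : {set rsubset r n}).

Section Closure.
Variables (D : nat) (Q : 'M[{mpoly C[D]}]_(r, n)).
Hypothesis rankQ : forall x, \rank (map_mx (meval x) Q) = r.

Definition family_forms : classical_sets.set {mpoly C[P]} := fun f =>
  (exists d : nat, f \is d.-homog) /\ forall x, f.@[plucker (map_mx (meval x) Q)] = 0.

Definition family_closure : classical_sets.set 'M[C]_n := zero_locus family_forms.

Lemma family_forms_homog f : family_forms f -> exists d : nat, f \is d.-homog.
Proof. by case. Qed.

Lemma family_closureP A : \rank A = r ->
  family_closure <<A>>%MS <-> (forall f, family_forms f -> f.@[plucker A] = 0).
Proof. exact/zero_locusP/family_forms_homog. Qed.

Lemma family_in_closure x : family_closure <<map_mx (meval x) Q>>%MS.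
Proof. by apply/family_closureP => // f [_]. Qed.

Lemma family_pullbackE f x :
  (f \mPo [tuple minor Q (enum_val i) | i < P]).@[x] = f.@[plucker (map_mx (meval x) Q)].
Proof.
rewrite comp_mpoly_meval; apply: meval_eq => i.
by rewrite tnth_mktuple /plucker /minor -map_mxsub det_map_mx.
Qed.

(** Forms that are not identically zero on the family pull back to nonzero polynomials in the
    parameters, and the product of two such polynomials is nonzero somewhere. *)
Lemma family_closure_irreducible : irreducible_closed r family_closure.
Proof.
split; first by exists family_forms; split=> //; apply: family_forms_homog.
  by exists <<map_mx (meval (fun _ => 0)) Q>>%MS; apply: family_in_closure.
move=> Z1 Z2 [S1 [h1 Z1E]] [S2 [h2 Z2E]] sub; apply: contrapT => H.
have nform (S : classical_sets.set {mpoly C[P]}) :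
    (forall f, S f -> exists d : nat, f \is d.-homog) ->
    ~ classical_sets.subset family_closure (zero_locus S) ->
    exists2 f, S f & exists x, f.@[plucker (map_mx (meval x) Q)] != 0.
  move=> hS nsub; apply: contrapT => H'; apply: nsub => U [A [rA UA AF]].
  exists A; split=> // f Sf; apply: AF; split; first exact: hS.
  move=> x; apply: contrapT => nz; apply: H'; exists f => //; exists x; exact/eqP.
have [f1 Sf1 [x1 nz1]] : exists2 f, S1 f & exists x, f.@[plucker (map_mx (meval x) Q)] != 0.
  by apply: nform => // H1; apply: H; left; rewrite Z1E.
have [f2 Sf2 [x2 nz2]] : exists2 f, S2 f & exists x, f.@[plucker (map_mx (meval x) Q)] != 0.
  by apply: nform => // H2; apply: H; right; rewrite Z2E.
have [p pE] : exists p : {mpoly C[P]} -> {mpoly C[D]},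
    forall f x, (p f).@[x] = f.@[plucker (map_mx (meval x) Q)].
  by eexists => f x; apply: family_pullbackE.
have p0 f x : f.@[plucker (map_mx (meval x) Q)] != 0 -> p f != 0.
  by apply: contraNneq => pf; rewrite -pE pf meval0.
have [x] := mpoly_nonroot (mulf_neq0 (p0 _ _ nz1) (p0 _ _ nz2)).
rewrite mevalM !pE mulf_eq0 negb_or => /andP[/eqP a1 /eqP a2].
case: (sub _ (family_in_closure x)); rewrite ?Z1E ?Z2E => Hx.
  by apply: a1; move/(zero_locusP h1 (rankQ x)): Hx; apply.
by apply: a2; move/(zero_locusP h2 (rankQ x)): Hx; apply.
Qed.

End Closure.

Lemma chart_mx_rank J (E : {set 'I_r * 'I_n}) (x : 'I_#|E| -> C) : \rank (chart_mx J E x) = r.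
Proof.
apply: (@cminor_rank _ _ _ _ (subset_enum J)).
by rewrite /cminor chart_mx_norm det1 oner_eq0.
Qed.

(** Free the entries in E one at a time and take closures. Inclusions are strict because the
    coordinate of the neighbor that belongs to the new entry is zero on the previous closure. *)
Lemma chart_chain Y J (E : {set 'I_r * 'I_n}) : zclosed r Y ->
  (forall q, q \in E -> q.2 \notin val J) ->
  (forall x : 'I_#|E| -> C, Y <<chart_mx J E x>>%MS) -> chain_length r Y #|E|.
Proof.
move=> cY EJ EY.
pose y i (k : 'I_#|E|) : {mpoly C[#|E|]} := if (k < i)%N then 'X_k else 0.
pose Q i := chart_mx J E (y i).
have QE i x : map_mx (meval x) (Q i) = chart_mx J E (fun k => if (k < i)%N then x k else 0).
  rewrite map_chart_mx; apply: eq_chart_mx => k; rewrite /y.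
  by case: ifP; rewrite ?mevalXU ?meval0.
have rQ i x : \rank (map_mx (meval x) (Q i)) = r by rewrite QE chart_mx_rank.
exists (fun i => family_closure (Q i)); split=> i ik.
  split; first exact: family_closure_irreducible.
  move=> U [A [rA -> AF]]; case: cY => S [hS YE]; rewrite YE.
  apply/(zero_locusP hS rA) => f Sf; apply: AF; split; first exact: hS.
  move=> x; rewrite QE; move: (EY (fun k => if (k < i)%N then x k else 0)); rewrite YE.
  by move/(zero_locusP hS (chart_mx_rank _ _)); apply.
split.
  move=> U [A [rA -> AF]]; apply: (family_closureP (Q i.+1) rA).2 => f [hf Ff].
  apply: AF; split; first exact: hf.
  move=> x.
  have := Ff (fun k => if (k < i)%N then x k else 0); rewrite !QE.
  rewrite (@eq_chart_mx _ _ _ _ _ _ (fun k => if (k < i)%N then x k else 0)) // => k.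
  by have [ki|] := ltnP k i; rewrite ?if_same // (leq_trans ki).
pose k0 := Ordinal ik; pose q := enum_val k0.
have qJ : q.2 \notin val J by apply: EJ; apply: enum_valP.
pose x k : C := (k == k0)%:R.
move/(_ _ (family_in_closure (rQ i.+1) x)).
move/(family_closureP _ (rQ i.+1 x))/(_ (coord R (neighbor J q.1 q.2))).
rewrite QE coordE => H.
have /eqP : minor (chart_mx J E (fun k => if (k < i.+1)%N then x k else 0))
    (neighbor J q.1 q.2) = 0.
  apply: H; split; first by exists 1%N; apply: coord_homog.
  move=> z; rewrite QE coordE; apply/eqP.
  rewrite minor_neighbor_entry ?chart_mx_norm //.
  by rewrite chart_mx_in // ltnn.
rewrite minor_neighbor_entry ?chart_mx_norm // chart_mx_in //= ltnSn /x eqxx.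
by rewrite oner_eq0.
Qed.

Lemma zclosed_pvar M : zclosed r (@pvar R r n M).
Proof.
exists (fun f => exists2 I, I \notin M & f = coord R I); split.
  by move=> _ [I _ ->]; exists 1%N; apply: coord_homog.
apply/seteqP; split=> U [A [rA UA H]]; exists A; split=> //.
  by move=> _ [I IM ->]; rewrite coordE; apply: H.
by move=> I IM; rewrite -coordE; apply: H; exists I.
Qed.

Lemma pvarP M A : \rank A = r ->
  pvar M <<A>>%MS <-> (forall I, I \notin M -> minor A I = 0).
Proof.
move=> rA; split=> [[B [rB AB H]] I IM|H]; last by exists A.
by rewrite -coordE; apply: (vanish_span (coord_homog R I) rA rB AB); rewrite coordE H.
Qed.

Lemma zclosed_Gr : zclosed r (@Gr R r n).
Proof.
exists classical_sets.set0; split=> //; apply/seteqP; split=> U.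
  by move=> [A rA UA]; exists A.
by move=> [A [rA UA _]]; exists A.
Qed.

Definition outside J : {set 'I_r * 'I_n} := [set q | q.2 \notin val J].

Lemma card_outside J : #|outside J| = (r * (n - r))%N.
Proof.
have -> : outside J = finset.setX [set: 'I_r] (~: val J).
  by apply/setP => -[i l]; rewrite !inE.
by rewrite cardsX cardsT card_ord cardsCs finset.setCK card_ord (eqP (valP J)).
Qed.

Lemma chain_length_Gr k : chain_length r (@Gr R r n) k -> (k <= r * (n - r))%N.
Proof.
move=> [Z [irrZ strZ]].
have irr i : (i <= k)%N -> irreducible_closed r (Z i) by move=> /irrZ[].
have [J ZJ] := irreducible_coord (irr k (leqnn k)).
rewrite -(card_outside J); apply: (chain_bound irr strZ ZJ) => i l lJ _.
by rewrite inE.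
Qed.

Lemma chain_length_sub Y Y' k : classical_sets.subset Y Y' ->
  chain_length r Y k -> chain_length r Y' k.
Proof.
move=> YY' [Z [irrZ strZ]]; exists Z; split=> // i ik.
by have [? ZY] := irrZ i ik; split=> // U /ZY/YY'.
Qed.

Lemma pvar_sub_Gr M : classical_sets.subset (@pvar R r n M) (@Gr R r n).
Proof. by move=> U [A [rA UA _]]; exists A. Qed.

Lemma krull_dim_Gr (J : rsubset r n) : krull_dim r (@Gr R r n) = (r * (n - r))%N.
Proof.
have [ub mem] := krull_dim_sup chain_length_Gr.
have ch : chain_length r (@Gr R r n) (r * (n - r)).
  rewrite -(card_outside J); apply: (chart_chain zclosed_Gr (J := J)).
    by move=> q; rewrite inE.
  by move=> x; exists (chart_mx J (outside J) x) => //; apply: chart_mx_rank.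
apply/eqP; rewrite eqn_leq (ub _ ch) andbT; apply: chain_length_Gr.
by apply: mem; exists (r * (n - r))%N.
Qed.

Lemma krull_dim_pvar_sup M :
  (forall k, chain_length r (@pvar R r n M) k -> (k <= krull_dim r (@pvar R r n M))%N) /\
  ((exists k, chain_length r (@pvar R r n M) k) ->
    chain_length r (@pvar R r n M) (krull_dim r (@pvar R r n M))).
Proof.
apply: (krull_dim_sup (b := (r * (n - r))%N)) => k H.
by apply: chain_length_Gr; apply: chain_length_sub H; apply: pvar_sub_Gr.
Qed.

End LowerBounds.

(** * The Jacobian at coordinate points *)

Section DeterminantDerivation.
Variables (S L : comNzRingType) (h : {rmorphism S -> L}) (der : S -> L).
Hypothesis derD : forall x y, der (x + y) = der x + der y.
Hypothesis derM : forall x y, der (x * y) = der x * h y + h x * der y.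

Lemma der0 : der 0 = 0.
Proof. by apply: (addrI (der 0)); rewrite -derD !addr0. Qed.

Lemma der1 : der 1 = 0.
Proof. by apply: (addrI (der 1)); rewrite addr0 -{3}[1]mulr1 derM rmorph1 mulr1 mul1r. Qed.

Lemma derN x : der (- x) = - der x.
Proof. by apply/eqP; rewrite -addr_eq0 -derD addNr der0. Qed.

Lemma der_prod (I : eqType) (s : seq I) (F : I -> S) : uniq s ->
  der (\prod_(i <- s) F i) =
  \sum_(q <- s) \prod_(i <- s) (if i == q then der (F i) else h (F i)).
Proof.
elim: s => [_|x s IH /= /andP[xs us]]; first by rewrite !big_nil der1.
rewrite !big_cons derM eqxx IH //; congr (_ * _ + _).
  rewrite rmorph_prod [LHS]big_seq [RHS]big_seq; apply: eq_bigr => i is_.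
  by case: eqP => // ix; rewrite -ix is_ in xs.
rewrite mulr_sumr [LHS]big_seq [RHS]big_seq; apply: eq_bigr => q qs.
by rewrite big_cons; case: eqP => // xq; rewrite xq qs in xs.
Qed.

(** The product rule in the Leibniz formula, regrouped by the column that is differentiated. *)
Lemma der_det m (A : 'M[S]_m) : der (\det A) =
  \sum_p \det (\matrix_(i, j) if j == p then der (A i j) else h (A i j)).
Proof.
under [RHS]eq_bigr => p _ do rewrite /determinant.
rewrite [RHS]exchange_big /= /determinant (big_morph der derD der0); apply: eq_bigr => s _.
have -> : der ((-1) ^+ s * \prod_i A i (s i)) = (-1) ^+ s * der (\prod_i A i (s i)).
  by rewrite !mulr_sign; case: (s : bool); rewrite ?derN.
rewrite der_prod ?index_enum_uniq // -mulr_sumr; congr (_ * _).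
rewrite [RHS](reindex_inj (@perm_inj _ s)) /=; apply: eq_bigr => q _.
by apply: eq_bigr => i _; rewrite mxE (inj_eq (@perm_inj _ s)).
Qed.

End DeterminantDerivation.

Section Jacobian.
Variables (R : realType) (r n : nat).
Local Notation C := (R[i]).
Implicit Types (A X : 'M[C]_(r, n)) (J I : rsubset r n) (M : {set rsubset r n}).

Lemma jacobian_mul M A X k :
  (jacobian M A *m (mxvec X)^T) k 0 =
  \sum_p \det (\matrix_(i, j) (if j == p then X else A) i (subset_enum (enum_val k) j)).
Proof.
pose der (g : {mpoly C[r * n]}) : C := \sum_l g^`M(l).@[mxvec A 0] * mxvec X 0 l.
have derD x y : der (x + y) = der x + der y.
  by rewrite -big_split; apply: eq_bigr => l _; rewrite mderivD mevalD mulrDl.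
have derM x y : der (x * y) = der x * y.@[mxvec A 0] + x.@[mxvec A 0] * der y.
  rewrite /der mulr_suml mulr_sumr -big_split; apply: eq_bigr => l _ /=.
  rewrite mderivM mevalD !mevalM mulrDl; congr (_ + _); last by rewrite mulrA.
  by rewrite mulrAC.
transitivity (der (minor (@generic_mx R r n) (enum_val k))).
  by rewrite mxE; apply: eq_bigr => l _; rewrite !mxE.
rewrite minorE /cminor (der_det (h := meval (mxvec A 0))) //; apply: eq_bigr => p _.
congr (\det _); apply/matrixP => i j; rewrite !mxE.
case: ifP => _; last by rewrite [LHS]mevalXU mxvecE.
rewrite /der (bigD1 (mxvec_index i (subset_enum (enum_val k) j))) //=.
rewrite mderivX mnmE eqxx scale1r.
have -> (a : 'I_(r * n)) : (U_(a) - U_(a))%MM = 0%MM.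
  by apply/mnmP => b; rewrite mnmBE subnn mnm0E.
rewrite mpolyX0 meval1 mul1r mxvecE big1 ?addr0 // => l ll.
rewrite mderivX mnmE eq_sym (negbTE ll) scale0r meval0 mul0r //.
Qed.

Definition missing M J : {set 'I_r * 'I_n} :=
  [set q | (q.2 \notin val J) && (neighbor J q.1 q.2 \notin M)].

(** For each missing exchange of j for l, the direction [X] has column j of A in place l and zeros
    elsewhere. On the rows of the missing neighbors these directions give a diagonal matrix, with
    entries equal to the minor of J up to sign. *)
Lemma jacobian_rank_ge M A J : J \in M -> minor A J != 0 ->
  (#|missing M J| <= \rank (jacobian M A))%N.
Proof.
move=> JM AJ.
pose X (q : 'I_r * 'I_n) : 'M[C]_(r, n) :=
  \matrix_(i, l) (if l == q.2 then A i (subset_enum J q.1) else 0).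
have row_ex (s : 'I_#|missing M J|) : exists k : 'I_#|~: M|,
    enum_val k = neighbor J (enum_val s).1 (enum_val s).2.
  have sM : neighbor J (enum_val s).1 (enum_val s).2 \in ~: M.
    by have := enum_valP s; rewrite !inE => /andP[].
  by exists (enum_rank_in sM (neighbor J (enum_val s).1 (enum_val s).2)); rewrite enum_rankK_in.
have [rho rhoE] := choice row_ex.
pose D : 'M[C]_(r * n, #|missing M J|) := \matrix_(l, t) mxvec (X (enum_val t)) 0 l.
pose G := rowsub rho (jacobian M A) *m D.
have GE s t : G s t = \sum_p \det (\matrix_(i, j)
    (if j == p then X (enum_val t) else A) i (subset_enum (enum_val (rho s)) j)).
  rewrite -jacobian_mul mxE [RHS]mxE; apply: eq_bigr => l _.
  by rewrite !mxE.
have lJ (s : 'I_#|missing M J|) : (enum_val s).2 \notin val J.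
  by have := enum_valP s; rewrite inE => /andP[].
suff Gdiag : G = diag_mx (\row_s G s s) /\ forall s, G s s != 0.
  have Gu : G \in unitmx.
    rewrite unitmxE unitfE Gdiag.1 det_diag; apply/prodf_neq0 => s _.
    by rewrite mxE; apply: Gdiag.2.
  have {1}<- : \rank G = #|missing M J|.
    by apply/eqP; rewrite -[_ == _]/(row_free G) row_free_unit.
  apply: leq_trans (mxrankM_maxl _ _) _; apply: mxrankS; exact: rowsub_sub.
(* The p-th summand of G s t is the minor of A on the column list of the
   neighbor J - j_s + l_s, in which column p is replaced by j_t if that column
   is l_t, and by zero otherwise. *)
have term s t p : \det (\matrix_(i, j)
    (if j == p then X (enum_val t) else A) i (subset_enum (enum_val (rho s)) j)) =
  if subset_enum (enum_val (rho s)) p == (enum_val t).2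
  then cminor A (swap (subset_enum (enum_val (rho s))) p (subset_enum J (enum_val t).1)) else 0.
  case: eqP => [e|e].
    congr (\det _); apply/matrixP => i j; rewrite !mxE /swap.
    by case: eqP => [->|//]; rewrite mxE e eqxx.
  rewrite (expand_det_col _ p) big1 // => i _; rewrite !mxE eqxx.
  by rewrite mxE; case: eqP => //; rewrite mul0r.
have mem s : val (enum_val (rho s)) =
   (enum_val s).2 |: (val J :\ subset_enum J (enum_val s).1).
  by rewrite rhoE val_neighbor.
split.
  apply/matrixP => s t; rewrite [RHS]mxE.
  have [<-|st] := eqVneq s t; first by rewrite mulr1n [RHS]mxE.
  rewrite mulr0n GE; apply: big1 => p _; rewrite term; case: eqP => // e.
  have l_st : (enum_val s).2 = (enum_val t).2.
    have := subset_enum_in (enum_val (rho s)) p; rewrite mem e !inE (negbTE (lJ t)) andbF orbF.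
    by move/eqP.
  have i_st : (enum_val s).1 != (enum_val t).1.
    apply: contra_neq st => i_st; apply: enum_val_inj.
    by rewrite [LHS]surjective_pairing i_st l_st -surjective_pairing.
  have /subset_enumP[q qe] : subset_enum J (enum_val t).1 \in val (enum_val (rho s)).
    rewrite mem !inE subset_enum_in andbT.
    by rewrite (inj_eq (@subset_enum_inj _ _ J)) [(enum_val t).1 == _]eq_sym i_st orbT.
  have pq : p != q.
    apply: contraTneq (lJ t) => pq; rewrite -e pq -qe negbK; exact: subset_enum_in.
  apply: (cminor_noninj _ pq); rewrite /swap eqxx eq_sym (negbTE pq); exact: qe.
move=> s.
have /subset_enumP[p pe] : (enum_val s).2 \in val (enum_val (rho s)) by rewrite mem !inE eqxx.
rewrite GE (bigD1 p) //= term -pe eqxx big1 ?addr0; last first.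
  move=> q qp; rewrite term {1}pe (inj_eq (@subset_enum_inj _ _ _)) (negbTE qp) //.
have sI : injective (swap (subset_enum (enum_val (rho s))) p (subset_enum J (enum_val s).1)).
  apply: swap_inj; first exact: subset_enum_inj.
  move=> q qp; apply: contraNneq qp => qe.
  have := subset_enum_in (enum_val (rho s)) q; rewrite mem qe !inE eqxx /= orbF => /eqP qe'.
  by apply/eqP/(@subset_enum_inj _ _ (enum_val (rho s))); rewrite qe qe' pe.
rewrite -(minor_image_eq0 _ sI); suff -> : image_subset sI = J by [].
apply: val_inj => /=; apply/eqP.
rewrite eqEcard card_imset // card_ord (eqP (valP J)) leqnn andbT.
apply/subsetP => _ /imsetP[q _ ->]; rewrite /swap; case: eqP => [_|/eqP qp].
  exact: subset_enum_in.
have := subset_enum_in (enum_val (rho s)) q; rewrite mem !inE pe.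
by rewrite (inj_eq (@subset_enum_inj _ _ _)) (negbTE qp) /= => /andP[].
Qed.

Lemma chart_origin_minor J (E : {set 'I_r * 'I_n}) (x : 'I_#|E| -> C) (f : 'I_r -> 'I_n) :
  x =1 (fun _ => 0) -> cminor (chart_mx J E x) f != 0 -> forall q, f q \in val J.
Proof.
move=> x0 /cminor_neq0_perm[s Hs] q; have := Hs (s^-1%g q); rewrite permKV mxE.
by case: ifP => // _; rewrite big1 ?eqxx // => k _; rewrite x0 mul0rn.
Qed.

(** The columns of A outside J are zero, so after a change of one column a minor of I is nonzero
    only if the other r - 1 elements of I lie in J. Only the rows of missing neighbors survive. *)
Lemma jacobian_rank_le M J (E : {set 'I_r * 'I_n}) : J \in M ->
  (\rank (jacobian M (chart_mx J E (fun _ => 0%R : C))) <= #|missing M J|)%N.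
Proof.
move=> JM; set A := chart_mx _ _ _.
have nz k l : jacobian M A k l != 0 ->
    exists s : 'I_#|missing M J|, enum_val k = neighbor J (enum_val s).1 (enum_val s).2.
  move=> Hkl; set I := enum_val k.
  have IM : I \notin M by have := enum_valP k; rewrite inE.
  have : (jacobian M A *m (mxvec (vec_mx (delta_mx 0 l)))^T) k 0 != 0.
    rewrite vec_mxK trmx_delta mxE (bigD1 l) //= [X in _ * X + _]mxE !eqxx mulr1 big1 ?addr0 //.
    by move=> l' ll; rewrite [X in _ * X]mxE (negbTE ll) mulr0.
  rewrite jacobian_mul -/I; set X := vec_mx _ => nz.
  have [p Hp] : exists p,
      \det (\matrix_(i, j) (if j == p then X else A) i (subset_enum I j)) != 0.
    apply: contrapT => H; case/eqP: nz; apply: big1 => p _; apply: contrapT => Hp.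
    by apply: H; exists p; apply/eqP.
  have inJ q : q != p -> subset_enum I q \in val J.
    have [s Hs] : exists s : 'S_r, forall i,
        (if s i == p then X else A) i (subset_enum I (s i)) != 0.
      have := @cminor_neq0_perm _ _ _
        (\matrix_(i, j) (if j == p then X else A) i (subset_enum I j)) id.
      rewrite /cminor mxsub_id => /(_ Hp)[s Hs]; exists s => i.
      by have := Hs i; rewrite mxE.
    move=> qp; have := Hs (s^-1%g q); rewrite permKV (negbTE qp) mxE.
    by case: ifP => // _; rewrite big1 ?eqxx // => j _; rewrite mul0rn.
  have pJ : subset_enum I p \notin val J.
    apply: contra IM => pJ; suff -> : I = J by [].
    apply: val_inj; apply/eqP; rewrite eqEcard (eqP (valP I)) (eqP (valP J)) leqnn andbT.
    apply/subsetP => x /subset_enumP[q ->]; have [->//|] := eqVneq q p; exact: inJ.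
  have [i Hi] : exists i, subset_enum J i \notin val I.
    have /subsetPn[x xJ xI] : ~~ (val J \subset val I).
      apply: contra pJ => JI; have /eqP -> : val J == val I.
        by rewrite eqEcard JI (eqP (valP I)) (eqP (valP J)) leqnn.
      exact: subset_enum_in.
    by have [i xi] := subset_enumP xJ; exists i; rewrite -xi.
  have IE : I = neighbor J i (subset_enum I p).
    apply: val_inj; rewrite val_neighbor //; apply/eqP; rewrite eqEcard; apply/andP; split.
      apply/subsetP => x xI; rewrite !inE; have [q xq] := subset_enumP xI.
      have [qp|qp] := eqVneq q p; first by rewrite xq qp eqxx.
      apply/orP; right; rewrite {2}xq inJ // andbT.
      by apply: contraNneq Hi => <-.
    rewrite -(val_neighbor i pJ) (eqP (valP (neighbor J i (subset_enum I p)))).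
    by rewrite (eqP (valP I)).
  have qM : (i, subset_enum I p) \in missing M J by rewrite inE /= pJ -IE.
  by exists (enum_rank_in qM (i, subset_enum I p)); rewrite enum_rankK_in.
have row_ex (s : 'I_#|missing M J|) : exists k : 'I_#|~: M|,
    enum_val k = neighbor J (enum_val s).1 (enum_val s).2.
  have sM : neighbor J (enum_val s).1 (enum_val s).2 \in ~: M.
    by have := enum_valP s; rewrite !inE => /andP[].
  by exists (enum_rank_in sM (neighbor J (enum_val s).1 (enum_val s).2)); rewrite enum_rankK_in.
have [rho rhoE] := choice row_ex.
have sub : (jacobian M A <= rowsub rho (jacobian M A))%MS.
  apply/row_subP => k; have [->|/rV0Pn[l]] := eqVneq (row k (jacobian M A)) 0.
    exact: sub0mx.
  rewrite mxE => /nz[s ks].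
  have -> : k = rho s by apply: enum_val_inj; rewrite ks rhoE.
  have -> : row (rho s) (jacobian M A) = row s (rowsub rho (jacobian M A)).
    by apply/rowP => j; rewrite !mxE.
  exact: row_sub.
exact: leq_trans (mxrankS sub) (rank_leq_row _).
Qed.

End Jacobian.

(** * Smooth positroids as direct sums of uniform matroids *)

Section SameType.
Variables (r n : nat) (T : eqType) (lab : 'I_n -> T).
Implicit Types (J I K : rsubset r n).

(* I and J have equally many elements of each label. *)
Definition same_type J I : Prop :=
  label_matched (fun i => lab (subset_enum J i)) lab (subset_enum I).

Lemma same_type_refl J : same_type J J.
Proof. by exists 1%g => i; rewrite perm1. Qed.

Lemma same_type_sym J I : same_type J I -> same_type I J.
Proof. by case=> s H; exists s^-1%g => i; rewrite H permKV. Qed.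

Lemma same_type_trans J I K : same_type J I -> same_type I K -> same_type J K.
Proof. by move=> [s Hs] [t Ht]; exists (s * t)%g => i; rewrite Hs Ht permM. Qed.

Lemma same_type_neighbor J i l : l \notin val J ->
  same_type J (neighbor J i l) <-> lab l = lab (subset_enum J i).
Proof.
move=> lJ; have fI := swap_subset_inj (i := i) lJ.
have [|s Hs] := @same_image_perm _ _ _ _ fI (@subset_enum_inj _ _ (neighbor J i l)).
  by rewrite imset_subset_enum neighborE.
split=> [st|ll]; last first.
  exists s => q; have := Hs q; rewrite /= => <-; rewrite /swap.
  by case: eqP => [->|].
have c := card_label_matched (lab l) st.
apply: contrapT => ll.
have c' : #|[set p | lab (subset_enum (neighbor J i l) p) == lab l]| =
    #|[set q | lab (swap (subset_enum J) i l q) == lab l]|.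
  rewrite -[RHS](card_imset _ (@perm_inj _ s)); apply: eq_card => p; rewrite !inE.
  apply/idP/imsetP => [H|[q]].
    exists (s^-1%g p); rewrite ?permKV // inE Hs /= permKV //.
  by rewrite inE Hs /= => H ->.
move: c; rewrite c'; apply/eqP; rewrite neq_ltn; apply/orP; left.
apply: proper_card; apply/properP; split.
  apply/subsetP => q; rewrite !inE => H; rewrite /swap; by case: (q =P i).
exists i; rewrite !inE /swap ?eqxx // eq_sym; exact/eqP.
Qed.

End SameType.

Section Exchange.
Variables (r n : nat).
Implicit Types (J I K : rsubset r n) (M : {set rsubset r n}).

Definition exch J (x y : 'I_n) : rsubset r n := insubd J (y |: (val J :\ x)).

Lemma val_exch J x y : x \in val J -> y \notin val J -> val (exch J x y) = y |: (val J :\ x).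
Proof.
move=> xJ yJ; rewrite /exch val_insubd cardsU1 !inE (negbTE yJ) andbF /=.
suff -> : (1 + #|sval J :\ x|)%N = r by rewrite eqxx.
by have := cardsD1 x (val J); rewrite xJ => <-; apply/eqP/(valP J).
Qed.

Lemma neighbor_exch J i y : y \notin val J -> neighbor J i y = exch J (subset_enum J i) y.
Proof.
by move=> yJ; apply: val_inj; rewrite val_neighbor // val_exch // subset_enum_in.
Qed.

Lemma same_type_exch (T : eqType) (lab : 'I_n -> T) J x y : x \in val J -> y \notin val J ->
  same_type lab J (exch J x y) <-> lab y = lab x.
Proof.
move=> /subset_enumP[i ->] yJ; rewrite -neighbor_exch //; exact: same_type_neighbor.
Qed.

Definition present M J : {set 'I_r * 'I_n} :=
  [set q | (q.2 \notin val J) && (neighbor J q.1 q.2 \in M)].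

Lemma card_present_missing M J : (#|present M J| + #|missing M J| = r * (n - r))%N.
Proof.
rewrite -(card_outside J) -(cardsID [set q | neighbor J q.1 q.2 \in M] (outside J)).
by congr (_ + _)%N; apply: eq_card => q; rewrite !inE // andbC.
Qed.

Lemma representable_exchange (F : fieldType) (A : 'M[F]_(r, n)) J I :
  minor A J != 0 -> minor A I != 0 -> I != J ->
  exists x y, [/\ x \in val J :\: val I, y \in val I :\: val J & minor A (exch J x y) != 0].
Proof.
move=> AJ AI IJ; have [g g0 gA1] := normalize_minor AJ.
have [s Hs] : exists s : 'S_r, forall i, (g *m A) i (subset_enum I (s i)) != 0.
  by apply: cminor_neq0_perm; rewrite cminor_mul mulf_neq0.
have [i iI] : exists i, subset_enum J i \notin val I.
  have /subsetPn[x xJ xI] : ~~ (val J \subset val I).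
    apply: contra IJ => JI; rewrite eq_sym -val_eqE eqEcard JI.
    by rewrite (eqP (valP I)) (eqP (valP J)) leqnn.
  by have [i xi] := subset_enumP xJ; exists i; rewrite -xi.
set y := subset_enum I (s i).
have yI : y \in val I by apply: subset_enum_in.
have yJ : y \notin val J.
  apply: contra iI => /subset_enumP[q yq].
  have := Hs i; rewrite -/y yq; have := congr1 (fun B : 'M_r => B i q) gA1.
  by rewrite !mxE => -> ; case: (i =P q) => [->|]; rewrite ?eqxx // -yq yI.
exists (subset_enum J i), y; split; rewrite ?inE ?iI ?yJ ?subset_enum_in //.
rewrite -neighbor_exch //; have := minor_neighbor_entry i gA1 yJ.
rewrite minorE cminor_mul mulf_eq0 (negbTE g0) /= -minorE => ->; exact: Hs.
Qed.

End Exchange.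

(** * From labels to smoothness *)

Section SmoothOfLabels.
Variables (R : realType) (r n : nat) (T : eqType) (lab : 'I_n -> T).
Local Notation C := (R[i]).
Implicit Types (J I K : rsubset r n) (M : {set rsubset r n}).

(** At a point with nonzero minor K the rank is at least r (n - r) - #|present M K|. The codimension
    is at most this number because the chart of K with the entries [present M K] free lies in the
    variety. *)
Lemma label_sum_smooth M J : (forall I, I \in M <-> same_type lab J I) -> smooth R M.
Proof.
move=> MJ A rA /(pvarP _ rA) AM; apply/negP; rewrite -leqNgt.
have [K AK] := rank_minor rA.
have KM : K \in M by apply: contraNT AK => /AM ->.
apply: leq_trans (jacobian_rank_ge KM AK).
rewrite /codim (krull_dim_Gr R J) -(card_present_missing M K) leq_subLR leq_add2r.
apply: (krull_dim_pvar_sup R M).1.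
apply: (chart_chain (zclosed_pvar R M) (J := K)) => [q|x].
  by rewrite inE => /andP[].
apply/pvarP; first exact: chart_mx_rank.
move=> I; apply: contraNeq => /cminor_neq0_perm[s Hs].
apply/MJ; apply: same_type_trans ((MJ K).1 KM) _.
exists s => i; have := Hs i; set l := subset_enum I (s i).
have [lK|lK] := boolP (l \in val K).
  by rewrite mxE lK; case: (_ =P l) => [->|]; rewrite ?eqxx.
move=> nz; apply/esym/(same_type_neighbor _ _ lK).
apply: same_type_trans (same_type_sym ((MJ K).1 KM)) _; apply: (MJ _).1.
have : (i, l) \in present M K by apply: contraNT nz => h; rewrite chart_mx_out.
by rewrite inE /= => /andP[].
Qed.

End SmoothOfLabels.

(** * From smoothness to free charts *)

Section LabelsOfSmooth.
Variables (R : realType) (r n : nat).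
Local Notation C := (R[i]).
Implicit Types (J I K : rsubset r n).
Variables (M : {set rsubset r n}) (F : fieldType) (A0 : 'M[F]_(r, n)).
Hypothesis smoothM : smooth R M.
Hypothesis repM : forall I, (I \in M) = (minor A0 I != 0).

Lemma origin_in_pvar J (E : {set 'I_r * 'I_n}) (x : 'I_#|E| -> C) :
  J \in M -> x =1 (fun _ => 0) -> pvar M <<chart_mx J E x>>%MS.
Proof.
move=> JM x0; apply/pvarP; first exact: chart_mx_rank.
move=> I; apply: contraNeq => nz.
suff -> : I = J by [].
apply: val_inj; apply/eqP; rewrite eqEcard (eqP (valP I)) (eqP (valP J)) leqnn andbT.
by apply/subsetP => _ /subset_enumP[q ->]; apply: (chart_origin_minor x0 nz).
Qed.

Lemma smooth_present_le J : J \in M -> (#|present M J| <= krull_dim r (@pvar R r n M))%N.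
Proof.
move=> JM; pose A := chart_mx J finset.set0 (fun _ => 0%R : C).
have AY : pvar M <<A>>%MS by apply: origin_in_pvar.
have := smoothM (chart_mx_rank _ _) AY => /negP; rewrite -leqNgt => H.
have := leq_trans H (jacobian_rank_le R finset.set0 JM).
rewrite /codim (krull_dim_Gr R J) -(card_present_missing M J) leq_subLR.
by rewrite leq_add2r.
Qed.

(* The chart coordinates at the basis J are algebraically independent: a nonzero
   minor of a matrix A in the chart is a polynomial relation among them unless I
   is a basis too. *)
Lemma smooth_free J (A : 'M[C]_(r, n)) I : J \in M -> minor A J != 0 ->
  (forall i l, l \notin val J -> minor A (neighbor J i l) != 0 -> neighbor J i l \in M) ->
  minor A I != 0 -> I \in M.
Proof.
move=> JM AJ Anb AI; set k := krull_dim r (@pvar R r n M).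
have [Z [irrZY strZ]] : chain_length r (@pvar R r n M) k.
  apply: (krull_dim_pvar_sup R M).2; exists #|(finset.set0 : {set 'I_r * 'I_n})|.
  apply: (chart_chain (zclosed_pvar R M) (J := J)) => [q|x]; first by rewrite inE.
  apply: origin_in_pvar => // q; have := enum_valP q; by rewrite inE.
have irrZ i : (i <= k)%N -> irreducible_closed r (Z i) by move=> /irrZY[].
have ZY : classical_sets.subset (Z k) (@pvar R r n M) by case: (irrZY k (leqnn k)).
have inM K : ~ vanishes (Z k) (coord R K) -> K \in M.
  move=> H; apply: contrapT => /negP KM; apply: H => B rB /ZY /(pvarP _ rB) BM.
  by rewrite coordE BM.
pose N K := ~ vanishes (Z k) (coord R K).
(* As k is the dimension, k <= #|E| <= #|present M K| <= k, so no neighboring basis has a coordinate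
   that vanishes on Z k. *)
have stepN K x y : N K -> x \in val K -> y \notin val K -> exch K x y \in M -> N (exch K x y).
  move=> NK /subset_enumP[i ->] yK; rewrite -neighbor_exch // => KM'.
  pose E := [set q in present M K | `[< N (neighbor K q.1 q.2) >]].
  have kE : (k <= #|E|)%N.
    apply: (chain_bound irrZ strZ NK) => j l lK Njl.
    by rewrite !inE /= lK inM //=; apply/asboolP.
  have EP : E = present M K.
    apply/eqP; rewrite eqEcard; apply/andP; split.
      by apply/subsetP => q; rewrite inE => /andP[].
    by apply: leq_trans kE; apply: smooth_present_le; apply: inM.
  have : (i, y) \in E by rewrite EP inE /= yK.
  by rewrite inE => /andP[_ /asboolP].
have [K0 NK0] := irreducible_coord (irrZ k (leqnn k)).
(* Exchanges through bases lead from K0 to K, each one decreasing the number of elements of K still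
   absent. *)
have allN K : K \in M -> N K.
  move=> KM; move: {2}#|_|.+1 (ltnSn #|val K :\: val K0|) NK0 => m.
  elim: m K0 => // m IH K1 cm NK1.
  have [->//|KK1] := eqVneq K K1.
  have K1M := inM _ NK1; rewrite repM in K1M.
  have KM' := KM; rewrite repM in KM'.
  have [x [y [xx yy nz]]] := representable_exchange K1M KM' KK1.
  move: xx yy; rewrite !inE => /andP[xK xK1] /andP[yK1 yK].
  apply: (IH (exch K1 x y)); last by apply: stepN => //; rewrite repM.
  apply: (@leq_trans #|val K :\: val K1|); last by rewrite -ltnS.
  apply: proper_card; rewrite val_exch //; apply/properP; split.
    apply/subsetP => z; rewrite !inE negb_or negb_and negbK => /andP[/andP[zy zz] zK].
    rewrite zK andbT; case/orP: zz => // /eqP zx; by rewrite -zx zK in xK.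
  by exists y; rewrite !inE ?yK1 ?yK // eqxx.
apply: contrapT => /negP IM.
have kP : (k < #|present M J|)%N.
  apply: (chain_bound_strict irrZ strZ (allN J JM) _ AJ AI).
  - by move=> i l lJ /inM nM; rewrite inE /= lJ.
  - by move=> i l lJ /(Anb i l lJ) nM; rewrite inE /= lJ.
  - apply: contrapT => H; have := inM _ H; exact/negP.
by have := smooth_present_le JM; rewrite leqNgt kP.
Qed.

End LabelsOfSmooth.

Section LabelsFromExchanges.
Variables (R : realType) (r n : nat).
Local Notation C := (R[i]).
Implicit Types (J I K : rsubset r n).
Variables (M : {set rsubset r n}) (F : fieldType) (A0 : 'M[F]_(r, n)).
Hypothesis smoothM : smooth R M.
Hypothesis repM : forall I, (I \in M) = (minor A0 I != 0).

(** The block Vandermonde matrix with the labels of J on its rows has nonzero minors exactly at the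
    sets of the type of J, and its nonzero neighbors of J are bases by assumption. *)
Lemma smooth_free_labels (T : eqType) (lab : 'I_n -> T) J I : J \in M ->
  (forall x y, x \in val J -> y \notin val J -> lab y = lab x -> exch J x y \in M) ->
  same_type lab J I -> I \in M.
Proof.
move=> JM Jexch st.
pose A : 'M[C]_(r, n) := block_vandermonde C (fun i => lab (subset_enum J i)) lab.
apply: (smooth_free smoothM repM (A := A) JM).
- apply: cminor_block_vandermonde; [exact: subset_enum_inj|exact: same_type_refl].
- move=> i l lJ /block_vandermonde_matched/(same_type_neighbor _ _ lJ) ll.
  by rewrite neighbor_exch //; apply: Jexch; rewrite ?subset_enum_in.
- apply: cminor_block_vandermonde; [exact: subset_enum_inj|exact: st].
Qed.

Definition edge J x y := [&& x \in val J, y \notin val J & exch J x y \in M].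

(* In the chart of K = J - j' + l, the exchanges l -> l' and j -> j' lead to bases,
   so their product is a nonzero term of the minor of J - j + l'. *)
Lemma edge_path J j l j' l' : J \in M ->
  edge J j l -> edge J j' l -> edge J j' l' -> edge J j l'.
Proof.
move=> JM e1 e2 e3; have [->//|jj] := eqVneq j j'; have [<-//|ll] := eqVneq l l'.
have /and3P[jJ lJ e1M] := e1; have /and3P[j'J _ e2M] := e2; have /and3P[_ l'J e3M] := e3.
rewrite /edge jJ l'J /=.
have neq x y : x \in val J -> y \notin val J -> x != y by move=> xJ; apply: contraNneq => <-.
have [K Kdef] : exists K, K = exch J j' l by exists (exch J j' l).
rewrite -Kdef in e2M.
have KE z : (z \in val K) = (z == l) || (z != j') && (z \in val J).
  by rewrite Kdef val_exch // !inE.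
have lK : l \in val K by rewrite KE eqxx.
have l'K : l' \notin val K by rewrite KE (negbTE l'J) eq_sym (negbTE ll) andbF.
have jK : j \in val K by rewrite KE jj jJ orbT.
have j'K : j' \notin val K by rewrite KE eqxx (negbTE (neq _ _ j'J lJ)).
(* Only l, l' and j, j' share labels, so the label-preserving exchanges at K are the two covered by
   [E1] and [E2]. *)
pose lab (x : 'I_n) : nat :=
  if x \in [:: l; l'] then 0%N else if x \in [:: j; j'] then 1%N else x.+2.
have lab_l : lab l = 0%N by rewrite /lab !inE eqxx.
have lab_l' : lab l' = 0%N by rewrite /lab !inE eqxx orbT.
have lab_j : lab j = 1%N.
  by rewrite /lab !inE eqxx (negbTE (neq _ _ jJ lJ)) (negbTE (neq _ _ jJ l'J)).
have lab_j' : lab j' = 1%N.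
  by rewrite /lab !inE eqxx orbT (negbTE (neq _ _ j'J lJ)) (negbTE (neq _ _ j'J l'J)).
have E1 : exch K l l' = exch J j' l'.
  apply: val_inj; rewrite !val_exch //; apply/setP => z; rewrite !inE KE.
  by case: (z =P l') => //= _; case: (z =P l) => [->|] //=; rewrite (negbTE lJ) andbF.
have E2 : exch K j j' = exch J j l.
  apply: val_inj; rewrite !val_exch //; apply/setP => z; rewrite !inE KE.
  case: (z =P j') => [->|] //=; first by rewrite [j' == j]eq_sym (negbTE jj) j'J orbT.
  move=> _; case: (z =P l) => [->|] //=; by rewrite andbT eq_sym; apply: neq.
have E3 : exch (exch K l l') j j' = exch J j l'.
  have jK2 : j \in val (exch J j' l') by rewrite val_exch // !inE jj jJ orbT.
  have j'K2 : j' \notin val (exch J j' l').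
    by rewrite val_exch // !inE eqxx (negbTE (neq _ _ j'J l'J)).
  apply: val_inj; rewrite E1 val_exch // val_exch // [RHS]val_exch //.
  apply/setP => z; rewrite !inE.
  case: (z =P j') => [->|] //=; first by rewrite [j' == j]eq_sym (negbTE jj) j'J orbT.
  move=> _; case: (z =P l') => [->|] //=; by rewrite andbT eq_sym; apply: neq.
apply: (@smooth_free_labels _ lab K _ e2M).
  move=> x y xK yK; rewrite /lab !inE.
  case: (y =P l) => [yl|_]; first by rewrite yl lK in yK.
  case: (y =P l') => [->|yl'] /=.
    case: (x =P l) => [-> _|_]; first by rewrite E1.
    case: (x =P l') => [xl'|_ /=]; first by rewrite xl' (negbTE l'K) in xK.
    by case: ifP.
  case: (y =P j) => [yj|_]; first by rewrite yj jK in yK.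
  case: (y =P j') => [->|yj'] /=.
    case: ifP => // _; case: (x =P j) => [-> _|_]; first by rewrite E2.
    by case: (x =P j') => [xj'|//]; rewrite xj' (negbTE j'K) in xK.
  case: ifP => // _; case: ifP => // _ [] /val_inj yx.
  by rewrite yx xK in yK.
have st1 : same_type lab K (exch K l l') by apply/same_type_exch; rewrite // lab_l lab_l'.
rewrite -E3; apply: (same_type_trans st1); apply/same_type_exch; rewrite ?lab_j ?lab_j' //.
  by rewrite E1 val_exch // !inE jj jJ orbT.
by rewrite E1 val_exch // !inE eqxx (negbTE (neq _ _ j'J l'J)).
Qed.

Section Blocks.
Variable J : rsubset r n.
Hypothesis JM : J \in M.

Definition adjacent x y := edge J x y || edge J y x.
(** Distances 0, 1 and 2 in the exchange graph suffice for a component, since [edge_path] shortens a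
    path of length 3 to an edge. *)
Definition same_block x y :=
  [|| x == y, adjacent x y | [exists z, adjacent x z && adjacent z y]].
Definition block_label x : {set 'I_n} := [set y | same_block x y].

Lemma adjacentC x y : adjacent x y = adjacent y x.
Proof. by rewrite /adjacent orbC. Qed.

Lemma adjacent_in x y : adjacent x y -> (x \in val J) = (y \notin val J).
Proof. by case/orP => /and3P[-> h _]; rewrite ?h // (negbTE h). Qed.

Lemma adjacent_edge x y : x \in val J -> adjacent x y -> edge J x y.
Proof. by move=> xJ /orP[//|/and3P[_]]; rewrite xJ. Qed.

Lemma adjacent_path x a b y : adjacent x a -> adjacent a b -> adjacent b y -> adjacent x y.
Proof.
have path_in x' a' b' y' : x' \in val J -> adjacent x' a' -> adjacent a' b' ->
    adjacent b' y' -> adjacent x' y'.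
  move=> xJ xa ab by_; have aJ := adjacent_in xa; have bJ := adjacent_in ab.
  have bJ' : b' \in val J.
    by rewrite xJ in aJ; move: bJ; rewrite (negbTE (esym aJ)) => /esym/negbFE.
  rewrite /adjacent (edge_path JM (j := x') (l := a') (j' := b') (l' := y')) //.
  - exact: adjacent_edge.
  - by apply: adjacent_edge => //; rewrite adjacentC.
  - exact: adjacent_edge.
move=> xa ab by_; have [xJ|xJ] := boolP (x \in val J); first exact: path_in xa ab by_.
have aJ : a \in val J by move: (adjacent_in xa); rewrite (negbTE xJ) => /esym/negbFE.
have bJ : b \notin val J by rewrite -(adjacent_in ab).
have yJ : y \in val J by move: (adjacent_in by_); rewrite (negbTE bJ) => /esym/negbFE.
by rewrite adjacentC (path_in y b a x) // adjacentC.
Qed.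

Lemma same_block_refl x : same_block x x.
Proof. by rewrite /same_block eqxx. Qed.

Lemma same_block_sym x y : same_block x y = same_block y x.
Proof.
rewrite /same_block eq_sym adjacentC; congr [|| _, _ | _].
by apply: eq_existsb => z; rewrite adjacentC [adjacent z y]adjacentC andbC.
Qed.

Lemma same_block_adj x y z : same_block x y -> adjacent y z -> same_block x z.
Proof.
case/or3P => [/eqP -> yz|xy yz|/existsP[a /andP[xa ay]] yz].
- by rewrite /same_block yz orbT.
- by apply/or3P; apply: Or33; apply/existsP; exists y; rewrite xy.
- by apply/or3P; apply: Or32; apply: adjacent_path xa ay yz.
Qed.

Lemma same_block_trans x y z : same_block x y -> same_block y z -> same_block x z.
Proof.
move=> xy /or3P[/eqP <- //|yz|/existsP[a /andP[ya az]]]; first exact: same_block_adj xy yz.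
exact: same_block_adj (same_block_adj xy ya) az.
Qed.

Lemma block_labelP x y : block_label x = block_label y <-> same_block x y.
Proof.
split=> [e|xy].
  have yy : y \in block_label y by rewrite inE same_block_refl.
  by rewrite -e inE in yy.
apply/setP => z; rewrite !inE; apply/idP/idP; apply: same_block_trans => //.
by rewrite same_block_sym.
Qed.

(** A nonzero Leibniz term of the normalized matrix is a matching along edges. Conversely, two
    elements of a block on different sides of J are adjacent, since distance 2 preserves the
    side. *)
Lemma mem_block_labels I : I \in M <-> same_type block_label J I.
Proof.
split.
  move=> IM; have AJ := JM; rewrite repM in AJ.
  have [g g0 gA1] := normalize_minor AJ.
  have [s Hs] : exists s : 'S_r, forall i, (g *m A0) i (subset_enum I (s i)) != 0.
    by apply: cminor_neq0_perm; rewrite cminor_mul mulf_neq0 // -repM.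
  exists s => i; have := Hs i; set y := subset_enum I (s i).
  have [/subset_enumP[q ->]|yJ nz] := boolP (y \in val J).
    have := congr1 (fun B : 'M_r => B i q) gA1; rewrite !mxE => ->.
    by case: (i =P q) => [->|]; rewrite ?eqxx.
  apply/block_labelP/or3P; apply: Or32; rewrite /adjacent /edge subset_enum_in yJ /=.
  rewrite -neighbor_exch // repM; have := minor_neighbor_entry i gA1 yJ.
  by rewrite minorE cminor_mul mulf_eq0 (negbTE g0) /= -minorE => ->; rewrite nz.
apply: smooth_free_labels => // x y xJ yJ /block_labelP.
case/or3P => [/eqP yx|yx|/existsP[z /andP[yz zx]]].
- by rewrite -yx (negbTE yJ) in xJ.
- by have := yx; rewrite adjacentC => /(adjacent_edge xJ)/and3P[].
- have zJ : z \in val J by move: (adjacent_in yz); rewrite (negbTE yJ) => /esym/negbFE.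
  by move: (adjacent_in zx); rewrite zJ xJ.
Qed.

Lemma block_label_mixed x y : x != y -> block_label x = block_label y ->
  exists a b, [/\ a \in val J, b \notin val J, block_label a = block_label x &
    block_label b = block_label x].
Proof.
move=> xy /block_labelP.
have adj_mixed u v : adjacent u v -> exists a b, [/\ a \in val J, b \notin val J,
    block_label a = block_label u & block_label b = block_label u].
  move=> uv; have e : block_label v = block_label u.
    apply/block_labelP; rewrite same_block_sym.
    by apply: same_block_adj uv; apply: same_block_refl.
  have := adjacent_in uv; have [uJ|uJ] := boolP (u \in val J) => vJ.
    by exists u, v; rewrite -vJ.
  by exists v, u; split=> //; move: vJ => /esym/negbFE.
case/or3P => [/eqP e|/adj_mixed //|/existsP[z /andP[/adj_mixed]] //].
by rewrite e eqxx in xy.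
Qed.

End Blocks.

End LabelsFromExchanges.

(** * Nonnegative minors and noncrossing blocks *)

Section VandermondeSigns.
Variables (R : realFieldType) (r n : nat).
Implicit Types (J I K : rsubset r n) (f : 'I_r -> 'I_n).

Lemma subset_enum_lt J (i j : 'I_r) : (i < j)%N -> (subset_enum J i < subset_enum J j)%N.
Proof.
move=> ij; rewrite /subset_enum.
have tr : transitive (relpre (val : 'I_n -> nat) ltn) by move=> y x z; apply: ltn_trans.
have srt : sorted (relpre val ltn) (enum (val J)).
  rewrite {1}/enum_mem -enumT; apply: sorted_filter => //.
  by rewrite -sorted_map val_enum_ord iota_ltn_sorted.
rewrite !(enum_val_nth (subset_enum J i)).
apply: (sorted_ltn_nth tr (subset_enum J i) srt); rewrite ?inE -?cardE ?(eqP (valP J)) //.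
Qed.

Definition full_vandermonde : 'M[R]_(r, n) := block_vandermonde R (fun _ => tt) (fun _ => tt).

Lemma tt_matched f : label_matched (fun _ : 'I_r => tt) (fun _ => tt) f.
Proof. by exists 1%g. Qed.

Lemma cminor_full_vandermonde f : injective f -> cminor full_vandermonde f != 0.
Proof. by move=> fI; apply: cminor_block_vandermonde fI (tt_matched f). Qed.

Lemma minor_full_vandermonde J : 0 < minor full_vandermonde J.
Proof.
have -> : minor full_vandermonde J =
    \det (Vandermonde r (\row_j (subset_enum J j : nat)%:R : 'rV[R]_r)).
  congr (\det _); apply/matrixP => i j; rewrite !mxE eqxx; congr (_ ^+ _).
  have -> : row_degree (fun _ => tt) i = #|widen_ord (ltnW (ltn_ord i)) @: 'I_i|.
    apply: eq_card => k; rewrite inE eqxx andbT; apply/idP/imsetP => [ki|[m _ ->]].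
      by exists (Ordinal ki) => //; apply: val_inj.
    exact: (ltn_ord m).
  by rewrite card_imset ?card_ord // => k m /(congr1 val) /= /val_inj.
rewrite det_Vandermonde; apply: prodr_gt0 => i _; apply: prodr_gt0 => j ij.
by rewrite !mxE subr_gt0 ltr_nat subset_enum_lt.
Qed.

(** Sorting f changes both factors by the same sign, and the sorted Vandermonde minor is
    positive. *)
Lemma minor_sign (A : 'M[R]_(r, n)) f (fI : injective f) :
  exists2 c, 0 < c & cminor A f * cminor full_vandermonde f = c * minor A (image_subset fI).
Proof.
set I := image_subset fI.
have := @cminor_cross _ _ _ _ idfun A full_vandermonde f (subset_enum I) fI
  (@subset_enum_inj _ _ I).
rewrite imset_subset_enum /= -!minorE => /(_ erefl) E.
have V0 := minor_full_vandermonde I; set w := minor full_vandermonde I in V0 E.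
have Vf := cminor_full_vandermonde fI; set v := cminor full_vandermonde f in Vf E *.
exists (v ^+ 2 / w); first by rewrite divr_gt0 // exprn_even_gt0.
have w0 : w != 0 by rewrite gt_eqF.
by apply: (mulIf w0); rewrite mulrAC E; field.
Qed.

End VandermondeSigns.

Section PositroidNoncrossing.
Variables (R : realFieldType) (r n : nat) (T : eqType) (lab : 'I_n -> T).
Implicit Types (J I K : rsubset r n).

(** At most one exchange inside the class is needed; p or q is the partner when a and c lie on the
    same side of J. *)
Lemma adjust_class J (a c : 'I_n) : a != c -> lab a = lab c ->
  (exists p q, [/\ p \in val J, q \notin val J, lab p = lab a & lab q = lab a]) ->
  exists K, [/\ same_type lab J K, a \in val K, c \notin val K &
    forall x, lab x <> lab a -> (x \in val K) = (x \in val J)].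
Proof.
move=> ac lac [p [q [pJ qJ lp lq]]].
have ex x y : x \in val J -> y \notin val J -> lab x = lab a -> lab y = lab a ->
    same_type lab J (exch J x y) /\
    forall z, lab z <> lab a -> (z \in val (exch J x y)) = (z \in val J).
  move=> xJ yJ lx ly; split; first by apply/same_type_exch; rewrite ?lx.
  move=> z lz; rewrite val_exch // !inE.
  have [zy|_] := eqVneq z y; first by case: lz; rewrite zy.
  by have [zx|_] := eqVneq z x; first by case: lz; rewrite zx.
have neq x y : x \in val J -> y \notin val J -> x != y by move=> xJ; apply: contraNneq => <-.
have [aJ|aJ] := boolP (a \in val J); have [cJ|cJ] := boolP (c \in val J).
- have [st oth] := ex c q cJ qJ (esym lac) lq; exists (exch J c q); split=> //.
    by rewrite val_exch // !inE ac aJ orbT.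
  by rewrite val_exch // !inE eqxx (negbTE (neq _ _ cJ qJ)).
- by exists J; split=> //; apply: same_type_refl.
- have [st oth] := ex c a cJ aJ (esym lac) erefl; exists (exch J c a); split=> //.
    by rewrite val_exch // !inE eqxx.
  by rewrite val_exch // !inE eqxx (negbTE (neq _ _ cJ aJ)).
- have [st oth] := ex p a pJ aJ lp erefl; exists (exch J p a); split=> //.
    by rewrite val_exch // !inE eqxx.
  by rewrite val_exch // !inE (negbTE cJ) andbF orbF eq_sym.
Qed.

(** Take K of the type of J with a, b in K and c, d outside. The lists [f0], [f1], [f3], [f2] are K,
    K after a -> c, after b -> d, and after both. Exchanging a for d changes the type, which forces
    m2 m0 = m1 m3 for the minors of A, so their product is a square. The product of the four
    Vandermonde minors is negative, although each agrees in sign with that of A. *)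
Lemma positroid_noncrossing (A : 'M[R]_(r, n)) J (a b c d : 'I_n) :
  (forall I, 0 <= minor A I) -> (forall I, minor A I != 0 <-> same_type lab J I) ->
  (forall x y, x != y -> lab x = lab y -> exists p q,
     [/\ p \in val J, q \notin val J, lab p = lab x & lab q = lab x]) ->
  (a < b)%N -> (b < c)%N -> (c < d)%N -> lab a = lab c -> lab b = lab d -> lab a = lab b.
Proof.
move=> A0 AJ mixed ab bc cd lac lbd; apply: contrapT => lab_ab.
have ac : a != c by rewrite -val_eqE neq_ltn (ltn_trans ab bc).
have bd : b != d by rewrite -val_eqE neq_ltn (ltn_trans bc cd).
have [J1 [st1 aJ1 cJ1 oth1]] := adjust_class ac lac (mixed a c ac lac).
have [|K [st2 bK dK oth2]] := adjust_class (J := J1) bd lbd.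
  have [p [q [pJ qJ lp lq]]] := mixed b d bd lbd; exists p, q; split=> //.
    by rewrite oth1 // lp; apply: nesym.
  by rewrite oth1 // lq; apply: nesym.
have stK := same_type_trans st1 st2.
have aK : a \in val K by rewrite oth2.
have cK : c \notin val K by rewrite oth2 // -lac.
have [pa aE] := subset_enumP aK; have [pb bE] := subset_enumP bK.
have pab : pb != pa.
  by apply/eqP => e; apply: lab_ab; rewrite aE bE e.
pose f0 := subset_enum K; have f0I : injective f0 := @subset_enum_inj _ _ K.
pose f1 := swap f0 pa c; pose f3 := swap f0 pb d; pose f2 := swap f1 pb d.
have f1I : injective f1 by apply: swap_subset_inj.
have f3I : injective f3 by apply: swap_subset_inj.
have dc : c != d by rewrite -val_eqE neq_ltn cd.
have f2I : injective f2.
  apply: swap_inj => // q qb; rewrite /f1 /swap; case: ifP => // _.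
  by apply: contraNneq dK => <-; apply: subset_enum_in.
have pos (f : 'I_r -> 'I_n) (fI : injective f) : same_type lab K (image_subset fI) ->
    0 < cminor A f * cminor (full_vandermonde R r n) f.
  move=> st; have [w w0 ->] := minor_sign A fI; rewrite mulr_gt0 // lt_neqAle A0 andbT eq_sym.
  by apply/AJ; apply: same_type_trans st.
have im f (fI : injective f) : (forall q, lab (f q) = lab (f0 q)) ->
    same_type lab K (image_subset fI).
  move=> ff; have [|s Hs] := same_image_perm fI (@subset_enum_inj _ _ (image_subset fI)).
    by rewrite imset_subset_enum.
  by exists s => q; rewrite -/(f0 q) -ff Hs.
have P0 : 0 < cminor A f0 * cminor (full_vandermonde R r n) f0 by apply: pos (im _ f0I _).
have l1 q : lab (f1 q) = lab (f0 q).
  by rewrite /f1 /swap; case: (q =P pa) => [->|//]; rewrite /f0 -aE.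
have P1 := pos _ _ (im _ f1I l1).
have P3 : 0 < cminor A f3 * cminor (full_vandermonde R r n) f3.
  apply: pos (im _ f3I _) => q.
  by rewrite /f3 /swap; case: (q =P pb) => [->|//]; rewrite /f0 -bE.
have P2 : 0 < cminor A f2 * cminor (full_vandermonde R r n) f2.
  apply: pos (im _ f2I _) => q.
  by rewrite /f2 /swap; case: (q =P pb) => [->|//]; rewrite /f0 -bE.
have AK : minor A K != 0 by apply/AJ.
have [g g0 gA1] := normalize_minor AK.
have [B BE] : exists B, B = g *m A by exists (g *m A).
rewrite -BE in gA1; have cB f : cminor B f = \det g * cminor A f by rewrite BE cminor_mul.
have Bad : B pa d = 0.
  apply/eqP; rewrite -(minor_neighbor_entry _ gA1 dK) minorE cB mulf_eq0 (negbTE g0) /=.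
  rewrite -minorE; apply: contrapT => /negP/AJ H.
  have := same_type_trans (same_type_sym stK) H => /(same_type_neighbor _ _ dK).
  by rewrite -aE -lbd => /esym.
have B1 i q : B i (f0 q) = (i == q)%:R.
  by have := congr1 (fun B : 'M_r => B i q) gA1; rewrite !mxE.
(* As B has a zero at (pa, d), column d is a combination of the unit columns of [f1] alone, and
   Cramer's rule reads off its coefficient at pb. *)
have Bf2 : cminor B f2 = cminor B f1 * B pb d.
  rewrite cminor_swap mxE.
  have col_d : col d B = colsub f1 B *m col d B.
    apply/colP => i; rewrite !mxE (bigD1 pa) //= !mxE Bad mulr0 add0r.
    have [->|ipa] := eqVneq i pa.
      rewrite Bad big1 // => j jpa; rewrite !mxE /f1 /swap (negbTE jpa) B1 eq_sym.
      by rewrite (negbTE jpa) mul0r.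
    rewrite (bigD1 i) //= !mxE /f1 /swap (negbTE ipa) B1 eqxx mul1r big1 ?addr0 //.
    move=> j /andP[jpa ji]; rewrite !mxE (negbTE jpa) B1 eq_sym (negbTE ji).
    by rewrite mul0r.
  transitivity ((\adj (colsub f1 B) *m col d B) pb 0).
    by rewrite [RHS]mxE; apply: eq_bigr => i _; rewrite [col d B i 0]mxE.
  rewrite {1}col_d mulmxA mul_adj_mx mul_scalar_mx !mxE.
  by rewrite /cminor.
have Bf3 : cminor B f3 = B pb d by rewrite cminor_swap gA1 adj1 mul1mx.
have Bf0 : cminor B f0 = 1 by rewrite /cminor gA1 det1.
have AE : cminor A f2 * cminor A f0 = cminor A f1 * cminor A f3.
  have E : cminor B f2 * cminor B f0 = cminor B f1 * cminor B f3.
    by rewrite Bf2 Bf3 Bf0 mulr1.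
  have g2 : \det g ^+ 2 != 0 by rewrite expf_neq0.
  apply: (mulfI g2); move: E; rewrite !cB => E.
  by rewrite expr2 -!mulrA [X in _ * X]mulrCA [in RHS]mulrCA !mulrA -mulrA E; ring.
have V1 := @block_vandermonde_swap_sign R _ _ _ _ _ f0 pb d f0I (tt_matched f0) erefl _.
have V2 := @block_vandermonde_swap_sign R _ _ _ _ _ f1 pb d f1I (tt_matched f1) erefl _.
set N1 := between_count _ f0 pb d in V1; set N2 := between_count _ f1 pb d in V2.
(* Here c lies between b and d, whereas a does not. *)
have N12 : N2 = N1.+1.
  have bd' : (b <= d)%N by apply/ltnW/(ltn_trans bc cd).
  have mbd : minn b d = b by apply/minn_idPl.
  have Mbd : maxn b d = d by apply/maxn_idPr.
  have S12 : [set q | [&& q != pb, tt == tt & (minn (f1 pb) d < f1 q < maxn (f1 pb) d)%N]] =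
      pa |: [set q | [&& q != pb, tt == tt & (minn (f0 pb) d < f0 q < maxn (f0 pb) d)%N]].
    apply/setP => q; rewrite !inE /f1 /swap (negbTE pab).
    have [->|//] := eqVneq q pa; rewrite [pa == pb]eq_sym pab /= /f0 -bE mbd Mbd.
    by rewrite bc cd.
  rewrite /N2 /between_count S12 cardsU1 (_ : pa \notin _) //.
  by rewrite inE /f0 -aE -bE mbd ltnNge (ltnW ab) /= andbF.
have pb3 q : q != pb -> f0 q != d.
  by move=> _; apply: contraNneq dK => <-; apply: subset_enum_in.
have pb2 q : q != pb -> f1 q != d.
  by move=> qb; rewrite /f1 /swap; case: ifP => // _; apply: pb3.
have {}V1 := V1 pb3; have {}V2 := V2 pb2; rewrite N12 exprS mulN1r mulNr oppr_gt0 in V2.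
rewrite -/f2 -/f3 in V1 V2.
move: V1 V2 P0 P1 P2 P3 AE; rewrite /full_vandermonde.
move: (cminor A f0) (cminor A f1) (cminor A f2) (cminor A f3).
move: (cminor _ f0) (cminor _ f1) (cminor _ f2) (cminor _ f3) => v0 v1 v2 v3 a0 a1 a2 a3.
rewrite -(signr_odd _ N1) !mulr_sign => V1 V2 P0 P1 P2 P3 AE.
have st : (v0 * v3) * (v1 * v2) < 0.
  move: V1 V2; case: ifP => _; rewrite ?oppr_gt0 ?oppr_lt0 => h1 h2.
    by rewrite nmulr_rlt0.
  by rewrite pmulr_rlt0.
have : 0 < (a0 * v0) * (a2 * v2) * ((a1 * v1) * (a3 * v3)).
  by apply: mulr_gt0; apply: mulr_gt0.
have -> : (a0 * v0) * (a2 * v2) * ((a1 * v1) * (a3 * v3)) =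
  (a2 * a0) * (a1 * a3) * ((v0 * v3) * (v1 * v2)) by ring.
rewrite AE -expr2 ltNge => /negP; apply.
by rewrite mulr_ge0_le0 ?sqr_ge0 // ltW.
Qed.

Lemma same_type_card (P : pred 'I_n) J K : same_type lab J K ->
  (forall x y, lab x = lab y -> P x -> P y) ->
  #|[set q | P (subset_enum J q)]| = #|[set q | P (subset_enum K q)]|.
Proof.
move=> [s Hs] Pl; rewrite -[LHS](card_imset _ (@perm_inj _ s)); apply: eq_card => q.
rewrite inE; apply/imsetP/idP => [[p]|Pq].
  by rewrite inE => Pp ->; apply: Pl Pp; apply: Hs.
exists (s^-1%g q); rewrite ?permKV // inE; apply: Pl Pq.
by rewrite (Hs (s^-1%g q)) permKV.
Qed.

Section Construction.
Hypothesis nc : forall a b c d : 'I_n, (a < b)%N -> (b < c)%N -> (c < d)%N ->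
  lab a = lab c -> lab b = lab d -> lab a = lab b.
Variable J : rsubset r n.

Definition foreign_below (x : 'I_n) : nat :=
  #|[set q | (subset_enum J q < x)%N && (lab (subset_enum J q) != lab x)]|.

(* Since the labels do not cross, the number of elements of other labels between two
   elements of one label is the same in all sets of the type of J; the sign of a
   column makes up for it. *)
Definition twisted_vandermonde : 'M[R]_(r, n) := \matrix_(i, x)
  ((-1) ^+ foreign_below x * block_vandermonde R (fun q => lab (subset_enum J q)) lab i x).

Definition foreign_between K (x y : 'I_n) : nat :=
  #|[set q | (minn x y < subset_enum K q < maxn x y)%N && (lab (subset_enum K q) != lab x)]|.

(** Without crossings, a class other than that of x and y lies entirely between them or entirely
    outside, so the elements counted are determined by their labels. *)
Lemma foreign_between_type K x y : same_type lab J K -> lab x = lab y ->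
  foreign_between J x y = foreign_between K x y.
Proof.
move=> st lxy.
apply: (same_type_card (P := fun z =>
  (minn x y < z < maxn x y)%N && (lab z != lab x))) => // z z' lz /=.
wlog xy : x y lxy / (x < y)%N.
  move=> W; have [xy|yx|/val_inj ->] := ltngtP x y.
  - by have := W x y lxy xy; rewrite (minn_idPl (ltnW xy)) (maxn_idPr (ltnW xy)).
  - have := W y x (esym lxy) yx.
    by rewrite (minn_idPl (ltnW yx)) (maxn_idPr (ltnW yx)) lxy.
  - by move=> /andP[/andP[h1 h2]]; move: (ltn_trans h1 h2); rewrite ltnn.
have -> : minn x y = x by apply/minn_idPl/ltnW.
have -> : maxn x y = y by apply/maxn_idPr/ltnW.
move=> /andP[/andP[xz zy] lzx]; rewrite -lz lzx andbT; apply/andP; split.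
  have [//|z'x|/val_inj z'x] := ltngtP x z'.
    by case/eqP: lzx; rewrite lz; apply: (nc z'x xz zy) => //; rewrite -lz.
  by case/eqP: lzx; rewrite lz z'x.
have [//|yz'|/val_inj z'y] := ltngtP z' y.
  by case/eqP: lzx; apply/esym; apply: (nc xz zy yz').
by case/eqP: lzx; rewrite lz z'y.
Qed.

Lemma foreign_below_between x y : lab x = lab y ->
  (-1) ^+ foreign_below x * (-1) ^+ foreign_below y = (-1) ^+ foreign_between J x y :> R.
Proof.
wlog xy : x y / (x <= y)%N.
  move=> W lxy; have [xy|yx] := leqP x y; first exact: W.
  rewrite mulrC W ?(ltnW yx) //; congr (_ ^+ _).
  by apply: eq_card => q; rewrite !inE minnC maxnC lxy.
move=> lxy; have -> : foreign_below y = (foreign_below x + foreign_between J x y)%N.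
  rewrite /foreign_below -(cardsID [set q | (subset_enum J q < x)%N]
    [set q | (subset_enum J q < y)%N && (lab (subset_enum J q) != lab y)]).
  congr (_ + _)%N; apply: eq_card => q; rewrite !inE -lxy.
    rewrite andbC; case: ltnP => //= qx; by rewrite (leq_trans qx xy).
  have -> : minn x y = x by apply/minn_idPl.
  have -> : maxn x y = y by apply/maxn_idPr.
  by case: (ltngtP (subset_enum J q) x) => [h|h|/val_inj ->] //=; rewrite eqxx !andbF.
by rewrite exprD mulrA -expr2 sqrr_sign mul1r.
Qed.

Lemma cminor_twisted f : cminor twisted_vandermonde f = (\prod_q (-1) ^+ foreign_below (f q)) *
  cminor (block_vandermonde R (fun q => lab (subset_enum J q)) lab) f.
Proof.
have -> : cminor twisted_vandermonde f =
  \det (colsub f (block_vandermonde R (fun q => lab (subset_enum J q)) lab) *m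
    diag_mx (\row_q (-1) ^+ foreign_below (f q))).
  congr (\det _); apply/matrixP => i q; rewrite mul_mx_diag !mxE mulrC.
  by [].
rewrite det_mulmx det_diag mulrC; congr (_ * _).
by apply: eq_bigr => q _; rewrite mxE.
Qed.

Lemma twisted_matched I : minor twisted_vandermonde I != 0 <-> same_type lab J I.
Proof.
rewrite minorE cminor_twisted mulf_eq0 negb_or.
have -> /= : \prod_q (-1) ^+ foreign_below (subset_enum I q) != 0 :> R.
  by apply/prodf_neq0 => q _; rewrite signr_eq0.
split; first exact: block_vandermonde_matched.
exact/cminor_block_vandermonde/subset_enum_inj.
Qed.

(** The full Vandermonde minor takes a sign for every column of K between x and y, the block one
    only for those with the label of x; the twist supplies the sign of the others. *)
Lemma twisted_exch_sign K x y : same_type lab J K -> x \in val K -> y \notin val K ->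
  lab y = lab x -> 0 < minor twisted_vandermonde K * minor twisted_vandermonde (exch K x y).
Proof.
move=> st xK yK lyx; have [p xE] := subset_enumP xK.
rewrite xE -neighbor_exch // (neighborE _ yK).
set fI := swap_subset_inj _; set f' := swap _ _ _ in fI *; set f := subset_enum K.
have [w w0 E] := minor_sign twisted_vandermonde fI.
suff : 0 < cminor twisted_vandermonde f * cminor twisted_vandermonde f' *
    (cminor (full_vandermonde R r n) f * cminor (full_vandermonde R r n) f').
  have Vf : 0 < cminor (full_vandermonde R r n) f by apply: minor_full_vandermonde.
  have -> : cminor twisted_vandermonde f * cminor twisted_vandermonde f' *
    (cminor (full_vandermonde R r n) f * cminor (full_vandermonde R r n) f') =
    cminor twisted_vandermonde f * cminor (full_vandermonde R r n) f *
    (cminor twisted_vandermonde f' * cminor (full_vandermonde R r n) f') by ring.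
  rewrite E (_ : _ * _ * _ = cminor (full_vandermonde R r n) f * w *
    (minor twisted_vandermonde K * minor twisted_vandermonde (image_subset fI))); last first.
    by rewrite [minor _ K]minorE -/f; ring.
  by rewrite (pmulr_rgt0 _ (mulr_gt0 Vf w0)).
have fl q : q != p -> f q != y.
  by move=> _; apply/eqP => fq; move/negP: (yK); apply; rewrite -fq; apply: subset_enum_in.
have f0I : injective f := @subset_enum_inj _ _ K.
have lyp : lab y = lab (f p) by rewrite lyx xE.
have V1 := @block_vandermonde_swap_sign R _ _ _ _ _ f p y f0I (tt_matched f) erefl fl.
have V2 := block_vandermonde_swap_sign R f0I st lyp fl.
rewrite -/f' -/(full_vandermonde R r n) in V1 V2.
rewrite !cminor_twisted.
have sgn : (\prod_q (-1) ^+ foreign_below (f q)) * (\prod_q (-1) ^+ foreign_below (f' q)) =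
    (-1) ^+ foreign_between J (f p) y :> R.
  rewrite -foreign_below_between // (bigD1 p) //= [X in _ * X](bigD1 p) //=.
  rewrite {1}/f' /swap eqxx.
  have -> : \prod_(i | i != p) (-1) ^+ foreign_below (f' i) =
      \prod_(i | i != p) (-1) ^+ foreign_below (f i) :> R.
    by apply: eq_bigr => q qp; rewrite /f' /swap (negbTE qp).
  set Q := \prod_(i | i != p) _; have QQ : Q * Q = 1.
    by rewrite -big_split big1 //= => q _; rewrite -expr2 sqrr_sign.
  by rewrite mulrACA QQ mulr1.
move: V1 V2 sgn.
move: (cminor (block_vandermonde _ _ _) f) (cminor (block_vandermonde _ _ _) f').
move: (cminor (full_vandermonde R r n) f) (cminor (full_vandermonde R r n) f').
move: (\prod_q _) (\prod_q _) => s' s v v' w1 w2 V1 V2 sgn.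
have -> : s * w1 * (s' * w2) * (v * v') = (s * s') * (w1 * w2) * (v * v') by ring.
have N12 : between_count (fun _ => tt) f p y =
    (between_count lab f p y + foreign_between K (f p) y)%N.
  rewrite /between_count /foreign_between -(cardsID [set q | lab (f q) == lab (f p)]).
  congr (_ + _)%N; apply: eq_card => q; rewrite !inE.
    by case: (q != p) => //=; rewrite andbC.
  rewrite -/(f q) andbC; case: (q =P p) => [->|_] /=; last by rewrite andbC.
  by rewrite eqxx andbF.
rewrite sgn (foreign_between_type st (esym lyp)).
rewrite N12 exprD in V1.
have := mulr_gt0 V1 V2; have := sqrr_sign R (between_count lab f p y).
move: ((-1) ^+ between_count lab f p y) ((-1) ^+ foreign_between K (f p) y) => e1 e2 e1E.
have -> : e1 * e2 * (v * v') * (e1 * (w1 * w2)) = e1 ^+ 2 * (e2 * (w1 * w2) * (v * v')) by ring.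
by rewrite e1E mul1r.
Qed.

Lemma twisted_sign K : same_type lab J K ->
  0 < minor twisted_vandermonde K * minor twisted_vandermonde J.
Proof.
have TJ : minor twisted_vandermonde J != 0 by apply/twisted_matched/same_type_refl.
move: {2}#|_|.+1 (ltnSn #|val K :\: val J|) => m.
elim: m K => // m IH K cm st.
have [->|KJ] := eqVneq K J; first by rewrite -expr2 exprn_even_gt0.
have JK : J != K by rewrite eq_sym.
have TK : minor twisted_vandermonde K != 0 by apply/twisted_matched.
have [x [y [xx yy]]] := representable_exchange TK TJ JK.
move: xx yy; rewrite !inE => /andP[xJ xK] /andP[yK yJ] /twisted_matched stE.
have lxy : lab y = lab x.
  exact: (same_type_exch lab xK yK).1 (same_type_trans (same_type_sym st) stE).
have s1 := twisted_exch_sign st xK yK lxy.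
have s2 : 0 < minor twisted_vandermonde (exch K x y) * minor twisted_vandermonde J.
  apply: IH stE; apply: (@leq_trans #|val K :\: val J|); last by rewrite -ltnS.
  apply: proper_card; rewrite val_exch //; apply/properP; split.
    apply/subsetP => z; rewrite !inE => /andP[zJ] /orP[/eqP zy|/andP[_ ->]].
      by rewrite zy yJ in zJ.
    by rewrite zJ.
  exists x; rewrite !inE ?xJ ?xK // eqxx /= orbF.
  by apply: contraNneq yK => <-.
move: s1 s2; move: (minor _ K) (minor _ J) (minor _ (exch K x y)) => a b c s1 s2.
have := mulr_gt0 s1 s2; have -> : a * c * (c * b) = c ^+ 2 * (a * b) by ring.
have c0 : c != 0 by apply: contraTneq s1 => ->; rewrite mulr0 ltxx.
by rewrite pmulr_rgt0 // exprn_even_gt0.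
Qed.

Lemma nonneg_label_matrix : exists A : 'M[R]_(r, n), [/\ \rank A = r, forall I, 0 <= minor A I &
  forall I, minor A I != 0 <-> same_type lab J I].
Proof.
have TJ : minor twisted_vandermonde J != 0 by apply/twisted_matched/same_type_refl.
have [g g0 gA1] := normalize_minor TJ.
have gJ : \det g * minor twisted_vandermonde J = 1.
  by rewrite minorE -cminor_mul /cminor gA1 det1.
have AI I : minor (g *m twisted_vandermonde) I != 0 <-> same_type lab J I.
  rewrite minorE cminor_mul mulf_eq0 (negbTE g0) /= -minorE; exact: twisted_matched.
exists (g *m twisted_vandermonde); split=> //.
  by apply: (@cminor_rank _ _ _ _ (subset_enum J)); rewrite -minorE; apply/AI/same_type_refl.
move=> I; have [->//|/AI/twisted_sign s] := eqVneq (minor (g *m twisted_vandermonde) I) 0.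
have -> : minor (g *m twisted_vandermonde) I =
    \det g ^+ 2 * (minor twisted_vandermonde I * minor twisted_vandermonde J).
  by rewrite expr2 mulrACA gJ mulr1 !minorE cminor_mul.
by rewrite mulr_ge0 ?sqr_ge0 // ltW.
Qed.

End Construction.

End PositroidNoncrossing.

(** * The count *)

Lemma label_matched_count (r : nat) (T : finType) (l1 l2 : 'I_r -> T) :
  (forall t, #|[set i | l1 i == t]| = #|[set i | l2 i == t]|) ->
  exists s : 'S_r, forall i, l1 i = l2 (s i).
Proof.
move=> H; have /tuple_permP[s E] : perm_eq [tuple l1 i | i < r] [tuple l2 i | i < r].
  apply/allP => t _; apply/eqP; rewrite /= -!sum1_count !big_map -!enumT !big_enum_cond /=.
  have := H t; rewrite -!sum1_card.
  by under eq_bigl do rewrite inE; under [in RHS]eq_bigl do rewrite inE.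
exists s => i; have := congr1 (fun u : seq T => nth (l1 i) u i) E.
rewrite -[nth _ _ i]tnth_nth.
by rewrite -[RHS]tnth_nth !tnth_mktuple.
Qed.

Section BlockRanks.
Variables (R : realType) (n : nat).
Hypothesis n0 : (0 < n)%N.
Implicit Types (P : {set {set 'I_n}}) (rk : {ffun {set 'I_n} -> 'I_n.+1}) (B : {set 'I_n}).

(* A singleton is a loop or a coloop; on a larger block the uniform matroid has to be
   connected. *)
Definition block_rank_ok B (v : 'I_n.+1) : bool :=
  if #|B| == 1%N then (v <= 1)%N else (0 < v < #|B|)%N.

(** The value off P is pinned to 0, so each assignment of ranks to blocks is a single finite
    function. *)
Definition rank_choices P B : pred 'I_n.+1 :=
  if B \in P then block_rank_ok B else pred1 ord0.

Definition ranked_partition P rk : bool :=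
  [&& finset.partition P finset.setT, noncrossing P & rk \in family (rank_choices P)].

Definition total_rank P rk : nat := (\sum_(B in P) rk B)%N.

Definition direct_sum r P rk : {set rsubset r n} :=
  [set I : rsubset r n | [forall B in P, #|val I :&: B| == rk B]].

Lemma ranked_partition_block P rk B : ranked_partition P rk -> B \in P ->
  (rk B <= #|B|)%N /\ ((1 < #|B|)%N -> (0 < rk B < #|B|)%N).
Proof.
move=> /and3P[PT _ /familyP/(_ B)]; rewrite /rank_choices => + BP; rewrite BP.
have B0 : (0 < #|B|)%N by rewrite card_gt0; apply: partition_neq0 PT BP.
rewrite /block_rank_ok unfold_in /=; case: eqP => [->|B1]; first by [].
by move=> /andP[h1 h2]; rewrite (ltnW h2) h1 h2.
Qed.

Lemma card_rank_choices P B : finset.partition P finset.setT ->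
  #|rank_choices P B| = if B \in P then s_c #|B| else 1%N.
Proof.
move=> PT; rewrite /rank_choices; case: ifP => BP; last by rewrite card1.
have B0 : (0 < #|B|)%N by rewrite card_gt0; apply: partition_neq0 PT BP.
have Bn : (#|B| <= n)%N by rewrite -[X in (_ <= X)%N](card_ord n) max_card.
rewrite /s_c; case: ifP => B1.
  transitivity #|[set ord0; inord 1 : 'I_n.+1]|; last first.
    by rewrite cards2 -val_eqE /= inordK.
  apply: eq_card => v; rewrite !inE unfold_in /= /block_rank_ok B1 -!val_eqE /= inordK //.
  by case: (nat_of_ord v) => [|[|]].
have lt_n i : (i < #|B|.-1)%N -> (i.+1 < n.+1)%N.
  by move: (#|B|) Bn => m; lia.
have inj : injective (fun i : 'I_(#|B|.-1) => inord i.+1 : 'I_n.+1).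
  move=> i j /(congr1 val); rewrite /= !inordK ?lt_n //.
  by case=> /val_inj.
rewrite -[RHS](card_ord #|B|.-1) -(card_codom inj); apply: eq_card => v.
rewrite unfold_in /= /block_rank_ok B1; apply/idP/codomP => [/andP[v0 vB]|[i ->]].
  have iB : (v.-1 < #|B|.-1)%N by move: (#|B|) (nat_of_ord v) v0 vB => m w; lia.
  by exists (Ordinal iB); apply: val_inj; rewrite /= inordK prednK //.
rewrite inordK ?lt_n //=.
by have := ltn_ord i; move: (nat_of_ord i) => w; move: (#|B|) => m; lia.
Qed.

Lemma card_ranked_partitions :
  #|[set v : {set {set 'I_n}} * {ffun {set 'I_n} -> 'I_n.+1} | ranked_partition v.1 v.2]| =
  (\sum_(P : {set {set 'I_n}} | finset.partition P finset.setT && noncrossing P)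
    \prod_(B in P) s_c #|B|)%N.
Proof.
rewrite -sum1_card (eq_bigl (fun v : {set {set 'I_n}} * {ffun {set 'I_n} -> 'I_n.+1} =>
  (finset.partition v.1 finset.setT && noncrossing v.1) && (v.2 \in family (rank_choices v.1)))); last by move=> v; rewrite inE /ranked_partition andbA.
rewrite -(pair_big_dep (fun P : {set {set 'I_n}} =>
    finset.partition P finset.setT && noncrossing P)
  (fun P (rk : {ffun {set 'I_n} -> 'I_n.+1}) => rk \in family (rank_choices P))
  (fun _ _ => 1%N)) /=.
apply: eq_bigr => P /andP[PT _]; rewrite sum1_card card_family.
rewrite foldrE big_map big_enum /= [RHS]big_mkcond; apply: eq_bigr => B _.
exact: card_rank_choices.
Qed.

Section Fixed.
Variables (r : nat) (P : {set {set 'I_n}}) (rk : {ffun {set 'I_n} -> 'I_n.+1}).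
Hypothesis ok : ranked_partition P rk.
Hypothesis tot : total_rank P rk = r.

Let PT : finset.partition P finset.setT. Proof. by case/and3P: ok. Qed.

Lemma pblock_eqP x B : B \in P -> (pblock P x == B) = (x \in B).
Proof.
move=> BP; apply/eqP/idP => [<-|xB]; first by rewrite mem_pblock (cover_partition PT) inE.
exact: def_pblock (partition_trivIset PT) BP xB.
Qed.

Lemma pblock_in x : pblock P x \in P.
Proof. by rewrite pblock_mem // (cover_partition PT) inE. Qed.

Lemma card_label_subset (I : rsubset r n) t :
  #|[set i | pblock P (subset_enum I i) == t]| = #|[set x in val I | pblock P x == t]|.
Proof.
rewrite -(card_imset _ (@subset_enum_inj _ _ I)); apply: eq_card => x; rewrite inE.
apply/imsetP/andP => [[q]|[/subset_enumP[q ->] e]].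
  by rewrite inE => e ->; rewrite subset_enum_in.
by exists q => //; rewrite inE.
Qed.

Lemma same_type_direct_sum (J I : rsubset r n) : J \in direct_sum r P rk ->
  I \in direct_sum r P rk <-> same_type (pblock P) J I.
Proof.
rewrite !inE => /forall_inP HJ.
have cardE (K : rsubset r n) B : B \in P ->
    #|[set i | pblock P (subset_enum K i) == B]| = #|val K :&: B|.
  by move=> BP; rewrite card_label_subset; apply: eq_card => x; rewrite !inE pblock_eqP.
split=> [/forall_inP HI|st].
  apply: (@label_matched_count _ _ (fun i => pblock P (subset_enum J i))
    (fun i => pblock P (subset_enum I i))) => t; have [tP|tP] := boolP (t \in P).
    by rewrite !cardE // (eqP (HI t tP)) (eqP (HJ t tP)).
  have nt x : (pblock P x == t) = false.
    by apply: contraNF tP => /eqP <-; apply: pblock_in.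
  by rewrite !card_label_subset !eq_card0 // => x; rewrite !inE nt andbF.
apply/forall_inP => B BP; have := card_label_matched B st.
by rewrite !cardE // => <-; apply: HJ.
Qed.

Lemma direct_sum_inhabited : exists J, J \in direct_sum r P rk.
Proof.
have H B : exists S : {set 'I_n}, B \in P -> S \subset B /\ #|S| = rk B.
  have [BP|] := boolP (B \in P); last by exists finset.set0.
  have [S [SB _] cS] := initial_exists (ranked_partition_block ok BP).1.
  by exists S.
have [S HS] := choice H.
pose J := \bigcup_(B in P) S B.
have JB B : B \in P -> J :&: B = S B.
  move=> BP; apply/setP => x; rewrite inE; apply/andP/idP => [[]|xS].
    move=> /bigcupP[B' B'P xS'] xB.
    have xB' := subsetP (HS B' B'P).1 x xS'.
    rewrite -(eqP (_ : pblock P x == B)) ?pblock_eqP //.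
    by rewrite (eqP (_ : pblock P x == B')) // pblock_eqP.
  split; last exact: subsetP (HS B BP).1 x xS.
  by apply/bigcupP; exists B.
have cJ : #|J| == r.
  apply/eqP; rewrite -tot -[J]finset.setIT -(cover_partition PT) /cover.
  rewrite -sum1_card (partition_big (pblock P) [in P]) /= => [|x _]; last exact: pblock_in.
  apply: eq_bigr => B BP; rewrite -(HS B BP).2 -(JB B BP) -sum1_card.
  apply: eq_bigl => x; rewrite !inE pblock_eqP // (_ : (x \in cover P) = true) ?andbT //.
  by rewrite (cover_partition PT) inE.
exists (exist _ J cJ : rsubset r n); rewrite inE; apply/forall_inP => B BP /=.
by rewrite JB // (HS B BP).2.
Qed.

Lemma direct_sum_good : is_positroid R (direct_sum r P rk) /\ smooth R (direct_sum r P rk).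
Proof.
have [J JM] := direct_sum_inhabited.
have iff I := same_type_direct_sum I JM.
split; last exact: (label_sum_smooth (lab := pblock P) (J := J)).
have nc (a b c d : 'I_n) : (a < b)%N -> (b < c)%N -> (c < d)%N ->
    pblock P a = pblock P c -> pblock P b = pblock P d -> pblock P a = pblock P b.
  move=> ab bc cd e1 e2; case/and3P: ok => _ /asboolP ncP _.
  apply: ncP; rewrite ?pblock_in //; exists a, b, c, d; split; split=> //.
  - by rewrite mem_pblock (cover_partition PT).
  - by rewrite mem_pblock (cover_partition PT).
  - by rewrite e1 mem_pblock (cover_partition PT).
  - by rewrite e2 mem_pblock (cover_partition PT).
have [A [rA A0 AI]] := nonneg_label_matrix R nc J.
exists A; split=> // I; apply/idP/idP => [/iff/AI //|/AI/iff //].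
Qed.

Lemma direct_sum_rank J B : J \in direct_sum r P rk -> B \in P ->
  nat_of_ord (rk B) = #|val J :&: B|.
Proof. by rewrite inE => /forall_inP H /H /eqP ->. Qed.

(** This recovers the partition from the bases. A block with two elements has rank strictly between
    0 and its size, so some basis contains x but not y. *)
Lemma pblock_direct_sum x y : x != y ->
  pblock P x = pblock P y <-> exists K : rsubset r n,
    [/\ K \in direct_sum r P rk, x \in val K, y \notin val K &
      exch K x y \in direct_sum r P rk].
Proof.
move=> xy; have [J JM] := direct_sum_inhabited; split=> [e|[K [KM xK yK eM]]]; last first.
  apply/esym/(same_type_exch _ xK yK); exact/(same_type_direct_sum _ KM).
set B := pblock P x in e.
have BP : B \in P by apply: pblock_in.
have xB : x \in B by rewrite mem_pblock (cover_partition PT).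
have yB : y \in B by rewrite e mem_pblock (cover_partition PT).
have B1 : (1 < #|B|)%N by apply/card_gt1P; exists x, y.
have [_ /(_ B1)/andP[r0 rB]] := ranked_partition_block ok BP.
rewrite (direct_sum_rank JM BP) in r0 rB.
have [|K [st xK yK _]] := @adjust_class _ _ _ (pblock P) J x y xy e.
  have /card_gt0P[p] := r0; rewrite inE => /andP[pJ pB].
  have /subsetPn[q qB qJ] : ~~ (B \subset val J).
    by apply: contraTN rB => /finset.setIidPr ->; rewrite ltnn.
  exists p, q; split=> //; first by apply/eqP; rewrite pblock_eqP.
  by apply/eqP; rewrite pblock_eqP.
have KM : K \in direct_sum r P rk by apply/(same_type_direct_sum _ JM).
exists K; split=> //; apply/(same_type_direct_sum _ KM)/same_type_exch => //.
Qed.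

End Fixed.

Lemma direct_sum_inj r P P' rk rk' : ranked_partition P rk -> ranked_partition P' rk' ->
  total_rank P rk = r -> total_rank P' rk' = r ->
  direct_sum r P rk = direct_sum r P' rk' -> (P, rk) = (P', rk').
Proof.
move=> ok ok' tot tot' E.
have PT : finset.partition P finset.setT by case/and3P: ok.
have PT' : finset.partition P' finset.setT by case/and3P: ok'.
have e x y : (pblock P x == pblock P y) = (pblock P' x == pblock P' y).
  have [->|xy] := eqVneq x y; first by rewrite !eqxx.
  apply/eqP/eqP => [/(pblock_direct_sum ok tot xy)|/(pblock_direct_sum ok' tot' xy)].
    by rewrite E => /(pblock_direct_sum ok' tot' xy).
  by rewrite -E => /(pblock_direct_sum ok tot xy).
have PP : P = P'.
  rewrite -(preim_partition_pblock PT) -(preim_partition_pblock PT').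
  rewrite /preim_partition /equivalence_partition; apply: eq_imset => x.
  by apply/setP => y; rewrite !inE e.
rewrite -PP in ok' tot' E *; congr (_, _).
have [J JM] := direct_sum_inhabited ok tot.
have JM' := JM; rewrite E in JM'.
apply/ffunP => B; have [BP|BP] := boolP (B \in P).
  by apply: val_inj; rewrite /= (direct_sum_rank JM BP) (direct_sum_rank JM' BP).
case/and3P: ok => _ _ /familyP/(_ B); case/and3P: ok' => _ _ /familyP/(_ B).
by rewrite /rank_choices (negbTE BP) => /eqP -> /eqP ->.
Qed.

(** The blocks are the components of the exchange graph of any one basis J, and their ranks are the
    sizes of their intersections with J. *)
Lemma good_direct_sum r (M : {set rsubset r n}) : is_positroid R M -> smooth R M ->
  exists P rk, [/\ ranked_partition P rk, total_rank P rk = r & M = direct_sum r P rk].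
Proof.
move=> [A [rA A0 AM]] sM; have [J AJ] := rank_minor rA.
have JM : J \in M by rewrite AM.
pose lab := block_label M J.
have labM I : I \in M <-> same_type lab J I := mem_block_labels sM AM JM I.
pose P := preim_partition lab finset.setT.
have PT : finset.partition P finset.setT by apply: preim_partitionP.
have same x y B : B \in P -> x \in B -> y \in B -> lab x = lab y.
  move=> /imsetP[z _ ->]; rewrite !inE /= => /eqP <- /eqP <- //.
have diff x y B B' : B \in P -> B' \in P -> x \in B -> y \in B' -> lab x = lab y -> B = B'.
  move=> /imsetP[z _ ->] /imsetP[w _ ->]; rewrite !inE /= => /eqP zx /eqP wy xy.
  by apply/setP => u; rewrite !inE zx wy xy.
pose rk : {ffun {set 'I_n} -> 'I_n.+1} :=
  [ffun B => if B \in P then inord #|val J :&: B| else ord0].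
have rkE B : B \in P -> nat_of_ord (rk B) = #|val J :&: B|.
  move=> BP; rewrite ffunE BP inordK // ltnS -[X in (_ <= X)%N](card_ord n); exact: max_card.
have mixed x y : x != y -> lab x = lab y -> exists p q,
     [/\ p \in val J, q \notin val J, lab p = lab x & lab q = lab x].
  exact: (block_label_mixed sM AM JM).
have ok : ranked_partition P rk.
  apply/and3P; split=> //.
    apply/asboolP => B B' BP B'P [a [b [c [d [[aB bB cB dB] [ab bc cd]]]]]].
    apply: (diff a b) => //.
    apply: (positroid_noncrossing A0 _ mixed ab bc cd); last 2 first.
    - exact: same BP aB cB.
    - exact: same B'P bB dB.
    by move=> I; rewrite -AM.
  apply/familyP => B; rewrite /rank_choices; case: ifP => BP; last by rewrite ffunE BP inE.
  rewrite unfold_in /= /block_rank_ok rkE //; case: eqP => [B1|B1].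
    by rewrite -B1 subset_leq_card // finset.subsetIr.
  have B2 : (1 < #|B|)%N.
    have : (0 < #|B|)%N by rewrite card_gt0; apply: partition_neq0 PT BP.
    by rewrite leq_eqVlt => /orP[/eqP /esym|].
  have /card_gt1P[x [y [xB yB xy]]] := B2.
  have [p [q [pJ qJ lp lq]]] := mixed x y xy (same _ _ _ BP xB yB).
  have inB z : lab z = lab x -> z \in B.
    by move: BP xB => /imsetP[w _ ->]; rewrite !inE /= => /eqP -> ->.
  apply/andP; split; first by apply/card_gt0P; exists p; rewrite inE pJ inB.
  apply: proper_card; apply/properP; split; first exact: finset.subsetIr.
  by exists q; rewrite ?inE ?(negbTE qJ) ?inB.
have tot : total_rank P rk = r.
  rewrite /total_rank -(eqP (valP J)) -sum1_card (partition_big (pblock P) [in P]) /=.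
    apply: eq_bigr => B BP; rewrite rkE // -sum1_card; apply: eq_bigl => x.
    by rewrite inE (pblock_eqP ok).
  by move=> x _; apply: (pblock_in ok).
have JD : J \in direct_sum r P rk by rewrite inE; apply/forall_inP => B BP; rewrite rkE.
exists P, rk; split=> //; apply/setP => I.
apply/idP/idP => [/labM|/(same_type_direct_sum ok I JD)].
  move=> [s Hs]; apply/(same_type_direct_sum ok I JD); exists s => i.
  have xP := pblock_in ok.
  apply: (diff (subset_enum J i) (subset_enum I (s i))) => //.
  - by rewrite mem_pblock (cover_partition PT).
  - by rewrite mem_pblock (cover_partition PT).
move=> [s Hs]; apply/labM; exists s => i.
apply: (same _ _ (pblock P (subset_enum J i))); first exact: (pblock_in ok).
  by rewrite mem_pblock (cover_partition PT).
by rewrite Hs mem_pblock (cover_partition PT).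
Qed.

Lemma num_smooth_positroidsE : num_smooth_positroids R n =
  (\sum_(P : {set {set 'I_n}} | finset.partition P finset.setT && noncrossing P)
    \prod_(B in P) s_c #|B|)%N.
Proof.
rewrite -card_ranked_partitions /num_smooth_positroids.
set V := [set v | _].
have rk_le v : v \in V -> (total_rank v.1 v.2 < n.+1)%N.
  rewrite inE => ok; have PT : finset.partition v.1 finset.setT by case/and3P: ok.
  rewrite ltnS -[X in (_ <= X)%N](card_ord n) -cardsT (card_partition PT).
  by apply: leq_sum => B BP; apply: (ranked_partition_block ok BP).1.
rewrite -[RHS]sum1_card (partition_big (fun v => inord (total_rank v.1 v.2) : 'I_n.+1) xpredT) //=.
apply: eq_bigr => r _; rewrite sum1_card.
pose Vr := [set v in V | total_rank v.1 v.2 == r].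
have -> : #|[pred v | (v \in V) && (inord (total_rank v.1 v.2) == r)]| = #|Vr|.
  apply: eq_card => v; rewrite !inE; case ok: (ranked_partition _ _) => //=.
  by rewrite -val_eqE /= inordK // rk_le // inE.
rewrite -(@card_in_imset _ _ (fun v => direct_sum r v.1 v.2) Vr).
  apply: eq_card => M; rewrite inE; apply/asboolP/imsetP => [[pM sM]|[v]].
    have [P [rk [ok tot ->]]] := good_direct_sum pM sM.
    by exists (P, rk) => //; rewrite !inE /= ok tot eqxx.
  by rewrite !inE => /andP[ok /eqP tot] ->; apply: direct_sum_good.
move=> [P rk] [P' rk']; rewrite !inE /= => /andP[ok /eqP tot] /andP[ok' /eqP tot'].
exact: direct_sum_inj.
Qed.

End BlockRanks.

Theorem corollary9p3 (R : realType) (n : nat) (hn : (1 <= n)%N) :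
  (num_smooth_positroids R n)%:R = ((n.+1)`!%:R)^-1 * \sum_(1 <= k < n.+1) ((n.+1 ^_ k) * bell_sc n k)%N%:R :> rat
  /\ ((n.+1)`!%:R)^-1 * \sum_(1 <= k < n.+1) ((n.+1 ^_ k) * bell_sc n k)%N%:R
     = \sum_(1 <= k < n.+1) (bell_sc n k)%:R / ((n - k + 1)`!)%:R :> rat.
Proof.
have E : ((n.+1)`!%:R)^-1 * \sum_(1 <= k < n.+1) ((n.+1 ^_ k) * bell_sc n k)%N%:R
     = \sum_(1 <= k < n.+1) (bell_sc n k)%:R / ((n - k + 1)`!)%:R :> rat.
  have nz m : m`!%:R != 0 :> rat by rewrite pnatr_eq0 -lt0n fact_gt0.
  rewrite mulr_sumr !big_nat; apply: eq_bigr => k /andP[_ kn].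
  have F : (n.+1 ^_ k * (n - k + 1)`!)%N = (n.+1)`!.
    by rewrite addn1 -subSn // ffact_fact // ltnW.
  apply: (canRL (mulfK (nz _))); rewrite -mulrA -natrM mulnAC F natrM.
  by rewrite mulKf.
split=> //; rewrite E num_smooth_positroidsE //.
rewrite /bell_sc -(sum_noncrossing s_c hn) natr_sum; apply: eq_bigr => P _.
by rewrite /nc_weight natr_prod.
Qed.
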